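(* Let $(V,Y,\mathbf 1,\omega)$ be a vertex operator algebra with $V_{(0)}=\mathbb{C}\mathbf 1$ and $V_{(n)}=0$ for $n<0$, and let $u\in V_{(1)}$ satisfy $L(1)u=0$. Let $W=\coprod_{n,\alpha\in\mathbb{C}}W_{\langle n\rangle}^{[\alpha]}$, with vertex operator map $Y_W$, be a strongly $\mathbb{C}$-graded generalized $V$-module, equipped with the action $e^{2\pi\sqrt{-1}\,(Y_W)_0(u)}$ of the automorphism $e^{2\pi\sqrt{-1}\,Y_0(u)}$ of $V$, whose additional $\mathbb{C}$-grading is given by the generalized eigenspaces of $(Y_W)_0(u)$. Define $Y_W^{(u)}(v,x)w=Y_W(\Delta_V^{(u)}(x)v,x)w$ for $v\in V$, $w\in W$. Equip $W$ with the $\mathbb{C}\times\mathbb{C}$-grading $W=\coprod_{n,\alpha\in\mathbb{C}}W_{[n]}^{[\alpha]}$ where $$W_{[n]}^{[\alpha]}=W_{\langle n-\alpha+\frac12\mu\rangle}^{[\alpha]},\qquad Y_1(u)u=\mu\mathbf 1,$$ that is, $w\in W_{[n]}^{[\alpha]}$ if and only if $w$ is a generalized eigenvector for $L_W^{(u)}(0)$ with eigenvalue $n$ and a generalized eigenvector for $(Y_W)_0(u)$ with eigenvalue $\alpha$, where $Y_W^{(u)}(\omega,x)=\sum_{n\in\mathbb{Z}}L_W^{(u)}(n)x^{-n-2}$. Then $(W,Y_W^{(u)})$ is a strongly $\mathbb{C}$-graded generalized $e^{2\pi\sqrt{-1}\,Y_0(u)}$-twisted $V$-module.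
   Context: Notation. $V=\coprod_{n\in\mathbb{Z}}V_{(n)}$ has finite-dimensional homogeneous subspaces, $Y(v,x)=\sum_{n\in\mathbb{Z}}Y_n(v)x^{-n-1}$, and $L(n)=Y_{n+1}(\omega)$. For a module, $Y_W(v,x)=\sum_{n\in\mathbb{Z}}(Y_W)_n(v)x^{-n-1}$ and $L_W(n)=(Y_W)_{n+1}(\omega)$. $W\{x\}$ is the space of formal series in arbitrary complex powers of $x$ with coefficients in $W$, and $W\{x\}[\log x]$ is the space of polynomials in the formal variable $\log x$ with coefficients in $W\{x\}$, with $\frac{d}{dx}\log x=x^{-1}$. Since $Y_1(u)u\in V_{(0)}=\mathbb{C}\mathbf 1$, the number $\mu\in\mathbb{C}$ is well defined. The series $\Delta_V^{(u)}(x)$. The operator $Y_0(u)=\mathrm{Res}_xY(u,x)$ preserves each finite-dimensional $V_{(n)}$. Let $V^{[\alpha]}$ be its generalized eigenspace with eigenvalue $\alpha\in\mathbb{C}$; this is the additional $\mathbb{C}$-grading of $V$. Let $(Y_0(u))_{ss}$ be the semisimple part of $Y_0(u)$ (acting as $\alpha$ on $V^{[\alpha]}$). Then $$\Delta_V^{(u)}(x)=x^{(Y_0(u))_{ss}}\,e^{(Y_0(u)-(Y_0(u))_{ss})\log x}\exp\Big(\sum_{n\ge 1}\frac{(-1)^n}{-n}Y_n(u)x^{-n}\Big),$$ where $x^{(Y_0(u))_{ss}}$ acts as $x^{\alpha}$ on $V^{[\alpha]}$. Strongly $\mathbb{C}$-graded vertex operator algebra: a vertex operator algebra with a second grading $V=\coprod_{\alpha\in\mathbb{C}}V^{[\alpha]}$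 such that $V_{(n)}=\coprod_\alpha V_{(n)}^{[\alpha]}$ with $V_{(n)}^{[\alpha]}=V_{(n)}\cap V^{[\alpha]}$, $\mathbf 1,\omega\in V^{[0]}$, and $Y_n(v)V^{[\beta]}\subset V^{[\alpha+\beta]}$ for $v\in V^{[\alpha]}$. It is compatible with an automorphism $g$ if each $v\in V^{[\alpha]}$ is a generalized eigenvector of $g$ with eigenvalue $e^{2\pi\sqrt{-1}\,\alpha}$. Strongly $\mathbb{C}$-graded generalized $V$-module: a vector space $W=\coprod_{n,\alpha\in\mathbb{C}}W_{\langle n\rangle}^{[\alpha]}$ with a vertex operator map $Y_W:V\otimes W\to W((x))$ satisfying the identity property, the Jacobi identity and the $L(-1)$-derivative property, such that $W_{\langle n\rangle}=\coprod_\alpha W_{\langle n\rangle}^{[\alpha]}$ is the generalized eigenspace of $L_W(0)$ with eigenvalue $n$; $(Y_W)_m(v)W^{[\beta]}\subset W^{[\alpha+\beta]}$ for $v\in V^{[\alpha]}$, where $W^{[\beta]}=\coprod_nW_{\langle n\rangle}^{[\beta]}$; and for all $n,\alpha$, $\dim W_{\langle n\rangle}^{[\alpha]}<\infty$ and $W_{\langle n+l\rangle}^{[\alpha]}=0$ for all sufficiently negative integers $l$. That the additional grading is given by the generalized eigenspaces of $(Y_W)_0(u)$ means $W^{[\alpha]}$ is the generalized eigenspace of $(Y_W)_0(u)$ with eigenvalue $\alpha$. Analytic branches. For $z\in\mathbb{C}^\times$ let $\log z=\log|z|+\sqrt{-1}\arg z$ with $0\le\arg z<2\pi$, and $l_p(z)=\log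 z+2p\pi\sqrt{-1}$ for $p\in\mathbb{Z}$. Give $x$ degree $-1$ and $\log x$ degree $0$. For a grading-preserving linear map $X:W_1\otimes W_2\to W_3\{x\}[\log x]$ between $\mathbb{C}$-graded spaces, its $p$-th analytic branch is $X^p(w_1,z)w_2=X(w_1,x)w_2\big|_{x^n=e^{nl_p(z)},\,\log x=l_p(z)}\in\prod_{n\in\mathbb{C}}(W_3)_{(n)}$. Strongly $\mathbb{C}$-graded generalized $g$-twisted $V$-module (for $V$ strongly $\mathbb{C}$-graded compatibly with $g$): a $\mathbb{C}\times\mathbb{C}$-graded vector space $W=\coprod_{n,\alpha\in\mathbb{C}}W_{[n]}^{[\alpha]}$ with a linear map $Y^g:V\otimes W\to W\{x\}[\log x]$, preserving the first $\mathbb{C}$-grading (so that branches $Y^{g;p}$ are defined), and an action of $g$ on $W$, such that: 1. (Grading restriction) For all $n,\alpha\in\mathbb{C}$, $\dim W_{[n]}^{[\alpha]}<\infty$ and $W_{[n+l]}^{[\alpha]}=0$ for all sufficiently negative real numbers $l$. 2. (Equivariance) $Y^{g;p+1}(gv,z)w=Y^{g;p}(v,z)w$ for $p\in\mathbb{Z}$, $z\in\mathbb{C}^\times$, $v\in V$, $w\in W$. 3. (Identity) $Y^g(\mathbf 1,x)w=w$ for $w\in W$. 4. (Duality) Let $W'=\coprod_{n,\alpha}(W_{[n]}^{[\alpha]})^*$ and let $\pi_n$ be the projection onto the subspace of weight $n$ (of $W$, resp. $V$). For all $v_1,v_2\in V$, $w\in W$, $w'\in W'$ there exists a multivalued analytic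 function of the form $f(z_1,z_2)=\sum_{i,j,k,l=0}^Na_{ijkl}z_1^{m_i}z_2^{n_j}(\log z_1)^k(\log z_2)^l(z_1-z_2)^{-t}$ with $N\in\mathbb{N}$, $a_{ijkl},m_i,n_j\in\mathbb{C}$ and $t\in\mathbb{Z}_+$ such that for $p\in\mathbb{Z}$ the series $\sum_{n\in\mathbb{C}}\langle w',Y^{g;p}(v_1,z_1)\pi_nY^{g;p}(v_2,z_2)w\rangle$, $\sum_{n\in\mathbb{C}}\langle w',Y^{g;p}(v_2,z_2)\pi_nY^{g;p}(v_1,z_1)w\rangle$, $\sum_{n\in\mathbb{C}}\langle w',Y^{g;p}(\pi_nY(v_1,z_1-z_2)v_2,z_2)w\rangle$ are absolutely convergent in the regions $|z_1|>|z_2|>0$, $|z_2|>|z_1|>0$, $|z_2|>|z_1-z_2|>0$, respectively, to the branch $$\sum_{i,j,k,l=0}^Na_{ijkl}e^{m_il_p(z_1)}e^{n_jl_p(z_2)}l_p(z_1)^kl_p(z_2)^l(z_1-z_2)^{-t}$$ of $f(z_1,z_2)$. 5. ($L^g(0)$-grading) Writing $Y^g(\omega,x)=\sum_{n\in\mathbb{Z}}L^g(n)x^{-n-2}$, for each $w\in W_{[n]}^{[\alpha]}$ there is $K\in\mathbb{Z}_+$ with $(L^g(0)-n)^Kw=0$. 6. (Grading compatibility) $Y^g(v,x)w\in W^{[\alpha+\beta]}\{x\}[\log x]$ for $v\in V^{[\alpha]}$, $w\in W^{[\beta]}$. 7. ($L(-1)$-derivative) $\frac{d}{dx}Y^g(v,x)=Y^g(L(-1)v,x)$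 for $v\in V$.
   Formalization: Corrected: the twisted operator uses Delta_V^{(-u)}; the grading is W_[n]^[α]=W_<n+α-μ/2>^[α]; in the third duality region log z1 is the branch within π/2 of l_p(z2); W_<n+l>^[α]=0 is assumed for all sufficiently negative real l. *)

(* Defs.v *)
From HB Require Import structures.
From mathcomp Require Export all_boot all_order all_algebra.
From mathcomp Require Export all_classical all_reals all_analysis.
From mathcomp Require Export complex.

Set Implicit Arguments.
Unset Strict Implicit.
Unset Printing Implicit Defensive.

Export Order.TTheory GRing.Theory Num.Theory.

Global Open Scope classical_set_scope.
Global Open Scope complex_scope.
Global Open Scope ring_scope.

(* Conventions.
   - The complex numbers are R[i] for a realType R.
   - A vertex operator map Y is given by its modes: Y v n w = Y_n(v)w, the
     coefficient of x^(-n-1) in Y(v,x)w.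
   - An element of W{x}[log x] is given by its coefficients f a k (a complex,
     k a natural number), f a k being the coefficient of x^a (log x)^k.
   - Subspaces are classical sets; \sum_(i \in [set: I]) F i is the sum of a
     finitely supported family (and 0 for an infinite support; the families
     below have finite support under the axioms of the structures at hand). *)

Section ComplexFunctions.
Variable R : realType.
Local Notation C := R[i].

Definition cexp (z : C) : C :=
  (expR (complex.Re z))%:C * (cos (complex.Im z) +i* sin (complex.Im z)).

(* The argument in [0, 2 pi[. *)
Definition carg (z : C) : R :=
  xget 0 [set t : R | 0 <= t < 2 * pi /\ z = `|z| * (cos t +i* sin t)].

(* The branch l_p(z) = log |z| + i arg z + 2 p pi i of the logarithm. *)
Definition lbr (p : int) (z : C) : C :=
  ln (Normc.normc z) +i* (carg z + 2 * p%:~R * pi).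

Definition two_pi_i : C := 0 +i* (2 * pi).

(* Generalized binomial coefficient of an integer. *)
Definition binz (m : int) (i : nat) : C :=
  (\prod_(j < i) (m%:~R - j%:R)) / i`!%:R.

Definition seq_cvgC (f : nat -> C) (s : C) : Prop :=
  forall e : R, 0 < e ->
    exists N : nat, forall n : nat, (N <= n)%N -> `|f n - s| < e%:C.

(* The family f, indexed by an arbitrary set, is absolutely summable, with
   sum s. *)
Definition abs_sums_to (I : choiceType) (f : I -> C) (s : C) : Prop :=
  summable [set: I] (fun i => (Normc.normc (f i))%:E) /\
  forall e : R, 0 < e -> exists2 A : set I, finite_set A &
    forall B : set I, finite_set B -> A `<=` B ->
      `|\sum_(i \in B) f i - s| < e%:C.

End ComplexFunctions.

Section LinearAlgebra.
Variables (R : realType) (M : lmodType R[i]).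
Local Notation C := R[i].

Definition subspace (A : set M) : Prop :=
  A 0 /\ forall (c : C) x y, A x -> A y -> A (c *: x + y).

Definition fin_dim (A : set M) : Prop :=
  exists s : seq M, forall x, A x ->
    exists c : 'I_(size s) -> C, x = \sum_i c i *: s`_i.

Definition decomposition (I : choiceType) (A : I -> set M) (x : M)
    (f : I -> M) : Prop :=
  [/\ forall i, A i (f i), finite_set [set i | f i != 0]
    & x = \sum_(i \in [set: I]) f i].

Definition direct_sum (I : choiceType) (A : I -> set M) : Prop :=
  (forall i, subspace (A i)) /\ forall x, exists! f, decomposition A x f.

(* The component of x in A i, when M is the direct sum of the A i. *)
Definition component (I : choiceType) (A : I -> set M) (i : I) (x : M) : M :=
  xget (fun=> 0) [set f | decomposition A x f] i.

Definition sum_of (I : choiceType) (A : I -> set M) : set M :=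
  [set x | exists f, decomposition A x f].

Definition gen_eigenspace (T : M -> M) (c : C) : set M :=
  [set x | exists K : nat, iter K (fun y => T y - c *: y) x = 0].

(* The exponential of a locally finite operator T: the terms of the series
   sum_k T^k x / k! lie in a finite-dimensional subspace, where convergence
   can be tested on linear functionals. *)
Definition exp_op (T : M -> M) (x : M) : M :=
  xget 0 [set y | forall f : {scalar M},
    seq_cvgC (fun N => f (\sum_(k < N) (k`!%:R)^-1 *: iter k T x)) (f y)].

End LinearAlgebra.

Section FormalCalculus.
Variables (R : realType) (M : lmodType R[i]).
Local Notation C := R[i].

(* The coefficient of y^m in B(y)^j x and in exp(B(y)) x, for the series
   B(y) = sum_(n >= 1) b n y^n with operator coefficients (b 0 is not used);
   B(y)^j starts at y^j. *)
Fixpoint series_pow (b : nat -> M -> M) (j m : nat) (x : M) : M :=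
  match j with
  | 0 => if m == 0%N then x else 0
  | j'.+1 => \sum_(1 <= n < m.+1) b n (series_pow b j' (m - n) x)
  end.

Definition series_exp (b : nat -> M -> M) (m : nat) (x : M) : M :=
  \sum_(j < m.+1) (j`!%:R)^-1 *: series_pow b j m x.

End FormalCalculus.

Section VertexOperators.
Variables (R : realType) (V W : lmodType R[i]).
Local Notation C := R[i].
Variables (YV : V -> int -> V -> V) (YW : V -> int -> W -> W).

Definition bilinear_modes : Prop :=
  (forall v n, linear (YW v n)) /\ (forall n w, linear (fun v => YW v n w)).

Definition truncated : Prop :=
  forall v w, exists N : int, forall n, N <= n -> YW v n w = 0.

(* The coefficient of x0^(-l-1) x1^(-m-1) x2^(-n-1) in the Jacobi identity
     x0^-1 delta((x1-x2)/x0) Y(v1,x1)Y(v2,x2)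
       - x0^-1 delta((x2-x1)/-x0) Y(v2,x2)Y(v1,x1)
     = x2^-1 delta((x1-x0)/x2) Y(Y(v1,x0)v2,x2),
   where x2^-1 delta((x1-x0)/x2) = x1^-1 delta((x2+x0)/x1). *)
Definition jacobi : Prop := forall (v1 v2 : V) (w : W) (l m n : int),
  \sum_(i \in [set: nat])
     ((-1) ^+ i * binz R l i) *: YW v1 (m + l - i%:Z) (YW v2 (n + i%:Z) w)
  - \sum_(i \in [set: nat])
     ((-1) ^ (l + i%:Z) * binz R l i) *:
        YW v2 (n + l - i%:Z) (YW v1 (m + i%:Z) w)
  = \sum_(i \in [set: nat])
     binz R m i *: YW (YV v1 (l + i%:Z) v2) (m + n - i%:Z) w.

(* d/dx Y_W(v,x) = Y_W(L(-1)v,x). *)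
Definition Lm1_derivative (omega : V) : Prop := forall v n w,
  YW (YV omega 0 v) n w = - (n%:~R : C) *: YW v (n - 1) w.

End VertexOperators.

Definition Lop (R : realType) (V W : lmodType R[i]) (Y : V -> int -> W -> W)
  (omega : V) (n : int) : W -> W := Y omega (n + 1).

Section VertexOperatorAlgebra.
Variables (R : realType) (V : lmodType R[i]).
Local Notation C := R[i].
Variables (Vn : int -> set V) (Y : V -> int -> V -> V) (vac omega : V).
Local Notation L := (Lop Y omega).

Record is_voa : Prop := {
  voa_graded : direct_sum Vn;
  voa_fin_dim : forall n, fin_dim (Vn n);
  voa_lower : exists N : int, forall n, n < N -> Vn n `<=` [set 0];
  voa_bilinear : bilinear_modes Y;
  voa_truncated : truncated Y;
  voa_vac : Vn 0 vac;
  voa_omega : Vn 2 omega;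
  voa_identity : forall n w, Y vac n w = if n == -1 then w else 0;
  voa_creation : forall v,
    (forall n, 0 <= n -> Y v n vac = 0) /\ Y v (-1) vac = v;
  voa_jacobi : jacobi Y Y;
  voa_virasoro : exists c : C, forall m n v,
    L m (L n v) - L n (L m v) =
      (m - n)%:~R *: L (m + n) v
      + (if m + n == 0 then (m ^+ 3 - m)%:~R / 12 * c else 0) *: v;
  voa_L0 : forall n v, Vn n v -> L 0 v = n%:~R *: v;
  voa_derivative : Lm1_derivative Y Y omega
}.

Record voa_automorphism (g : V -> V) : Prop := {
  aut_linear : linear g;
  aut_bijective : bijective g;
  aut_vac : g vac = vac;
  aut_omega : g omega = omega;
  aut_Y : forall v n w, g (Y v n w) = Y (g v) n (g w)
}.

(* Va alpha is the subspace V^[alpha] of an additional grading. *)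
Record strongly_C_graded_voa (Va : C -> set V) : Prop := {
  sg_voa : is_voa;
  sg_graded : direct_sum Va;
  sg_bigraded : forall n, Vn n = sum_of (fun alpha => Vn n `&` Va alpha);
  sg_vac : Va 0 vac;
  sg_omega : Va 0 omega;
  sg_Y : forall alpha beta v n w,
    Va alpha v -> Va beta w -> Va (alpha + beta) (Y v n w)
}.

Definition grading_compatible (g : V -> V) (Va : C -> set V) : Prop :=
  forall alpha, Va alpha `<=` gen_eigenspace g (cexp (two_pi_i R * alpha)).

End VertexOperatorAlgebra.

Section DoubleGradings.
Variables (R : realType) (W : lmodType R[i]).
Local Notation C := R[i].
(* Wg n alpha: weight n, additional degree alpha. *)
Variable Wg : C -> C -> set W.

Definition weight_space (n : C) : set W := sum_of (fun alpha => Wg n alpha).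
Definition degree_space (alpha : C) : set W := sum_of (fun n => Wg n alpha).
Definition doubly_graded : Prop :=
  direct_sum (fun i : C * C => Wg i.1 i.2).

(* The elements of the direct sum of the duals of the Wg n alpha, as linear
   functionals on W. *)
Definition graded_dual (f : {scalar W}) : Prop :=
  finite_set [set i : C * C | exists2 w, Wg i.1 i.2 w & f w != 0].

(* Pairing with an element of the product of the weight spaces, given by the
   family of its components. *)
Definition pairing (f : {scalar W}) (X : C -> W) : C :=
  \sum_(n \in [set: C]) f (X n).

End DoubleGradings.

Section GradedModule.
Variables (R : realType) (V W : lmodType R[i]).
Local Notation C := R[i].
Variables (Y : V -> int -> V -> V) (vac omega : V) (Va : C -> set V).
Variables (Wg : C -> C -> set W) (YW : V -> int -> W -> W).

Record strongly_C_graded_module : Prop := {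
  gm_graded : doubly_graded Wg;
  gm_bilinear : bilinear_modes YW;
  gm_truncated : truncated YW;
  gm_identity : forall n w, YW vac n w = if n == -1 then w else 0;
  gm_jacobi : jacobi Y YW;
  gm_derivative : Lm1_derivative Y YW omega;
  gm_weight : forall n, weight_space Wg n = gen_eigenspace (Lop YW omega 0) n;
  gm_degree : forall alpha beta v m w,
    Va alpha v -> degree_space Wg beta w ->
    degree_space Wg (alpha + beta) (YW v m w);
  gm_fin_dim : forall n alpha, fin_dim (Wg n alpha);
  gm_lower : forall n alpha, exists N : int, forall l : int, l <= N ->
    Wg (n + l%:~R) alpha `<=` [set 0]
}.

End GradedModule.

(* The spaces of weight n+l vanish for all sufficiently negative real numbers l.
   This does not follow from gm_lower, whose bound may vary with n mod Z. *)
Definition real_lower_bounded (R : realType) (W : lmodType R[i])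
    (Wg : R[i] -> R[i] -> set W) : Prop :=
  forall n alpha, exists B : R, forall l : R, l <= B ->
    Wg (n + l%:C) alpha `<=` [set 0].

Section TwistedModule.
Variables (R : realType) (V W : lmodType R[i]).
Local Notation C := R[i].
Variables (Vn : int -> set V) (Y : V -> int -> V -> V) (vac omega : V).
Variables (Va : C -> set V) (g : V -> V).
(* gW is the action of g on W. *)
Variables (Wg : C -> C -> set W) (Yg : V -> W -> C -> nat -> W) (gW : W -> W).

(* The weight n component of the branch Y^{g;p}(v,z)w. *)
Definition branch (p : int) (v : V) (z : C) (w : W) (n : C) : W :=
  \sum_(ak \in [set: C * nat])
    (cexp (ak.1 * lbr p z) * lbr p z ^+ ak.2) *:
      component (weight_space Wg) n (Yg v w ak.1 ak.2).

(* pi_n Y(v1,z)v2. *)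
Definition Y_at (v1 : V) (z : C) (v2 : V) (n : int) : V :=
  \sum_(m \in [set: int]) z ^ (- m - 1) *: component Vn n (Y v1 m v2).

(* The value of f(z1,z2) when log z1, log z2 take the values l1, l2. *)
Definition f_branch (N : nat) (a : nat -> nat -> nat -> nat -> C)
    (m n : nat -> C) (t : nat) (z1 z2 l1 l2 : C) : C :=
  \sum_(i < N.+1) \sum_(j < N.+1) \sum_(k < N.+1) \sum_(l < N.+1)
    a i j k l * cexp (m i * l1) * cexp (n j * l2) * l1 ^+ k * l2 ^+ l
      * (z1 - z2) ^- t.

(* In the region |z2| > |z1-z2| > 0 the numbers z1 and z2 may lie on opposite
   sides of the cut arg = 0 of the l_p, and the series (single-valued in z1 for
   fixed log z2) converges to the branch of f with log z2 = l_p(z2) and log z1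
   the logarithm l_q(z1) close to it; q = p when |arg z1 - arg z2| < pi/2. *)
Definition duality : Prop :=
  forall (v1 v2 : V) (w : W) (w' : {scalar W}), graded_dual Wg w' ->
  exists (N : nat) (a : nat -> nat -> nat -> nat -> C) (m n : nat -> C)
         (t : nat),
  (0 < t)%N /\
  forall (p : int) (z1 z2 : C),
  let f := f_branch N a m n t z1 z2 in
  [/\ `|z1| > `|z2| -> `|z2| > 0 ->
        abs_sums_to
          (fun s : C => pairing w' (branch p v1 z1 (branch p v2 z2 w s)))
          (f (lbr p z1) (lbr p z2)),
      `|z2| > `|z1| -> `|z1| > 0 ->
        abs_sums_to
          (fun s : C => pairing w' (branch p v2 z2 (branch p v1 z1 w s)))
          (f (lbr p z1) (lbr p z2))
    & `|z2| > `|z1 - z2| -> `|z1 - z2| > 0 ->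
        forall q : int,
        `|complex.Im (lbr q z1 - lbr p z2)| < pi / 2 ->
        abs_sums_to
          (fun s : int => pairing w' (branch p (Y_at v1 (z1 - z2) v2 s) z2 w))
          (f (lbr q z1) (lbr p z2))].

Record strongly_C_graded_twisted_module : Prop := {
  tw_voa : strongly_C_graded_voa Vn Y vac omega Va;
  tw_automorphism : voa_automorphism Y vac omega g;
  tw_compatible : grading_compatible g Va;
  tw_graded : doubly_graded Wg;
  tw_linear_l : forall w a k, linear (fun v => Yg v w a k);
  tw_linear_r : forall v a k, linear (fun w => Yg v w a k);
  tw_log : forall v w, exists K : nat, forall a k, (K <= k)%N ->
    Yg v w a k = 0;
  tw_weight : forall (m : int) n v w a k, Vn m v -> weight_space Wg n w ->
    weight_space Wg (m%:~R + n + a) (Yg v w a k);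
  tw_action : linear gW /\ bijective gW;
  tw_fin_dim : forall n alpha, fin_dim (Wg n alpha);
  tw_lower : real_lower_bounded Wg;
  tw_equivariance : forall p z v w n, z != 0 ->
    branch (p + 1) (g v) z w n = branch p v z w n;
  tw_identity : forall w a k,
    Yg vac w a k = if (a == 0) && (k == 0%N) then w else 0;
  tw_duality : duality;
  (* Y^g(omega,x) has integral powers of x and no log x; L^g(0) is its
     coefficient of x^-2. *)
  tw_omega : forall w a k, Yg omega w a k != 0 ->
    k = 0%N /\ exists n : int, a = n%:~R;
  tw_L0 : forall n alpha,
    Wg n alpha `<=` gen_eigenspace (fun w => Yg omega w (- 2) 0%N) n;
  tw_degree : forall alpha beta v w a k,
    Va alpha v -> degree_space Wg beta w ->
    degree_space Wg (alpha + beta) (Yg v w a k);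
  (* d/dx Y^g(v,x)w = Y^g(L(-1)v,x)w. *)
  tw_derivative : forall v w a k,
    Yg (Lop Y omega (-1) v) w a k =
      (a + 1) *: Yg v w (a + 1) k + k.+1%:R *: Yg v w (a + 1) k.+1
}.

End TwistedModule.

Section DeltaSeries.
Variables (R : realType) (V W : lmodType R[i]).
Local Notation C := R[i].
Variables (Y : V -> int -> V -> V) (u : V).

Definition semisimple_part (v : V) : V :=
  \sum_(alpha \in [set: C])
    alpha *: component (gen_eigenspace (Y u 0)) alpha v.

Definition nilpotent_part (v : V) : V := Y u 0 v - semisimple_part v.

(* The coefficient of x^(-m) in exp(sum_(n >= 1) (-1)^n/(-n) Y_n(u) x^(-n)) v.*)
Definition Delta_exp (m : nat) (v : V) : V :=
  series_exp (fun n y => ((-1) ^+ n / (- n%:R)) *: Y u n%:Z y) m v.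

(* The coefficient of x^a (log x)^k in Delta_V^(u)(x)v; the factor
   x^(semisimple part) selects the summand of generalized eigenvalue a + m of
   the coefficient of x^(-m). *)
Definition Delta (v : V) (a : C) (k : nat) : V :=
  \sum_(m \in [set: nat])
    component (gen_eigenspace (Y u 0)) (a + m%:R)
      ((k`!%:R)^-1 *: iter k nilpotent_part (Delta_exp m v)).

(* The coefficient of x^a (log x)^k in Y_W(Delta_V^(u)(x)v,x)w.
   Pitfall: Delta_V^(u) multiplies the generalized eigenspace alpha of Y_0(u)
   by x^alpha, so passing from l_p to l_(p+1) acts by e^(2 pi i Y_0(u)); the
   equivariance Y^{g;p+1}(gv,z) = Y^{g;p}(v,z) asks for g^-1.  Hence the
   operator that is twisted for g = e^(2 pi i Y_0(u)) is that of -u. *)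
Definition Delta_modified (YW : V -> int -> W -> W) (v : V) (w : W)
    (a : C) (k : nat) : W :=
  \sum_(n \in [set: int]) YW (Delta v (a + (n + 1)%:~R) k) n w.

End DeltaSeries.

(* Main.v *)
(* Write Delta(x) = sum_M D_M x^(T - M) for the series attached to -u, with
   T = Y_0(-u).  The D_M are determined by D_0 = 1 and the recursion
   M D_M = sum_(n >= 1) (-1)^(n+1) Y_n(-u) D_(M-n); comparing recursions gives the conjugation formula
     Delta(x2) Y(v1, x0) = Y(Delta(x2 + x0) v1, x0) Delta(x2),
   where (x2 + x0)^T is expanded in powers of x0 as sum_s binom(T, s) x2^(T-s) x0^s.
   Moreover Delta(x) omega = omega - u x^-1 + (mu/2) x^-2, so that
   L^g(0) = L(0) - Y_0(u) + mu/2, which gives the grading.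

   Duality: on homogeneous vectors the twisted matrix coefficients are finite
   combinations of untwisted ones with coefficients z^a (log z)^k.  For the
   untwisted ones, (z1 - z2)^t times the product is a Laurent polynomial by weak
   commutativity, and weak associativity shows that the iterate expands the same
   rational function.  In the region |z2| > |z1 - z2| the coefficients binom(T, s)
   of the conjugation formula sum up to exp(T log(1 + (z1-z2)/z2)), and
   log z2 + log(1 + (z1-z2)/z2) is the logarithm of z1 close to log z2. *)

(* The operator [Y u 0] need not be semisimple, so every power x^T carries powers of log x. T is
   therefore split into a semisimple part, which contributes scalar exponentials, and a locally
   nilpotent part N, whose exponential is a finite sum on each vector; binom(T, s) becomes a
   polynomial in N whose coefficients [beta k s a] have, in s, the generating series (1 + y)^a log(1
   + y)^k / k!. That identity turns the algebraic conjugation formula into the passage from log z2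
   to log z1. Convergence rests on one device: in each region the untwisted series, multiplied by a
   power of 1 + d with |d| < 1, becomes a finite sum, and dividing by 1 + d ([asum_divide]) yields
   absolute convergence and the value together. The pole order t must be the same for all
   homogeneous constituents of v1, v2 and w, so the expansions are shown for all large t before they
   are added. The operator [exp_op] is a weak limit; the finite-dimensional homogeneous subspaces
   supply enough functionals to identify it with the algebraic exponential. *)
Require Import Defs.
From HB Require Import structures.
From mathcomp Require Import ring lra zify.
Import numFieldNormedType.Exports.

Set Implicit Arguments.
Unset Strict Implicit.
Unset Printing Implicit Defensive.

(** * Absolutely convergent series *)

Section ComplexSeries.
Variable R : realType.
Local Notation C := R[i].
Local Notation nc := (@Normc.normc R).
Implicit Types (z w s t c d : C) (f g : nat -> C).

Lemma normCE z : `|z| = (nc z)%:C. Proof. by []. Qed.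

Lemma nc_ge0 z : 0 <= nc z.
Proof. by case: z => a b; rewrite /Normc.normc sqrtr_ge0. Qed.

Lemma nc_real (x : R) : nc x%:C = `|x|.
Proof. by rewrite /Normc.normc /= expr0n /= addr0 sqrtr_sqr. Qed.

Lemma nc0 : nc 0 = 0. Proof. exact: Normc.normc0. Qed.

Lemma nc1 : nc 1 = 1. Proof. exact: Normc.normc1. Qed.

Lemma nc_eq0 z : (nc z == 0) = (z == 0).
Proof.
apply/eqP/eqP => [/Normc.eq0_normc //|->]; exact: nc0.
Qed.

Lemma nc_gt0 z : (0 < nc z) = (z != 0).
Proof. by rewrite lt_neqAle nc_ge0 andbT eq_sym nc_eq0. Qed.

Lemma ncX z n : nc (z ^+ n) = nc z ^+ n.
Proof.
elim: n => [|n IH]; first by rewrite !expr0 Normc.normc1.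
by rewrite !exprS Normc.normcM IH.
Qed.

Lemma ncD z w : nc (z + w) <= nc z + nc w.
Proof. exact: le_normcD. Qed.

Lemma ncN z : nc (- z) = nc z.
Proof. exact: normcN. Qed.

Lemma ncB z w : nc (z - w) <= nc z + nc w.
Proof. by rewrite -(ncN w) ncD. Qed.

Lemma nc_sum (I : Type) (r : seq I) (P : pred I) (F : I -> C) :
  nc (\sum_(i <- r | P i) F i) <= \sum_(i <- r | P i) nc (F i).
Proof.
elim/big_rec2: _ => [|i x y _ h]; first by rewrite nc0.
by apply: le_trans (ncD _ _) _; rewrite lerD2l.
Qed.

Lemma le_Re_nc z : `|complex.Re z| <= nc z.
Proof. by rewrite -lecR -normCE; exact: normc_ge_Re. Qed.

Lemma le_Im_nc z : `|complex.Im z| <= nc z.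
Proof.
case: z => a b /=; rewrite /Normc.normc -sqrtr_sqr ler_wsqrtr //.
by rewrite lerDr sqr_ge0.
Qed.

Lemma le_nc_ReIm z : nc z <= `|complex.Re z| + `|complex.Im z|.
Proof.
rewrite {1}(complexE z).
apply: le_trans (ncD _ _) _.
rewrite Normc.normcM !nc_real lerD2l.
by rewrite (_ : nc 'i = 1) ?mul1r //= /Normc.normc expr0n expr1n add0r sqrtr1.
Qed.

Lemma ReD z w : complex.Re (z + w) = complex.Re z + complex.Re w.
Proof. by case: z; case: w. Qed.
Lemma ImD z w : complex.Im (z + w) = complex.Im z + complex.Im w.
Proof. by case: z; case: w. Qed.
Lemma ReN z : complex.Re (- z) = - complex.Re z. Proof. by case: z. Qed.
Lemma ImN z : complex.Im (- z) = - complex.Im z. Proof. by case: z. Qed.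
Lemma ReM z w : complex.Re (z * w) =
  complex.Re z * complex.Re w - complex.Im z * complex.Im w.
Proof. by case: z; case: w. Qed.
Lemma ImM z w : complex.Im (z * w) =
  complex.Re z * complex.Im w + complex.Im z * complex.Re w.
Proof. by case: z; case: w. Qed.

Lemma eq_ReIm z w : complex.Re z = complex.Re w ->
  complex.Im z = complex.Im w -> z = w.
Proof. by case: z; case: w => /= ? ? ? ? -> ->. Qed.

Lemma Re_sum (I : Type) (r : seq I) (P : pred I) (F : I -> C) :
  complex.Re (\sum_(i <- r | P i) F i) = \sum_(i <- r | P i) complex.Re (F i).
Proof. by elim/big_rec2: _ => // i x y _ h; rewrite ReD h. Qed.
Lemma Im_sum (I : Type) (r : seq I) (P : pred I) (F : I -> C) :
  complex.Im (\sum_(i <- r | P i) F i) = \sum_(i <- r | P i) complex.Im (F i).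
Proof. by elim/big_rec2: _ => // i x y _ h; rewrite ImD h. Qed.

Lemma seq_cvgCP f s : seq_cvgC f s <-> forall e : R, 0 < e ->
    exists N : nat, forall n : nat, (N <= n)%N -> nc (f n - s) < e.
Proof.
split=> h e /h [N hN]; exists N => n /hN; by rewrite normCE ltcR.
Qed.

Lemma cvgR_seqP (u : nat -> R) (l : R) : (u @ \oo --> l)%classic <->
  forall e : R, 0 < e ->
    exists N : nat, forall n : nat, (N <= n)%N -> `|u n - l| < e.
Proof.
split.
  move=> /cvgrPdist_lt h e e0; have [N _ hN] := h e e0.
  by exists N => n /hN; rewrite distrC.
move=> h; apply/cvgrPdist_lt => e /h [N hN]; exists N => // n /hN.
by rewrite distrC.
Qed.

Lemma seq_cvgC_ReIm f s : seq_cvgC f s <->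
  (complex.Re (f n) @[n --> \oo] --> complex.Re s)%classic /\
  (complex.Im (f n) @[n --> \oo] --> complex.Im s)%classic.
Proof.
rewrite !cvgR_seqP seq_cvgCP; split.
  move=> h; split => e /h [N hN]; exists N => n /hN; apply: le_lt_trans.
    by rewrite -ReN -ReD le_Re_nc.
  by rewrite -ImN -ImD le_Im_nc.
move=> [h1 h2] e e0.
have e20 : 0 < e / 2 by rewrite divr_gt0.
have [N1 hN1] := h1 _ e20; have [N2 hN2] := h2 _ e20.
exists (maxn N1 N2) => n; rewrite geq_max => /andP[/hN1 a /hN2 b].
apply: le_lt_trans (le_nc_ReIm _) _.
rewrite ReD ReN ImD ImN; lra.
Qed.

Lemma seq_cvgC_uniq f s t : seq_cvgC f s -> seq_cvgC f t -> s = t.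
Proof.
move=> /seq_cvgC_ReIm [a b] /seq_cvgC_ReIm [c d].
apply: eq_ReIm; first exact: (cvg_unique _ a c).
exact: (cvg_unique _ b d).
Qed.

Lemma seq_cvgC_cst s : seq_cvgC (fun=> s) s.
Proof.
by apply/seq_cvgCP => e e0; exists 0%N => n _; rewrite subrr nc0.
Qed.

Lemma seq_cvgCD f g s t : seq_cvgC f s -> seq_cvgC g t ->
  seq_cvgC (fun n => f n + g n) (s + t).
Proof.
move=> /seq_cvgC_ReIm [a b] /seq_cvgC_ReIm [c d]; apply/seq_cvgC_ReIm.
split.
  by rewrite ReD; under eq_fun do rewrite ReD; exact: cvgD.
by rewrite ImD; under eq_fun do rewrite ImD; exact: cvgD.
Qed.

Lemma seq_cvgCM f g s t : seq_cvgC f s -> seq_cvgC g t ->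
  seq_cvgC (fun n => f n * g n) (s * t).
Proof.
move=> /seq_cvgC_ReIm [a b] /seq_cvgC_ReIm [c d]; apply/seq_cvgC_ReIm.
split.
  rewrite ReM; under eq_fun do rewrite ReM.
  by apply: cvgB; exact: cvgM.
rewrite ImM; under eq_fun do rewrite ImM.
by apply: cvgD; exact: cvgM.
Qed.

Lemma seq_cvgCZ c f s : seq_cvgC f s -> seq_cvgC (fun n => c * f n) (c * s).
Proof. exact/seq_cvgCM/seq_cvgC_cst. Qed.

Lemma seq_cvgC_sum (I : Type) (r : seq I) (F : I -> nat -> C) (S : I -> C) :
  (forall i, seq_cvgC (F i) (S i)) ->
  seq_cvgC (fun n => \sum_(i <- r) F i n) (\sum_(i <- r) S i).
Proof.
move=> h; elim: r => [|i r IH].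
  rewrite big_nil; under eq_fun do rewrite big_nil.
  exact: seq_cvgC_cst.
rewrite big_cons; under eq_fun do rewrite big_cons.
exact: seq_cvgCD.
Qed.

Lemma seq_cvgC_sub f s (h : nat -> nat) : (forall n, (n <= h n)%N) ->
  seq_cvgC f s -> seq_cvgC (f \o h) s.
Proof.
move=> hh /seq_cvgCP hf; apply/seq_cvgCP => e /hf [N hN]; exists N => n Nn.
by apply: hN; apply: leq_trans (hh n).
Qed.

Lemma seq_cvgC_shift f s (d : nat) : seq_cvgC f s <-> seq_cvgC (fun n => f (n + d)%N) s.
Proof.
split; first by apply: (@seq_cvgC_sub f s (fun n => n + d)%N) => n; exact: leq_addr.
move=> /seq_cvgCP hf; apply/seq_cvgCP => e /hf [N hN]; exists (N + d)%N => n Nn.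
have -> : n = (n - d + d)%N by lia.
by apply: hN; lia.
Qed.

Lemma seq_cvgC_sandwich f g s : seq_cvgC f s ->
  seq_cvgC (fun n => f n - g n) 0 -> seq_cvgC g s.
Proof.
move=> hf /(seq_cvgCZ (-1)) h; have := seq_cvgCD hf h.
rewrite mulr0 addr0; under eq_fun do rewrite mulN1r opprB addrC subrK.
by [].
Qed.

(** Carrying the bound on the norms along with the limit lets Cauchy products ([asum_conv]) and
    unordered sums ([asum_sasum]) be derived directly. *)
Definition asum f s := (exists M : R, forall n, \sum_(k < n) nc (f k) <= M) /\
  seq_cvgC (fun n => \sum_(k < n) f k) s.

(** Real and imaginary parts are dominated by the norm, so both converge absolutely as real
    series. *)
Lemma asum_bound_ex f (M : R) : (forall n, \sum_(k < n) nc (f k) <= M) ->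
  exists s, asum f s.
Proof.
move=> hM.
have aux (h : C -> R) : (forall z, `|h z| <= nc z) ->
    exists l : R, ((\sum_(k < n) h (f k)) @[n --> \oo] --> l)%classic.
  move=> hh.
  have : cvgn [normed series (fun k => h (f k))].
    apply: nondecreasing_is_cvgn.
      by apply: nondecreasing_series => n _ _; rewrite normr_ge0.
    exists M => _ [n _ <-]; apply: le_trans (hM n).
    rewrite [X in X <= _](_ : _ = \sum_(i < n) `|h (f i)|); last exact: big_mkord.
    by apply: ler_sum => i _.
  move=> /normed_cvg hc; exists (limn (series (fun k => h (f k)))).
  by move: hc; rewrite seriesEord.
have [a ha] := aux _ le_Re_nc.
have [b hb] := aux _ le_Im_nc.
exists (a +i* b); split; first by exists M.
apply/seq_cvgC_ReIm; split => /=.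
  by under eq_fun do rewrite Re_sum.
by under eq_fun do rewrite Im_sum.
Qed.

Lemma asum_uniq f s t : asum f s -> asum f t -> s = t.
Proof. by move=> [_ h] [_ k]; exact: seq_cvgC_uniq h k. Qed.

Lemma eq_asum f g s : f =1 g -> asum f s -> asum g s.
Proof. by move=> /funext ->. Qed.

Lemma asumD f g s t : asum f s -> asum g t -> asum (fun n => f n + g n) (s + t).
Proof.
move=> [[M hM] h] [[K hK] k]; split.
  exists (M + K) => n.
  apply: le_trans (lerD (hM n) (hK n)).
  by rewrite -big_split /=; apply: ler_sum => i _; exact: ncD.
by under eq_fun do rewrite big_split /=; exact: seq_cvgCD.
Qed.

Lemma asumZ c f s : asum f s -> asum (fun n => c * f n) (c * s).
Proof.
move=> [[M hM] h]; split.
  exists (nc c * M) => n.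
  under eq_bigr do rewrite Normc.normcM.
  by rewrite -mulr_sumr ler_wpM2l ?nc_ge0.
by under eq_fun do rewrite -mulr_sumr; exact: seq_cvgCZ.
Qed.

Lemma asum_fin f N : (forall n, (N <= n)%N -> f n = 0) ->
  asum f (\sum_(k < N) f k).
Proof.
move=> h.
have aux (V : nmodType) (F : nat -> V) : (forall n, (N <= n)%N -> F n = 0) ->
    forall n, (N <= n)%N -> \sum_(k < n) F k = \sum_(k < N) F k.
  move=> hF n Nn; rewrite -(subnKC Nn) big_split_ord /= [X in _ + X]big1 ?addr0 //.
  by move=> i _; rewrite hF // leq_addr.
split.
  exists (\sum_(k < N) nc (f k)) => n.
  have h2 m : (N <= m)%N -> nc (f m) = 0 by move=> /h ->; rewrite nc0.
  have [Nn|/ltnW nN] := leqP N n; first by rewrite (aux _ _ h2).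
  by rewrite -(subnKC nN) big_split_ord /= lerDl sumr_ge0 // => i _; exact: nc_ge0.
apply/seq_cvgCP => e e0; exists N => n Nn.
by rewrite (aux _ _ h _ Nn) subrr nc0.
Qed.

Lemma asum_shift f s : f 0%N = 0 -> asum (fun n => f n.+1) s <-> asum f s.
Proof.
move=> f0.
have aux n : \sum_(k < n.+1) f k = \sum_(k < n) f k.+1.
  by rewrite big_ord_recl f0 add0r.
have aux2 n : \sum_(k < n.+1) nc (f k) = \sum_(k < n) nc (f k.+1).
  by rewrite big_ord_recl f0 nc0 add0r.
split=> -[[M hM] h]; split.
- exists M => -[|n]; last by rewrite aux2.
  by have := hM 0%N; rewrite !big_ord0.
- rewrite (seq_cvgC_shift _ _ 1); under eq_fun do rewrite addn1 aux.
  exact: h.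
- by exists M => n; rewrite -aux2.
- move: h; rewrite (seq_cvgC_shift _ _ 1).
  by under eq_fun do rewrite addn1 aux.
Qed.

(* The norms of f are bounded through those of g, so f needs no expansion of
   1 / (1 + d). *)
Lemma asum_divide f g d t : nc d < 1 -> asum g t ->
  g 0%N = f 0%N -> (forall n, g n.+1 = f n.+1 + d * f n) ->
  asum f (t / (1 + d)).
Proof.
move=> d1 [[M hM] hg] g0 gS.
have d1' : 0 < 1 - nc d by rewrite subr_gt0.
have bnd n : \sum_(k < n) nc (f k) <= M / (1 - nc d).
  rewrite ler_pdivlMr // mulrBr mulr1 lerBlDr.
  apply: le_trans (_ : \sum_(k < n) nc (g k) +
    nc d * \sum_(k < n.-1) nc (f k) <= _).
    case: n => [|n]; first by rewrite !big_ord0 mulr0 addr0.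
    rewrite !big_ord_recl /= -g0 -addrA lerD2l mulr_sumr -big_split /=.
    apply: ler_sum => i _; rewrite -Normc.normcM.
    rewrite (_ : f _ = g i.+1 - d * f i); first exact: ncB.
    by rewrite gS addrK.
  apply: lerD; first exact: hM.
  rewrite mulrC ler_wpM2r ?nc_ge0 //; case: n => [|n] /=; first by rewrite !big_ord0.
  by rewrite big_ord_recr /= lerDl nc_ge0.
have [s hs] := asum_bound_ex bnd.
have nz : 1 + d != 0.
  apply/eqP => /(canRL (addKr _)); rewrite addr0 => dE.
  by move: d1; rewrite dE ncN Normc.normc1 ltxx.
suff -> : t / (1 + d) = s by [].
apply: (canLR (mulfK nz)).
(* [sh] is the series moved by one place; f + d sh = g termwise, hence s + d s = t. *)
pose sh n := if n is m.+1 then f m else 0.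
have hsh : asum sh s by apply/asum_shift.
have := asumD hs (asumZ d hsh).
have -> : (fun n => f n + d * sh n) = g.
  by apply/funext => -[|n] /=; rewrite ?mulr0 ?addr0.
by case=> _ /(seq_cvgC_uniq hg) ->; rewrite mulrDr mulr1 mulrC.
Qed.

Definition conv f g n := \sum_(i < n.+1) f i * g (n - i)%N.

Lemma triangle_sum (V : nmodType) (F : nat -> nat -> V) N :
  \sum_(n < N) \sum_(i < n.+1) F i (n - i)%N =
  \sum_(i < N) \sum_(j < N | (i + j < N)%N) F i j.
Proof.
have -> : \sum_(n < N) \sum_(i < n.+1) F i (n - i)%N =
  \sum_(n < N) \sum_(i < N | (i <= n)%N) F i (n - i)%N.
  apply: eq_bigr => n _.
  rewrite (big_ord_widen_cond N xpredT (fun i => F i (n - i)%N)) //.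
rewrite (exchange_big_dep xpredT) //=.
apply: eq_bigr => i _.
rewrite -(big_mkord (fun n => (i <= n)%N) (fun n => F i (n - i)%N)).
rewrite -(big_mkord (fun j => (i + j < N)%N) (fun j => F i j)).
have iN := ltnW (ltn_ord i).
rewrite (big_cat_nat (n := i)) //= big_nat_cond big1 ?add0r; last first.
  by move=> k /andP[/andP[_ ki] ik]; rewrite leqNgt ki in ik.
rewrite [RHS](big_cat_nat (n := N - i)) ?leq_subr //= [X in _ = _ + X]big_nat_cond.
rewrite [X in _ = _ + X]big1 ?addr0; last first.
  by move=> k /andP[/andP[ki _] ik]; lia.
rewrite -{1}(add0n (nat_of_ord i)) big_addn.
rewrite big_nat_cond [RHS]big_nat_cond.
by apply: eq_big => [k|k _]; [lia|rewrite addnK].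
Qed.

Lemma asum_conv f g s t : asum f s -> asum g t -> asum (conv f g) (s * t).
Proof.
move=> [[M hM] hs] [[K hK] ht].
pose A (n : nat) : R := \sum_(i < n.+1) nc (f i) * nc (g (n - i)%N).
have Age0 n : 0 <= A n by apply: sumr_ge0 => i _; rewrite mulr_ge0 ?nc_ge0.
have M0 : 0 <= M by have := hM 0%N; rewrite big_ord0.
have Abnd n : \sum_(k < n) A k <= M * K.
  rewrite (triangle_sum (fun i j => nc (f i) * nc (g j))).
  apply: le_trans (_ : (\sum_(i < n) nc (f i)) * (\sum_(j < n) nc (g j)) <= _).
    rewrite big_distrl /=; apply: ler_sum => i _.
    rewrite big_distrr /= [leRHS](bigID (fun j : 'I_n => (i + j < n)%N)) /=.
    by rewrite lerDl sumr_ge0 // => j _; rewrite mulr_ge0 ?nc_ge0.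
  apply: ler_pM => //; apply: sumr_ge0 => i _; exact: nc_ge0.
split.
  exists (M * K) => n; apply: le_trans (Abnd n).
  apply: ler_sum => i _; apply: le_trans (nc_sum _ _ _) _.
  by apply: ler_sum => j _; rewrite Normc.normcM.
apply: (seq_cvgC_sandwich (seq_cvgCM hs ht)).
have : cvgn (series A).
  apply: nondecreasing_is_cvgn.
    by apply: nondecreasing_series => n _ _.
  by exists (M * K) => _ [n _ <-]; rewrite seriesEord; exact: Abnd.
move=> /cvgR_seqP hA.
apply/seq_cvgCP => e e0.
have [N hN] := hA _ (divr_gt0 e0 (ltr0Sn _ 1)).
exists N => n Nn; rewrite subr0.
(* What the triangular partial sum misses of the square are the pairs with i + j >= n. *)
have -> : (\sum_(i < n) f i) * (\sum_(j < n) g j) - \sum_(k < n) conv f g k =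
   \sum_(i < n) \sum_(j < n | ~~ (i + j < n)%N) f i * g j.
  rewrite (triangle_sum (fun i j => f i * g j)) big_distrl /= -sumrB.
  apply: eq_bigr => i _; rewrite big_distrr /=.
  by rewrite (bigID (fun j : 'I_n => (i + j < n)%N)) /= addrAC subrr add0r.
(* As i, j < n force i + j < 2n, the missed terms are dominated by the block from n to 2n of the
   convergent series A. *)
apply: le_lt_trans (_ : \sum_(k < n + n) A k - \sum_(k < n) A k < _).
  rewrite !(triangle_sum (fun i j => nc (f i) * nc (g j))).
  rewrite lerBrDr.
  apply: le_trans (_ : \sum_(i < n) \sum_(j < n) nc (f i) * nc (g j) <= _).
    rewrite [leRHS](eq_bigr (fun i : 'I_n =>
        \sum_(j < n | (i + j < n)%N) nc (f i) * nc (g j) +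
        \sum_(j < n | ~~ (i + j < n)%N) nc (f i) * nc (g j))); last first.
      by move=> i _; rewrite (bigID (fun j : 'I_n => (i + j < n)%N)).
    rewrite [leRHS]big_split /= [leRHS]addrC lerD2r.
    apply: le_trans (nc_sum _ _ _) _; apply: ler_sum => i _.
    apply: le_trans (nc_sum _ _ _) _; apply: ler_sum => j _.
    by rewrite Normc.normcM.
  rewrite big_split_ord /=.
  apply: le_trans (_ : \sum_(i < n) \sum_(j < n + n | (i + j < n + n)%N)
       nc (f i) * nc (g j) <= _); last first.
    rewrite lerDl sumr_ge0 // => i _; rewrite sumr_ge0 // => j _.
    by rewrite mulr_ge0 ?nc_ge0.
  apply: ler_sum => i _; rewrite big_split_ord /=.
  rewrite [X in _ <= X + _](eq_bigl xpredT); last first.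
    by move=> j; have := ltn_ord i; have := ltn_ord j; lia.
  by rewrite lerDl sumr_ge0 // => j _; rewrite mulr_ge0 ?nc_ge0.
have h1 := hN n Nn; have h2 := hN (n + n)%N (leq_trans Nn (leq_addr _ _)).
rewrite seriesEord in h1 h2.
set a := \sum_(k < n) A k; set b := \sum_(k < n + n) A k.
have {h1} : `|a - limn [sequence \sum_(k < n0) A k]_n0| < e / 2 := h1.
have {h2} : `|b - limn [sequence \sum_(k < n0) A k]_n0| < e / 2 := h2.
move: (lim _ : R) => L.
rewrite !ltr_norml => /andP[x1 x2] /andP[x3 x4]; lra.
Qed.

End ComplexSeries.

(** * The complex exponential *)

Section ComplexExp.
Variable R : realType.
Local Notation C := R[i].
Local Notation nc := (@Normc.normc R).
Implicit Types (z w s t c d : C) (f g : nat -> C) (x y : R).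

Lemma natrC (n : nat) : (n%:R : C) = (n%:R : R)%:C.
Proof. by rewrite rmorph_nat. Qed.

Lemma intrC (n : int) : (n%:~R : C) = (n%:~R : R)%:C.
Proof. by rewrite rmorph_int. Qed.

Lemma nc_nat (n : nat) : nc n%:R = n%:R.
Proof. by rewrite natrC nc_real ger0_norm. Qed.

Lemma cexpD z w : cexp (z + w) = cexp z * cexp w.
Proof.
rewrite /cexp ReD ImD expRD cosD sinD.
by apply: eq_ReIm; rewrite !(ReM, ImM) /=; ring.
Qed.

Lemma cexp0 : cexp (0 : C) = 1.
Proof. by apply: eq_ReIm; rewrite /cexp !(ReM, ImM) /= expR0 cos0 sin0; ring. Qed.

Lemma cexpN z : cexp (- z) = (cexp z)^-1.
Proof.
have h : cexp z * cexp (- z) = 1 by rewrite -cexpD subrr cexp0.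
have nz : cexp z != 0.
  by apply/eqP => e; move: h; rewrite e mul0r => /esym/eqP; rewrite oner_eq0.
by apply: (mulfI nz); rewrite h divff.
Qed.

Lemma cexp_neq0 z : cexp z != 0.
Proof.
apply/eqP => e; have : cexp z * cexp (- z) = 1 by rewrite -cexpD subrr cexp0.
by rewrite e mul0r => /esym/eqP; rewrite oner_eq0.
Qed.

Lemma cexpMn z n : cexp (n%:R * z) = cexp z ^+ n.
Proof.
elim: n => [|n IH]; first by rewrite mul0r cexp0 expr0.
by rewrite -addn1 natrD mulrDl mul1r cexpD IH exprD expr1.
Qed.

Lemma cexpMz z (n : int) : cexp (n%:~R * z) = cexp z ^ n.
Proof.
case: n => n; first exact: cexpMn.
by rewrite NegzE mulrNz mulNr cexpN -[n.+1%:~R]/(n.+1%:R) cexpMn.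
Qed.

Lemma Im_cexp z : complex.Im (cexp z) = expR (complex.Re z) * sin (complex.Im z).
Proof. by rewrite /cexp ImM /=; ring. Qed.

Lemma Re_cexp z : complex.Re (cexp z) = expR (complex.Re z) * cos (complex.Im z).
Proof. by rewrite /cexp ReM /=; ring. Qed.

Lemma cexp_two_pi_i : cexp (two_pi_i R) = 1.
Proof.
by apply: eq_ReIm; rewrite ?Re_cexp ?Im_cexp /= expR0 mul1r mulr_natl
  ?cos2pi ?sin2pi.
Qed.

(* |Im| < pi/2 on both sides leaves no room for a multiple of 2 pi i. *)
Lemma cexp_inj_strip z w : `|complex.Im z| < pi / 2 -> `|complex.Im w| < pi / 2 ->
  cexp z = cexp w -> z = w.
Proof.
move=> hz hw e.
have : cexp (z - w) = 1 by rewrite cexpD cexpN e divff ?cexp_neq0.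
set d := z - w => hd.
have hIm : `|complex.Im d| < pi.
  rewrite /d ImD ImN; apply: le_lt_trans (ler_normB _ _) _.
  by rewrite -[ltRHS](_ : pi / 2 + pi / 2 = _) ?ltrD // -splitr.
have sin0 : sin (complex.Im d) = 0.
  have := Im_cexp d; rewrite hd /= => /esym/eqP.
  by rewrite mulf_eq0 expR_eq0 => /eqP.
have Im0 : complex.Im d = 0.
  case: (ltgtP (complex.Im d) 0) => // h.
    have : 0 < sin (- complex.Im d).
      by apply: sin_gt0_pi; rewrite oppr_gt0 h /= -(ltr0_norm h).
    by rewrite sinN sin0 oppr0 ltxx.
  have : 0 < sin (complex.Im d) by apply: sin_gt0_pi; rewrite h /= -(gtr0_norm h).
  by rewrite sin0 ltxx.
have Re0 : complex.Re d = 0.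
  have := Re_cexp d; rewrite hd Im0 cos0 mulr1 /= => /esym/eqP.
  by rewrite -expR0 => /eqP/expR_inj.
by apply/eqP; rewrite -subr_eq0; apply/eqP/eq_ReIm.
Qed.

Lemma exp_asum_ex z : exists s, asum (fun n => z ^+ n / n`!%:R) s.
Proof.
apply: (@asum_bound_ex _ _ (expR (nc z))) => n.
apply: le_trans (_ : series (exp_coeff (nc z)) n <= _).
  rewrite seriesEord; apply: ler_sum => k _.
  rewrite Normc.normcM ncX Normc.normcV /exp_coeff /=.
  by rewrite nc_nat.
apply: nondecreasing_cvgn_le; last exact: is_cvg_series_exp_coeff.
by apply: nondecreasing_series => k _ _; exact: exp_coeff_ge0 (nc_ge0 _).
Qed.

Lemma asum_exp_real x : asum (fun n => (x%:C) ^+ n / n`!%:R) (expR x)%:C.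
Proof.
have [s hs] := exp_asum_ex x%:C.
suff -> : (expR x)%:C = s by [].
have [_ h] := hs.
apply: (seq_cvgC_uniq _ h).
have E n : \sum_(k < n) (x%:C) ^+ k / k`!%:R = (series (exp_coeff x) n)%:C.
  rewrite seriesEord /= rmorph_sum; apply: eq_bigr => k _.
  by rewrite rmorphM rmorphXn /= fmorphV rmorph_nat.
rewrite (funext E); apply/seq_cvgC_ReIm; split => /=; last exact: cvg_cst.
exact: is_cvg_series_exp_coeff.
Qed.

Lemma asum_exp_imag y : asum (fun n => (0 +i* y) ^+ n / n`!%:R)
  (cos y +i* sin y).
Proof.
have [s hs] := exp_asum_ex (0 +i* y).
suff -> : (cos y +i* sin y) = s by [].
have [_ h] := hs.
apply: (seq_cvgC_uniq _ h).
have E n : (0 +i* y : C) ^+ n = (((~~ odd n)%:R * (-1) ^+ n./2 * y ^+ n) +i*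
   ((odd n)%:R * (-1) ^+ n.-1./2 * y ^+ n)).
  have E2 m : (0 +i* y : C) ^+ m.*2 = ((-1) ^+ m * y ^+ m.*2)%:C.
    rewrite -mul2n !exprM rmorphM /= !rmorphXn /= -exprMn; congr (_ ^+ _).
    by apply: eq_ReIm; rewrite expr2 ?ReM ?ImM /=; ring.
  have [k [->|->]] : exists k, n = k.*2 \/ n = k.*2.+1.
    by exists n./2; case: (boolP (odd n)) => h'; have := odd_double_half n;
       rewrite ?h' ?(negbTE h') /=; [right|left].
  - rewrite E2 odd_double /= doubleK mul1r; apply: eq_ReIm => //=.
    by rewrite !mul0r.
  - rewrite exprS E2 /= odd_double /= mul0r mul0r doubleK.
    by apply: eq_ReIm; rewrite ?ReM ?ImM /= ?exprS; ring.
have F n : \sum_(k < n) (0 +i* y : C) ^+ k / k`!%:R =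
    (series (cos_coeff y) n +i* series (sin_coeff y) n).
  have G k : (0 +i* y : C) ^+ k / k`!%:R = (cos_coeff y k +i* sin_coeff y k).
    rewrite E natrC -fmorphV /=.
    by rewrite /cos_coeff /sin_coeff; apply: eq_ReIm;
      rewrite ?ReM ?ImM /= ?(mulr0, subr0, add0r, addr0).
  rewrite !seriesEord (eq_bigr _ (fun (k : 'I_n) _ => G k)).
  by apply: eq_ReIm; rewrite ?Re_sum ?Im_sum.
rewrite (funext F); apply/seq_cvgC_ReIm; split => /=.
  by rewrite cos.unlock; exact: is_cvg_series_cos_coeff.
by rewrite sin.unlock; exact: is_cvg_series_sin_coeff.
Qed.

Lemma exp_conv z w n :
  conv (fun n => z ^+ n / n`!%:R) (fun n => w ^+ n / n`!%:R) n =
  (z + w) ^+ n / n`!%:R.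
Proof.
rewrite /conv addrC exprDn mulr_suml; apply: eq_bigr => k _.
have kn : (k <= n)%N by rewrite -ltnS.
rewrite -mulr_natr -(bin_fact kn) !natrM.
have f0 m : (m`!%:R : C) != 0 by rewrite pnatr_eq0 -lt0n fact_gt0.
have b0 : ('C(n, k)%:R : C) != 0 by rewrite pnatr_eq0 -lt0n bin_gt0.
by field; rewrite !f0 b0.
Qed.

(** By the binomial theorem the Cauchy product of the series at Re z and at i Im z is the series at
    z. *)
Lemma asum_exp z : asum (fun n => z ^+ n / n`!%:R) (cexp z).
Proof.
have h := asum_conv (asum_exp_real (complex.Re z)) (asum_exp_imag (complex.Im z)).
apply: eq_asum h => n; rewrite exp_conv; congr (_ ^+ _ / _).
by apply: eq_ReIm => /=; rewrite ?ReD ?ImD /=; ring.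
Qed.

Lemma carg_spec z : z != 0 ->
  0 <= carg z < 2 * pi /\ z = (nc z)%:C * (cos (carg z) +i* sin (carg z)).
Proof.
move=> z0; rewrite -normCE; apply: (@xgetPex _ 0 [set t : R | 0 <= t < 2 * pi /\
  z = `|z| * (cos t +i* sin t)]) => /=.
have n0 : 0 < nc z by rewrite nc_gt0.
pose a := complex.Re z / nc z; pose b := complex.Im z / nc z.
have ab : a ^+ 2 + b ^+ 2 = 1.
  rewrite /a /b !expr_div_n -mulrDl (_ : _ + _ = nc z ^+ 2).
    by rewrite divff // expf_eq0 /= gt_eqF.
  case: (z) => u v /=; rewrite /Normc.normc sqr_sqrtr //.
  by rewrite addr_ge0 ?sqr_ge0.
have ale : -1 <= a <= 1.
  rewrite -ler_norml -(@ler_pXn2r _ 2) ?nnegrE // expr1n real_normK ?num_real //.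
  by rewrite -ab lerDl sqr_ge0.
have zE (t : R) : cos t = a -> sin t = b -> z = `|z| * (cos t +i* sin t).
  move=> -> ->; rewrite normCE /a /b; apply: eq_ReIm; rewrite ?ReM ?ImM /=;
    by rewrite mul0r ?subr0 ?addr0 mulrC divfK // gt_eqF.
have cE : cos (acos a) = a by rewrite acosK.
have sE : sin (acos a) = `|b|.
  by rewrite sin_acos // -ab addrAC subrr add0r sqrtr_sqr.
have [b0|b0] := leP 0 b.
  exists (acos a); split; last by apply: zE; rewrite // sE ger0_norm.
  rewrite acos_ge0 //=; apply: le_lt_trans (acos_lepi ale) _.
  by rewrite ltr_pMl ?pi_gt0 // ltr1n.
(* In the lower half plane the angle is reflected; a < 1, which follows from b < 0, keeps it
   strictly below 2 pi. *)
exists (2 * pi - acos a); split.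
  have a1 : a < 1.
    rewrite lt_neqAle (andP ale).2 andbT; apply/eqP => a1; move: ab.
    rewrite a1 expr1n => /(canRL (addKr _)); rewrite addNr => /eqP.
    by rewrite sqrf_eq0 => /eqP b0'; rewrite b0' ltxx in b0.
  have := acos_gt0; move=> /(_ _ a) h; have {h} := h (introT andP (conj (andP ale).1 a1)).
  by have := acos_lepi ale; have := pi_gt0 R; lra.
have c2 : cos (2 * pi) = 1 :> R by rewrite mulrC mulr_natr cos2pi.
have s2 : sin (2 * pi) = 0 :> R by rewrite mulrC mulr_natr sin2pi.
apply: zE; first by rewrite cosB c2 s2 cE; ring.
by rewrite sinB c2 s2 sE ltr0_norm //; ring.
Qed.

Lemma lbr_shift (p : int) z :
  lbr p z = lbr 0 z + p%:~R * two_pi_i R.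
Proof.
rewrite /lbr /two_pi_i; apply: eq_ReIm; rewrite ?ReD ?ImD ?ReM ?ImM /=.
  by rewrite intrC /=; ring.
by rewrite intrC /= mulr0z; ring.
Qed.

Lemma cexp_lbr (p : int) z : z != 0 -> cexp (lbr p z) = z.
Proof.
move=> z0; rewrite lbr_shift cexpD cexpMz cexp_two_pi_i exp1rz mulr1.
have [_ zE] := carg_spec z0.
rewrite /cexp /= mulr0z mulr0 mul0r addr0 lnK; last by rewrite posrE nc_gt0.
by rewrite -zE.
Qed.

End ComplexExp.

(** * The logarithm and binomial series *)

Section BinomialPoly.
Variable R : realType.
Local Notation C := R[i].
Implicit Types (a c y : C) (s k : nat).

(* binom(a + X, s) *)
Definition fbp a s : {poly C} :=
  (s`!%:R)^-1 *: \prod_(j < s) ('X + (a - j%:R)%:P).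

Lemma fbp0 a : fbp a 0 = 1.
Proof. by rewrite /fbp big_ord0 fact0 invr1 scale1r. Qed.

Lemma fbpS a s : s.+1%:R *: fbp a s.+1 = ('X + (a - s%:R)%:P) * fbp a s.
Proof.
rewrite /fbp big_ord_recr /= scalerA factS natrM invfM mulrA divff ?pnatr_eq0 //.
by rewrite mul1r -scalerAr mulrC.
Qed.

Lemma natS_neq0 s : (s.+1%:R : C) != 0. Proof. by rewrite pnatr_eq0. Qed.

Lemma scaleS_inj (V : lmodType C) s : injective (fun x : V => s.+1%:R *: x).
Proof. by apply: scalerI; exact: natS_neq0. Qed.

(** As s + 1 is invertible, the recursion and the initial value determine the sequence; identities
    between binomial polynomials reduce to one step of it. *)
Lemma fbp_rec a (F : nat -> {poly C}) : F 0%N = 1 ->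
  (forall s, s.+1%:R *: F s.+1 = ('X + (a - s%:R)%:P) * F s) ->
  F =1 fbp a.
Proof.
move=> F0 FS; elim=> [|s IH]; first by rewrite F0 fbp0.
by apply: (@scaleS_inj _ s); rewrite FS fbpS IH.
Qed.

Lemma binz0 (m : int) : binz R m 0 = 1.
Proof. by rewrite /binz big_ord0 fact0 invr1 mulr1. Qed.

Lemma binzS (m : int) i : i.+1%:R * binz R m i.+1 = (m%:~R - i%:R) * binz R m i.
Proof.
rewrite /binz big_ord_recr /= factS natrM invfM.
have -> : forall P Q x S S' : C, S * (P * x * (S' * Q)) = (S * S') * (x * (P * Q)).
  by move=> *; ring.
by rewrite divff ?natS_neq0 // mul1r.
Qed.

(** Chu-Vandermonde. The convolution satisfies the recursion of [fbp_rec] once the factor s + 1 is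
    split as i + (s + 1 - i). *)
Lemma fbp_vandermonde (m : int) c s :
  \sum_(i < s.+1) binz R m i *: fbp c (s - i) = fbp (c + m%:~R) s.
Proof.
apply: (@fbp_rec _ (fun s => \sum_(i < s.+1) binz R m i *: fbp c (s - i))).
  by rewrite big_ord_recl big_ord0 addr0 binz0 scale1r fbp0.
move=> {}s; rewrite scaler_sumr mulr_sumr.
rewrite (eq_bigr (fun i : 'I_s.+2 => (i%:R * binz R m i) *: fbp c (s.+1 - i) +
   binz R m i *: ((s.+1 - i)%:R *: fbp c (s.+1 - i)))); last first.
  move=> i _; have i_s : (i <= s.+1)%N by rewrite -ltnS.
  rewrite !scalerA -scalerDl; congr (_ *: _).
  by rewrite natrB //; ring.
rewrite big_split /= big_ord_recl mul0r scale0r add0r.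
rewrite [X in _ + X]big_ord_recr /= subnn scale0r scaler0 addr0 -big_split /=.
apply: eq_bigr => i _; have i_s : (i <= s)%N by rewrite -ltnS.
rewrite /bump /= add1n subSS binzS subSn // fbpS natrB //.
rewrite -!mul_polyC; ring.
Qed.

(** Both sides are (X + c)(X + c - 1)...(X + c - s) / s!. *)
Lemma fbp_shift c s :
  ('X + c%:P) * fbp (c - 1) s = ('X + (c - s%:R)%:P) * fbp c s.
Proof.
elim: s => [|s IH]; first by rewrite !fbp0 subr0.
apply: (@scaleS_inj _ s) => /=; rewrite !scalerAr !fbpS.
rewrite mulrCA IH; congr (_ * _).
by congr (_ + _%:P); rewrite -[s.+1]addn1 natrD; ring.
Qed.

(** The coefficients of log(1 + y); at i = 0 the convention for division by zero gives the right
    value 0. *)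
Definition logc (i : nat) : C := (-1) ^+ i.-1 / i%:R.

Lemma logcS i : i.+1%:R * logc i.+1 = (-1) ^+ i.
Proof. by rewrite /logc /= mulrC divfK // natS_neq0. Qed.

(** Coefficient of y^s in d/dX (1 + y)^(a + X) = log(1 + y) (1 + y)^(a + X). *)
Lemma fbp_deriv a s :
  (fbp a s)^`() = \sum_(i < s) logc i.+1 *: fbp a (s - i.+1).
Proof.
elim: s => [|s IH]; first by rewrite fbp0 big_ord0 derivC.
apply: (@scaleS_inj _ s); rewrite -derivZ fbpS derivM derivD derivX derivC addr0 mul1r IH.
rewrite scaler_sumr mulr_sumr.
rewrite (eq_bigr (fun i : 'I_s => logc i.+1 *: (('X + (a - s%:R)%:P) * fbp a (s - i.+1)))); last first.
  by move=> i _; rewrite scalerAr.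
rewrite (eq_bigr (fun i : 'I_s => logc i.+1 *: ((s - i)%:R *: fbp a (s - i)) -
    (-1) ^+ i *: fbp a (s - i.+1))); last first.
  move=> i _; have i_s := ltn_ord i.
  have -> : (s - i)%:R *: fbp a (s - i) =
      ('X + (a - (s - i.+1)%:R)%:P) * fbp a (s - i.+1).
    by rewrite -fbpS subnSK.
  by rewrite -logcS natrB // -[i.+1]addn1 natrD -!mul_polyC; ring.
rewrite sumrB.
rewrite [RHS](eq_bigr (fun i : 'I_s.+1 => logc i.+1 *: ((s - i)%:R *: fbp a (s - i))
   + (-1) ^+ i *: fbp a (s - i))); last first.
  move=> i _; have i_s : (i <= s)%N by rewrite -ltnS.
  rewrite subSS -logcS !scalerA -scalerDl; congr (_ *: _).
  by rewrite natrB // -!natr1; ring.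
rewrite big_split /= [X in _ = X + _]big_ord_recr /= subnn scale0r scaler0 addr0.
rewrite addrCA; congr (_ + _).
rewrite [RHS]big_ord_recl /= expr0 scale1r subn0; congr (_ + _).
rewrite -sumrN; apply: eq_bigr => i _.
by rewrite /bump /= add1n exprS mulN1r scaleNr.
Qed.

(** The generating series in s is (1 + y)^a log(1 + y)^k / k! ([asum_beta_exp]). Through these
    numbers binom(T, s) acts by powers of the nilpotent part of T. *)
Definition beta k s a := (fbp a s)`_k.

Lemma betaS k s a :
  k.+1%:R * beta k.+1 s a = \sum_(i < s) logc i.+1 * beta k (s - i.+1) a.
Proof.
have := congr1 (fun p : {poly C} => p`_k) (fbp_deriv a s).
rewrite coef_deriv coef_sum /beta mulr_natl => ->.
by apply: eq_bigr => i _; rewrite coefZ.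
Qed.

Lemma horner_fbp a s y : (fbp a s).[y] = (s`!%:R)^-1 * \prod_(j < s) (y + (a - j%:R)).
Proof.
rewrite /fbp hornerZ horner_prod; congr (_ * _).
by apply: eq_bigr => j _; rewrite hornerD hornerX hornerC.
Qed.

Lemma beta0E s a : beta 0 s a = (fbp 0 s).[a].
Proof.
rewrite /beta -horner_coef0 !horner_fbp; congr (_ * _).
by apply: eq_bigr => j _; ring.
Qed.

Lemma size_fbp a s : (size (fbp a s) <= s.+1)%N.
Proof.
elim: s => [|s IH]; first by rewrite fbp0 size_poly1.
rewrite -(size_scale _ (natS_neq0 s)) fbpS.
apply: leq_trans (size_polyMleq _ _) _.
have : (size ('X + (a - s%:R)%:P : {poly C})%R <= 2)%N.
  apply: leq_trans (size_polyD _ _) _; rewrite size_polyX geq_max leqnn /=.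
  by apply: leq_trans (size_polyC_leq1 _) _.
by move=> h; rewrite -subn1 leq_subLR -[(1 + _)%N]/(2 + s.+1)%N; exact: leq_add.
Qed.

Lemma beta_taylor s a : beta 0 s a = \sum_(k < s.+1) a ^+ k * beta k s 0.
Proof.
rewrite beta0E (horner_coef_wide _ (size_fbp 0 s)).
by apply: eq_bigr => k _; rewrite mulrC.
Qed.

Local Notation nc := (@Normc.normc R).

(** Each factor X + (a - j) of the product is majorized, at X = rho, by rho + |a| + j. *)
Lemma beta_norm (rho : R) a s : 0 <= rho ->
  \sum_(k < s.+1) nc (beta k s a) * rho ^+ k <=
  (s`!%:R)^-1 * \prod_(j < s) (rho + nc a + j%:R).
Proof.
move=> r0; elim: s => [|s IH].
  by rewrite big_ord_recl !big_ord0 addr0 /beta fbp0 coef1 nc1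
     fact0 invr1 expr0 !mulr1.
have nS0 : 0 < (s.+1%:R : R) by rewrite ltr0n.
rewrite [X in _ <= _ * X]big_ord_recr /= factS natrM invfM -mulrA [X in _ <= _ * X]mulrA.
rewrite -(ler_pM2l nS0) [leRHS]mulVKf ?gt_eqF // [leRHS]mulrC [X in _ <= X]mulrC.
apply: le_trans (ler_wpM2r _ IH); last first.
  by rewrite !addr_ge0 ?nc_ge0.
rewrite mulr_sumr.
have rec (k : nat) : s.+1%:R * nc (beta k s.+1 a) <=
    (if k is k'.+1 then nc (beta k' s a) else 0) + (nc a + s%:R) * nc (beta k s a).
  have h : s.+1%:R * beta k s.+1 a =
      (if k is k'.+1 then beta k' s a else 0) + (a - s%:R) * beta k s a.
    have := congr1 (fun p : {poly C} => p`_k) (fbpS a s).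
    rewrite coefZ mulrDl coefD coefXM coefCM => ->.
    by case: k.
  have -> : s.+1%:R * nc (beta k s.+1 a) = nc (s.+1%:R * beta k s.+1 a).
    by rewrite Normc.normcM nc_nat.
  rewrite h; apply: le_trans (ncD _ _) _.
  apply: lerD; first by case: k {h} => //; rewrite nc0.
  rewrite Normc.normcM ler_wpM2r ?nc_ge0 //.
  by apply: le_trans (ncB _ _) _; rewrite nc_nat.
apply: le_trans (_ : \sum_(k < s.+2) (((if k : nat is k'.+1 then nc (beta k' s a) else 0) +
    (nc a + s%:R) * nc (beta k s a)) * rho ^+ k) <= _).
  apply: ler_sum => k _; rewrite mulrA; apply: ler_wpM2r; first exact: exprn_ge0.
  exact: rec.
rewrite (eq_bigr _ (fun (k : 'I_s.+2) _ => mulrDl _ _ _)) big_split /=.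
rewrite big_ord_recl mul0r add0r [X in _ + X]big_ord_recr /=.
have -> : beta s.+1 s a = 0 by rewrite /beta nth_default // size_fbp.
rewrite nc0 mulr0 mul0r addr0 -big_split /= mulr_suml; apply: ler_sum => k _.
by rewrite /bump /= add1n exprS le_eqVlt; apply/orP; left; apply/eqP; ring.
Qed.

(** The series is that of (1 - r)^-(A + 1): each induction step divides by 1 - r, which on
    coefficients is Pascal's rule. *)
Lemma bin_series_bound (A : nat) (r : R) : 0 <= r < 1 ->
  exists M : R, forall n, \sum_(s < n) ('C(A + s, s)%:R * r ^+ s) <= M.
Proof.
move=> /andP[r0 r1].
suff [t [[M hM] _]] : exists t, asum (fun s => ('C(A + s, s)%:R * r ^+ s)%:C) t.
  exists M => n; apply: le_trans (hM n).
  by apply: ler_sum => s _; rewrite nc_real ler_norm.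
have d1 : nc (- r%:C) < 1 by rewrite ncN nc_real ger0_norm.
elim: A => [|A [t ht]].
  have h1 : asum (fun s => if s == 0%N then 1 else 0 : C) 1.
    have := @asum_fin R (fun s => if s == 0%N then 1 else 0) 1.
    by rewrite big_ord_recl big_ord0 addr0; apply; case.
  eexists; apply: (asum_divide d1 h1) => [|n] /=.
    by rewrite addn0 bin0 expr0 mul1r.
  by rewrite !add0n !binn !mul1r exprS rmorphM /=; ring.
eexists; apply: (asum_divide d1 ht) => [|n].
  by rewrite !addn0 !bin0.
have -> : ('C(A.+1 + n.+1, n.+1) = 'C(A + n.+1, n.+1) + 'C(A.+1 + n, n))%N.
  by rewrite addSn binS addSnnS.
by rewrite natrD exprS !rmorphM rmorphD; ring.
Qed.

Lemma prod_fact_bound (x : R) (A s : nat) : 0 <= x -> x <= A.+1%:R ->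
  (s`!%:R)^-1 * \prod_(j < s) (x + j%:R) <= 'C(A + s, s)%:R.
Proof.
move=> x0 xA; rewrite mulrC ler_pdivrMr ?ltr0n ?fact_gt0 //.
rewrite -natrM bin_ffact ffact_prod natr_prod.
rewrite [leRHS](reindex_inj rev_ord_inj) /=.
apply: ler_prod => j _; have js := ltn_ord j.
rewrite addr_ge0 //=.
have -> : (A + s - (s - j.+1) = A.+1 + j)%N by lia.
by rewrite natrD lerD2r.
Qed.

Lemma nat_bound (x : R) : exists A : nat, x <= A.+1%:R.
Proof.
exists (Num.bound `|x|); apply: ltW; apply: lt_le_trans (_ : (Num.bound `|x|)%:R <= _).
  by apply: le_lt_trans (archi_boundP (normr_ge0 x)); rewrite ler_norm.
by rewrite ler_nat.
Qed.

Lemma asum_beta k a y : nc y < 1 ->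
  exists t, asum (fun s => beta k s a * y ^+ s) t.
Proof.
move=> y1; have [A hA] := nat_bound (1 + nc a).
have [|M hM] := @bin_series_bound A (nc y); first by rewrite nc_ge0.
apply: (@asum_bound_ex _ _ M) => n; apply: le_trans (hM n).
apply: ler_sum => s _; rewrite Normc.normcM ncX; apply: ler_wpM2r.
  by rewrite exprn_ge0 // nc_ge0.
apply: le_trans (@prod_fact_bound (1 + nc a) A s _ hA); last by rewrite addr_ge0 ?nc_ge0.
(* With rho = 1 the sum of all coefficient norms is bounded, hence also the single one at k. *)
apply: le_trans (beta_norm a s ler01).
have [ks|ks] := ltnP k s.+1; last first.
  rewrite /beta nth_default ?nc0; last exact: leq_trans (size_fbp _ _) ks.
  by apply: sumr_ge0 => i _; rewrite mulr_ge0 ?nc_ge0 // exprn_ge0.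
rewrite (bigD1 (Ordinal ks)) //= expr1n mulr1 lerDl.
by apply: sumr_ge0 => i _; rewrite mulr_ge0 ?nc_ge0 // exprn_ge0.
Qed.

End BinomialPoly.

Section LogSeries.
Variable R : realType.
Local Notation C := R[i].
Local Notation nc := (@Normc.normc R).
Implicit Types (a y s t : C) (k n : nat).

Lemma logc0 : logc R 0 = 0. Proof. by rewrite /logc invr0 mulr0. Qed.

Lemma beta00 n : beta 0 n (0 : C) = (n == 0%N)%:R.
Proof.
rewrite beta0E horner_fbp; case: n => [|n].
  by rewrite big_ord0 fact0 invr1 mulr1.
by rewrite big_ord_recl /= subrr addr0 mul0r mulr0.
Qed.

Lemma beta_log k n a : k.+1%:R * beta k.+1 n a =
  \sum_(i < n.+1) logc R i * beta k (n - i) a.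
Proof. by rewrite betaS big_ord_recl logc0 mul0r add0r. Qed.

(** The coefficient of X in binom(X, n) is the n-th coefficient of the logarithm, so this is the
    case k = 1, a = 0 of [asum_beta]. *)
Lemma asum_logc y : nc y < 1 -> exists t, asum (fun n => logc R n * y ^+ n) t.
Proof.
move=> /(asum_beta 1 0) [t ht]; exists t; apply: eq_asum ht => n.
congr (_ * _); have := beta_log 0 n 0; rewrite mul1r => ->.
rewrite big_ord_recr /= subnn beta00 mulr1 big1 ?add0r // => i _.
by rewrite beta00 subn_eq0 leqNgt ltn_ord mulr0.
Qed.

(* log(1 + y) *)
Definition lam y : C := xget 0 [set t | asum (fun n => logc R n * y ^+ n) t].

Lemma lamP y : nc y < 1 -> asum (fun n => logc R n * y ^+ n) (lam y).
Proof. by move=> /asum_logc h; exact: (xgetPex 0 h). Qed.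

Opaque lam.

(** Each multiplication by log(1 + y) raises k by one, by [beta_log]. The sum t0 at k = 0 is left
    free: it is computed only in [asum_beta0], whose proof uses this lemma at a = 0, where t0 =
    1. *)
Lemma asum_betaE k a y t0 : nc y < 1 ->
  asum (fun n => beta 0 n a * y ^+ n) t0 ->
  asum (fun n => beta k n a * y ^+ n) (t0 * (lam y ^+ k / k`!%:R)).
Proof.
move=> y1 h0; elim: k => [|k IH]; first by rewrite expr0 fact0 divr1 mulr1.
have := asumZ (k.+1%:R)^-1 (asum_conv (lamP y1) IH).
have -> : (k.+1%:R)^-1 * (lam y * (t0 * (lam y ^+ k / k`!%:R))) =
    t0 * (lam y ^+ k.+1 / (k.+1)`!%:R).
  by rewrite factS natrM invfM exprS; ring.
apply: eq_asum => n; rewrite -[RHS](mulKf (natS_neq0 _ k)); congr (_ * _).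
rewrite mulrA beta_log mulr_suml; apply: eq_bigr => i _.
have i_n : (i <= n)%N by rewrite -ltnS.
have -> : y ^+ n = y ^+ i * y ^+ (n - i) by rewrite -exprD subnKC.
by ring.
Qed.

Lemma seq_cvgC_le (f : nat -> C) s t (e : R) N :
  seq_cvgC f s -> (forall n, (N <= n)%N -> nc (f n - t) <= e) -> nc (s - t) <= e.
Proof.
move=> /seq_cvgCP h1 h2; apply/ler_addgt0Pr => d d0.
have [M hM] := h1 d d0; pose n := maxn N M.
have := hM n (leq_maxr _ _); have := h2 n (leq_maxl _ _).
have -> : s - t = (f n - t) - (f n - s) by ring.
move=> a b; apply: le_trans (ncB _ _) _; lra.
Qed.

Lemma asum_tail (f : nat -> C) s : asum f s -> forall e : R, 0 < e -> exists N,
  forall n m, (N <= n <= m)%N -> \sum_(k < m) nc (f k) - \sum_(k < n) nc (f k) < e.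
Proof.
move=> [[M hM] _] e e0.
have [|t [_ /seq_cvgCP ht]] := @asum_bound_ex R (fun k => (nc (f k))%:C) M.
  by move=> n; apply: le_trans (hM n); apply: ler_sum => i _;
     rewrite nc_real ger0_norm ?nc_ge0.
have [N hN] := ht _ (divr_gt0 e0 (ltr0Sn _ 1)).
exists N => n m /andP[Nn nm].
have h1 := hN n Nn; have h2 := hN m (leq_trans Nn nm).
have h3 := ncB ((\sum_(k < m) (nc (f k))%:C) - t) ((\sum_(k < n) (nc (f k))%:C) - t).
rewrite opprB addrA subrK -!rmorph_sum -rmorphB nc_real in h3.
have := ler_norm (\sum_(k < m) nc (f k) - \sum_(k < n) nc (f k)).
by rewrite -!rmorph_sum /= in h1 h2; lra.
Qed.

(* Summing the Taylor expansion of binom(a, s) in a over s first, the double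
   series becomes the exponential series of a log(1+y). *)
Lemma asum_beta0 a y : nc y < 1 ->
  asum (fun n => beta 0 n a * y ^+ n) (cexp (a * lam y)).
Proof.
move=> y1; have [t ht] := asum_beta 0 a y1.
suff -> : cexp (a * lam y) = t by [].
have [_ hE] := asum_exp (a * lam y).
apply: (seq_cvgC_uniq hE).
have [_ h2] := ht; apply: (seq_cvgC_sandwich h2).
(* [B n] majorizes the Taylor expansion of binom(a, n) in powers of a; the convergence of its series
   in y controls the exchange of the two summations. *)
pose B (n : nat) : R := \sum_(k < n.+1) nc (beta k n 0) * nc a ^+ k.
have B0 n : 0 <= B n.
  by apply: sumr_ge0 => k _; rewrite mulr_ge0 ?nc_ge0 // exprn_ge0 ?nc_ge0.
have [A hA] := nat_bound (nc a).
have [|M hM] := @bin_series_bound R A (nc y); first by rewrite nc_ge0.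
have Bbnd n : B n <= 'C(A + n, n)%:R.
  apply: le_trans (prod_fact_bound n _ hA); last exact: nc_ge0.
  by have := beta_norm 0 n (nc_ge0 a); rewrite nc0 addr0.
have [|tB hB] := @asum_bound_ex R (fun n => (B n)%:C * y ^+ n) M.
  move=> n; apply: le_trans (hM n); apply: ler_sum => k _.
  rewrite Normc.normcM ncX nc_real ger0_norm //; apply: ler_wpM2r => //.
  by rewrite exprn_ge0 ?nc_ge0.
apply/seq_cvgCP => e e0.
have [N hN] := asum_tail hB (divr_gt0 e0 (ltr0Sn _ 1)).
exists N => n Nn; rewrite subr0.
have Phi k : seq_cvgC (fun m => \sum_(j < m) beta k j 0 * y ^+ j)
    (lam y ^+ k / k`!%:R).
  have h0 : asum (fun j => beta 0 j 0 * y ^+ j) 1.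
    have := @asum_fin R (fun j => beta 0 j 0 * y ^+ j) 1.
    rewrite big_ord_recl big_ord0 addr0 beta00 mul1r expr0; apply => -[|j] //.
    by rewrite beta00 mul0r.
  by have [_] := asum_betaE k y1 h0; rewrite mul1r.
have cE := @seq_cvgC_sum R 'I_n (index_enum _) (fun (k : 'I_n) m => a ^+ (k : nat) *
  \sum_(j < m) beta k j 0 * y ^+ j) (fun k : 'I_n => a ^+ (k : nat) * (lam y ^+ k / k`!%:R))
  (fun k : 'I_n => seq_cvgCZ (a ^+ (k : nat)) (Phi k)).
(* Since [beta k j 0] vanishes for k > j, the triangular double sum may be completed to a square. *)
have -> : \sum_(k < n) beta 0 k a * y ^+ k =
    \sum_(k < n) a ^+ k * \sum_(j < n) beta k j 0 * y ^+ j.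
  under [RHS]eq_bigr do rewrite mulr_sumr.
  rewrite exchange_big /=; apply: eq_bigr => j _.
  rewrite beta_taylor mulr_suml (big_ord_widen n (fun k => a ^+ k * beta k j 0 * y ^+ j)) //.
    rewrite big_mkcond /=; apply: eq_bigr => k _.
    case: ltnP => // kj; first by rewrite mulrA.
    by rewrite /beta nth_default ?mul0r ?mulr0 //; apply: leq_trans (size_fbp _ _) kj.
rewrite -ncN opprB.
have -> : \sum_(k < n) (a * lam y) ^+ k / k`!%:R =
   \sum_(k < n) a ^+ k * (lam y ^+ k / k`!%:R).
  by apply: eq_bigr => k _; rewrite exprMn mulrA.
apply: le_lt_trans (_ : e / 2 < _); last by lra.
(* The inner limits are replaced by partial sums up to m >= n; the difference is then a finite block
   of indices n <= i < m, bounded by the tail of [B]. *)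
apply: (seq_cvgC_le (N := n) cE) => m nm.
rewrite -sumrB (eq_bigr (fun k : 'I_n => a ^+ k *
   \sum_(i < m | (n <= i)%N) beta k i 0 * y ^+ i)); last first.
  move=> k _; rewrite -mulrBr; congr (_ * _).
  rewrite (bigID (fun i : 'I_m => (i < n)%N)) /= -(big_ord_widen _ (fun i => beta k i 0 * y ^+ i) nm).
  by rewrite addrAC subrr add0r; apply: eq_bigl => i; rewrite -leqNgt.
apply: ltW; apply: le_lt_trans (hN n m _); last by rewrite Nn.
apply: le_trans (nc_sum _ _ _) _.
have -> : \sum_(k < m) nc ((B k)%:C * y ^+ k) - \sum_(k < n) nc ((B k)%:C * y ^+ k)
   = \sum_(i < m | (n <= i)%N) B i * nc y ^+ i.
  rewrite (bigID (fun i : 'I_m => (i < n)%N)) /=.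
  rewrite -(big_ord_widen _ (fun i => nc ((B i)%:C * y ^+ i)) nm) addrAC subrr add0r.
  apply: eq_big => [i|i _]; first by rewrite -leqNgt.
  by rewrite Normc.normcM ncX nc_real ger0_norm.
apply: le_trans (_ : \sum_(k < n) \sum_(i < m | (n <= i)%N)
   nc (beta k i 0) * nc a ^+ k * nc y ^+ i <= _).
  apply: ler_sum => k _; rewrite Normc.normcM ncX.
  apply: le_trans (ler_wpM2l _ (nc_sum _ _ _)) _; first by rewrite exprn_ge0 ?nc_ge0.
  rewrite mulr_sumr; apply: ler_sum => i _; rewrite Normc.normcM ncX.
  by rewrite mulrA [_ * nc (beta _ _ _)]mulrC.
rewrite exchange_big /=; apply: ler_sum => i ni.
rewrite -mulr_suml; apply: ler_wpM2r; first by rewrite exprn_ge0 ?nc_ge0.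
rewrite /B (big_ord_widen i.+1 (fun k => nc (beta k i 0) * nc a ^+ k)); last first.
  exact: leq_trans ni _.
rewrite big_mkcond /=; apply: ler_sum => k _; case: ifP => // _.
by rewrite mulr_ge0 ?nc_ge0 // exprn_ge0 ?nc_ge0.
Qed.

Lemma asum_beta_exp k a y : nc y < 1 ->
  asum (fun n => beta k n a * y ^+ n) (cexp (a * lam y) * (lam y ^+ k / k`!%:R)).
Proof. by move=> y1; apply: asum_betaE => //; exact: asum_beta0. Qed.

(** At a = 1 the binomial series is the polynomial 1 + y. *)
Lemma cexp_lam y : nc y < 1 -> cexp (lam y) = 1 + y.
Proof.
move=> y1; have := asum_beta0 1 y1; rewrite mul1r => h.
have h2 : asum (fun n => beta 0 n (1 : C) * y ^+ n) (1 + y).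
  have b2 n : beta 0 n.+2 (1 : C) = 0.
    rewrite beta0E horner_fbp big_ord_recl big_ord_recl /= /bump /=.
    by rewrite (_ : 1 + (0 - (1 + 0)%:R) = 0 :> C) ?mul0r ?mulr0 // sub0r subrr.
  have b0 : beta 0 0 (1 : C) = 1 by rewrite /beta fbp0 coef1.
  have b1 : beta 0 1 (1 : C) = 1.
    by rewrite beta0E horner_fbp big_ord1 subr0 addr0 mulr1 invr1.
  have := @asum_fin R (fun j => beta 0 j 1 * y ^+ j) 2.
  rewrite big_ord_recl big_ord1 b0 b1 expr0 expr1 !mul1r; apply.
  by move=> [|[|n]] // _; rewrite b2 mul0r.
exact: asum_uniq h h2.
Qed.

Lemma Re_gt0_small y : nc y < 1 -> 0 < complex.Re (1 + y).
Proof.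
move=> y1; rewrite ReD /=; have := le_Re_nc y.
by move=> /(le_lt_trans)/(_ y1); rewrite ltr_norml => /andP[]; lra.
Qed.

(** Since |p^k - q^k| <= k |p - q|, the factor k cancels the denominator of the k-th coefficient of
    the logarithm, and a geometric series in |y| remains. *)
Lemma lam_lip y (p q : R) : nc y < 1 -> 0 <= p <= 1 -> 0 <= q <= 1 ->
  nc (lam (p%:C * y) - lam (q%:C * y)) <= `|p - q| / (1 - nc y).
Proof.
move=> y1 p01 q01.
have ny (r : R) : 0 <= r <= 1 -> nc (r%:C * y) < 1.
  move=> /andP[r0 r1]; rewrite Normc.normcM nc_real ger0_norm //.
  by apply: le_lt_trans y1; rewrite ler_piMl ?nc_ge0.
have [_ h1] := lamP (ny p p01); have [_ h2] := lamP (ny q q01).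
have h := seq_cvgCD h1 (seq_cvgCZ (-1) h2); rewrite mulN1r in h.
rewrite -[X in nc X]subr0; apply: (seq_cvgC_le (N := 0) h) => n _; rewrite subr0.
rewrite mulN1r -sumrB; apply: le_trans (nc_sum _ _ _) _.
apply: le_trans (_ : \sum_(k < n) `|p - q| * nc y ^+ k <= _).
  apply: ler_sum => k _.
  have pqE : p%:C ^+ k - q%:C ^+ k = (p ^+ k - q ^+ k)%:C by rewrite rmorphB !rmorphXn.
  rewrite !exprMn -mulrBr -mulrBl Normc.normcM (Normc.normcM _ (y ^+ k)) ncX pqE nc_real.
  rewrite mulrA; apply: ler_wpM2r; first by rewrite exprn_ge0 ?nc_ge0.
  clear pqE; move: (nat_of_ord k) => {k} [|k]; first by rewrite logc0 nc0 mul0r.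
  have -> : nc (logc R k.+1) = k.+1%:R^-1.
    rewrite /logc Normc.normcM Normc.normcV nc_nat ncX.
    by rewrite ncN nc1 expr1n mul1r.
  rewrite ler_pdivrMl ?ltr0n // subrXX normrM mulrC; apply: ler_wpM2r => //.
  apply: le_trans (ler_norm_sum _ _ _) _.
  apply: le_trans (_ : \sum_(i < k.+1) 1 <= _); last by rewrite sumr_const card_ord.
  apply: ler_sum => i _; rewrite normrM !normrX.
  by apply: mulr_ile1; rewrite ?exprn_ge0 // exprn_ile1 // ger0_norm;
     case/andP: p01 => //; case/andP: q01.
rewrite -mulr_sumr; apply: ler_wpM2l => //.
rewrite -[leRHS]mul1r ler_pdivlMr ?subr_gt0 // mulrC -opprB mulNr -subrX1 opprB.
by rewrite lerBlDr lerDl exprn_ge0 ?nc_ge0.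
Qed.

Lemma cos_le0_far (x : R) : pi / 2 <= x <= pi + pi / 2 -> cos x <= 0.
Proof.
move=> h; rewrite -[x](subrK pi) cosDpi oppr_le0 cos_ge0_pihalf //.
by move: h; have := pi_gt0 R; lra.
Qed.

(* The argument of 1 + t y stays in the right half plane for t in [0, 1], so
   Im log(1 + t y), moving from 0 in small steps, cannot leave ]-pi/2, pi/2[. *)
Lemma Im_lam y : nc y < 1 -> `|complex.Im (lam y)| < pi / 2.
Proof.
move=> y1; pose K : R := (1 - nc y)^-1.
have K0 : 0 < K by rewrite invr_gt0 subr_gt0.
(* With n + 1 >= K, consecutive values of the logarithm along n + 1 equal steps differ by at most 1
   < pi. *)
have [n hn] := nat_bound K.
have n0 : 0 < (n.+1%:R : R) by rewrite ltr0n.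
have tri (b c : R) : `|b| < pi / 2 -> `|c - b| < pi -> `|c| <= pi + pi / 2.
  move=> hb hcb; rewrite -(subrK b c); apply: le_trans (ler_normD _ _) _.
  exact: lerD (ltW hcb) (ltW hb).
have step j : (j <= n.+1)%N -> `|complex.Im (lam ((j%:R / n.+1%:R : R)%:C * y))| < pi / 2.
  elim: j => [|j IH] jn.
    rewrite mul0r (_ : 0%:C = 0) // mul0r.
    have -> : lam 0 = 0.
      apply: asum_uniq (lamP _) _; first by rewrite nc0.
      have := @asum_fin R (fun j => logc R j * 0 ^+ j) 0; rewrite big_ord0; apply.
      by move=> [|k] _; rewrite ?logc0 ?mul0r // expr0n mulr0.
    by rewrite /= normr0 divr_gt0 // pi_gt0.
  have {}IH := IH (ltnW jn).
  have q01 k : (k <= n.+1)%N -> 0 <= (k%:R / n.+1%:R : R) <= 1.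
    by move=> kn; rewrite divr_ge0 //= ler_pdivrMr // mul1r ler_nat.
  have hl := lam_lip y1 (q01 _ jn) (q01 _ (ltnW jn)).
  have e1 : `|j.+1%:R / n.+1%:R - j%:R / n.+1%:R| = (n.+1%:R)^-1 :> R.
    rewrite -mulrBl -natr1 addrAC subrr add0r mul1r ger0_norm ?invr_ge0 ?ler0n //.
  rewrite e1 in hl.
  set z := lam _ in IH hl; set z' := lam _ in hl *.
  have h1 : nc (z' - z) < pi.
    apply: le_lt_trans hl _; apply: (@lt_le_trans _ _ 2); last exact: pi_ge2.
    apply: (@le_lt_trans _ _ 1); last by rewrite ltr1n.
    by rewrite -/K mulrC ler_pdivrMr // mul1r.
  have h2 : `|complex.Im z' - complex.Im z| < pi.
    by apply: le_lt_trans h1; rewrite -ImN -ImD le_Im_nc.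
  have hy : nc ((j.+1%:R / n.+1%:R : R)%:C * y) < 1.
    rewrite Normc.normcM nc_real; have /andP[a b] := q01 _ jn.
    rewrite ger0_norm //; apply: le_lt_trans y1; by rewrite ler_piMl ?nc_ge0.
  have h3 : 0 < cos (complex.Im z').
    have := Re_gt0_small hy; rewrite -cexp_lam // Re_cexp.
    by rewrite pmulr_rgt0 ?expR_gt0.
  (* An imaginary part of absolute value between pi/2 and 3 pi/2 would have a cosine <= 0. *)
  rewrite ltNge; apply/negP => h4.
  have : cos `|complex.Im z'| <= 0.
    apply: cos_le0_far; rewrite h4 /=; exact: tri IH h2.
  by rewrite cos_norm leNgt h3.
have n1 : n.+1%:R / n.+1%:R = 1 :> R by rewrite divff // gt_eqF.
by have := step n.+1 (leqnn _); rewrite n1 mul1r.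
Qed.

(** The difference of the two logarithms and [lam] have the same exponential z1 / z2, and both lie
    in the strip |Im| < pi/2, where the exponential is injective. This is what the condition on q is
    for. *)
Lemma lbr_lam (p q : int) (z1 z2 : C) :
  nc (z1 - z2) < nc z2 -> `|complex.Im (lbr q z1 - lbr p z2)| < pi / 2 ->
  lbr q z1 = lbr p z2 + lam ((z1 - z2) / z2).
Proof.
move=> h hI.
have z20 : z2 != 0.
  by rewrite -nc_gt0; apply: le_lt_trans h; exact: nc_ge0.
have z10 : z1 != 0.
  by apply: contraTneq h => ->; rewrite sub0r ncN ltxx.
have y1 : nc ((z1 - z2) / z2) < 1.
  by rewrite Normc.normcM Normc.normcV ltr_pdivrMr ?nc_gt0 // mul1r.
rewrite -(subrK (lbr p z2) (lbr q z1)) addrC; congr (_ + _).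
apply: cexp_inj_strip => //; first exact: Im_lam.
rewrite cexp_lam // cexpD cexpN !cexp_lbr //.
by field.
Qed.

End LogSeries.

(** * Unordered sums *)

Section UnorderedSums.
Variable R : realType.
Local Notation C := R[i].
Local Notation nc := (@Normc.normc R).

(* abs_sums_to, with finite index sets given by duplicate-free sequences. *)
Definition sasum (I : choiceType) (f : I -> C) (s : C) : Prop :=
  (exists M : R, forall r : seq I, uniq r -> \sum_(i <- r) nc (f i) <= M) /\
  forall e : R, 0 < e -> exists r0 : seq I, forall r : seq I, uniq r ->
    {subset r0 <= r} -> nc (\sum_(i <- r) f i - s) < e.

Lemma sasum_abs (I : choiceType) (f : I -> C) (s : C) :
  sasum f s -> abs_sums_to f s.
Proof.
move=> [[M hM] h]; split.
  rewrite /summable; apply: le_lt_trans (ltry M).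
  apply: ge_ereal_sup => _ [A [finA _] <-].
  rewrite fsbig_finite //=.
  under eq_bigr do rewrite ger0_norm ?nc_ge0 //.
  by rewrite sumEFin lee_fin; apply: hM; exact: finmap.fset_uniq.
move=> e /h [r0 hr0]; exists [set` r0]; first exact: finite_seq.
move=> B finB AB; rewrite fsbig_finite //= normCE ltcR.
apply: hr0; first exact: finmap.fset_uniq.
by move=> i ir; rewrite in_fset_set // inE; apply: AB.
Qed.

Lemma sasum_eq (I : choiceType) (f g : I -> C) (s : C) :
  f =1 g -> sasum f s -> sasum g s.
Proof. by move=> /funext ->. Qed.

Lemma sasum0 (I : choiceType) : sasum (fun _ : I => 0) (0 : C).
Proof.
split; first by exists 0 => r _; rewrite big1 // nc0.
by move=> e e0; exists [::] => r _ _; rewrite big1 // subr0 nc0.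
Qed.

Lemma sasumD (I : choiceType) (f g : I -> C) s t : sasum f s -> sasum g t ->
  sasum (fun i => f i + g i) (s + t).
Proof.
move=> [[M hM] h] [[K hK] k]; split.
  exists (M + K) => r ur; apply: le_trans (lerD (hM r ur) (hK r ur)).
  by rewrite -big_split /=; apply: ler_sum => i _; exact: ncD.
move=> e e0; have e20 : 0 < e / 2 by rewrite divr_gt0.
have [r1 h1] := h _ e20; have [r2 h2] := k _ e20.
exists (r1 ++ r2) => r ur sr.
have a : nc (\sum_(i <- r) f i - s) < e / 2.
  by apply: h1 => // i ir; apply: sr; rewrite mem_cat ir.
have b : nc (\sum_(i <- r) g i - t) < e / 2.
  by apply: h2 => // i ir; apply: sr; rewrite mem_cat ir orbT.
rewrite big_split /= opprD addrACA; apply: le_lt_trans (ncD _ _) _; lra.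
Qed.

Lemma sasumZ (I : choiceType) (f : I -> C) c s : sasum f s ->
  sasum (fun i => c * f i) (c * s).
Proof.
move=> [[M hM] h]; split.
  exists (nc c * M) => r ur; under eq_bigr do rewrite Normc.normcM.
  by rewrite -mulr_sumr ler_wpM2l ?nc_ge0 ?hM.
have [->|c0] := eqVneq c 0.
  move=> e e0; exists [::] => r _ _; rewrite big1 => [|i _]; last by rewrite mul0r.
  by rewrite mul0r subr0 nc0.
have c1 : 0 < nc c by rewrite nc_gt0.
move=> e e0; have [r0 hr0] := h _ (divr_gt0 e0 c1).
exists r0 => r ur sr; have := hr0 r ur sr.
by rewrite -mulr_sumr -mulrBr Normc.normcM ltr_pdivlMr // mulrC.
Qed.

Lemma sasum_reindex (I J : choiceType) (h : I -> J) (F : J -> C) s :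
  injective h -> (forall j, F j != 0 -> exists i, j = h i) ->
  sasum (F \o h) s -> sasum F s.
Proof.
move=> hinj hF [[M hM] hs].
have pre (r : seq J) : uniq r -> exists r' : seq I, [/\ uniq r',
    (forall i, (i \in r') = (h i \in r)),
    \sum_(j <- r) F j = \sum_(i <- r') F (h i) &
    \sum_(j <- r) nc (F j) = \sum_(i <- r') nc (F (h i))].
  elim: r => [|j r IH] /=; first by exists [::]; rewrite !big_nil.
  move=> /andP[jr /IH [r' [ur' mr' e1 e2]]].
  have [[i ji]|nj] := pselect (exists i, j = h i).
    exists (i :: r'); split => /=; rewrite ?big_cons ?e1 ?e2 -?ji //.
      by rewrite mr' -ji jr.
    by move=> i'; rewrite !inE mr' ji (inj_eq hinj).
  have Fj : F j = 0.
    by apply/eqP; apply: contra_notT nj; exact: hF.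
  exists r'; split => //; rewrite ?big_cons ?Fj ?nc0 ?add0r //.
  move=> i; rewrite inE mr'; case: eqP => // hij; exfalso; apply: nj.
  by exists i.
split.
  by exists M => r /pre [r' [ur' _ _ ->]]; exact: hM.
move=> e /hs [r0 hr0]; exists (map h r0) => r /pre [r' [ur' mr' -> _]] sr.
apply: hr0 => // i ir0; rewrite mr'; apply: sr; exact: map_f.
Qed.

Lemma asum_sasum (f : nat -> C) s : asum f s -> sasum f s.
Proof.
move=> hf; have [[M hM] hs] := hf.
have nat_seq (V : nmodType) (F : nat -> V) (r : seq nat) n : uniq r ->
    (forall k, k \in r -> (k < n)%N) ->
    \sum_(i <- r) F i = \sum_(k < n | (k : nat) \in r) F k.
  move=> ur hr; rewrite -(big_mkord (fun k => k \in r) F) -big_filter.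
  apply: perm_big; apply: uniq_perm => //; first by rewrite filter_uniq ?iota_uniq.
  move=> k; rewrite mem_filter mem_index_iota /=.
  by case kr : (k \in r) => //=; rewrite hr.
have bnd (r : seq nat) : exists n, forall k, k \in r -> (k < n)%N.
  exists (\max_(k <- r) k).+1 => k kr; rewrite ltnS.
  exact: (@leq_bigmax_seq _ r xpredT (fun k => k)).
split.
  exists M => r ur; have [n hn] := bnd r; apply: le_trans (hM n).
  rewrite (nat_seq _ _ _ n) // big_mkcond /=; apply: ler_sum => i _.
  by case: ifP => // _; exact: nc_ge0.
move=> e e0; have e20 : 0 < e / 2 by rewrite divr_gt0.
have [N1 h1] := asum_tail hf e20.
move: hs => /seq_cvgCP hs; have [N2 h2] := hs _ e20.
(* The initial segment up to N approximates the sum; whatever else r contains is bounded by a tail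
   of the norms. *)
pose N := maxn N1 N2; exists (iota 0 N) => r ur sr.
have [n0 hn0] := bnd r; pose n := maxn n0 N.
have Nn : (N <= n)%N by exact: leq_maxr.
have hn k : k \in r -> (k < n)%N by move=> /hn0 h; apply: leq_trans h (leq_maxl _ _).
rewrite (nat_seq _ _ _ n) // (bigID (fun i : 'I_n => (i < N)%N)) /=.
rewrite (eq_bigl (fun i : 'I_n => (i < N)%N)); last first.
  move=> i /=; case: ltnP => iN; rewrite ?andbF // andbT sr //.
  by rewrite mem_iota.
rewrite -(big_ord_widen _ f Nn) addrAC.
apply: le_lt_trans (ncD _ _) _.
have a := h2 N (leq_maxr _ _).
suff b : nc (\sum_(i < n | ((i : nat) \in r) && ~~ (i < N)%N) f i) < e / 2 by lra.
apply: le_lt_trans (nc_sum _ _ _) _.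
apply: le_lt_trans (h1 N n _); last by rewrite leq_maxl Nn.
rewrite [X in _ <= X - _](bigID (fun i : 'I_n => (i < N)%N)) /=.
rewrite -(big_ord_widen _ (fun i => nc (f i)) Nn) addrAC subrr add0r.
rewrite big_mkcond [leRHS]big_mkcond /=; apply: ler_sum => i _.
case: (_ \in r); case: ltnP => //= _; exact: nc_ge0.
Qed.

(** Multiplication by 1 + d x on the coefficients of a Laurent series; its t-fold iterate multiplies
    by (1 + d x)^t. *)
Definition diffz (d : C) (f : int -> C) (i : int) := f i + d * f (i - 1).

Lemma iter_diffz d f t i : iter t (diffz d) f i =
  \sum_(k < t.+1) ('C(t, k)%:R * d ^+ k) * f (i - k%:Z).
Proof.
elim: t i => [|t IH] i.
  by rewrite big_ord1 /= bin0 expr0 !mul1r subr0.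
rewrite iterS /diffz !IH big_ord_recl [in RHS]big_ord_recl /= !bin0 -!addrA; congr (_ + _).
rewrite [X in _ = X](eq_bigr (fun k : 'I_t.+1 =>
   ('C(t, k.+1)%:R * d ^+ k.+1) * f (i - k.+1%:Z) +
   d * (('C(t, k)%:R * d ^+ k) * f (i - 1 - k%:Z)))); last first.
  move=> k _; rewrite /bump /= add1n binS natrD exprS.
  have -> : i - 1 - k%:Z = i - k.+1%:Z by lia.
  by ring.
rewrite big_split /= -mulr_sumr; congr (_ + _).
by rewrite [RHS]big_ord_recr /= bin_small // mul0r mul0r addr0.
Qed.

(** The series times (1 + d x)^t is a finite sum; [asum_divide] removes the factors one at a time
    and is evaluated at x = 1. *)
Lemma zdiv_aux d t (f : int -> C) (i0 : int) N : nc d < 1 ->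
  (forall i, i < i0 -> f i = 0) ->
  (forall n : nat, (N <= n)%N -> iter t (diffz d) f (i0 + n%:Z) = 0) ->
  asum (fun n : nat => f (i0 + n%:Z))
    ((\sum_(n < N) iter t (diffz d) f (i0 + n%:Z)) / (1 + d) ^+ t).
Proof.
move=> d1; elim: t f => [|t IH] f f0 h.
  by rewrite expr0 divr1; exact: asum_fin.
rewrite iterSr in h *.
have h2 : forall i, i < i0 -> diffz d f i = 0.
  by move=> i ii0; rewrite /diffz !f0 ?mulr0 ?addr0 //; lia.
have {}IH := IH _ h2 h.
have -> : forall S : C, S / (1 + d) ^+ t.+1 = (S / (1 + d) ^+ t) / (1 + d).
  by move=> S; rewrite exprS invfM mulrCA mulrC.
apply: (asum_divide d1 IH) => [|n]; rewrite /diffz.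
  by rewrite (f0 (_ - 1)) ?mulr0 ?addr0 //; lia.
by congr (_ + _ * f _); lia.
Qed.

Lemma zdiv d t (f : int -> C) (i0 : int) N : nc d < 1 ->
  (forall i, i < i0 -> f i = 0) ->
  (forall n : nat, (N <= n)%N ->
     \sum_(k < t.+1) ('C(t, k)%:R * d ^+ k) * f (i0 + n%:Z - k%:Z) = 0) ->
  sasum f ((\sum_(n < N) \sum_(k < t.+1)
     ('C(t, k)%:R * d ^+ k) * f (i0 + n%:Z - k%:Z)) / (1 + d) ^+ t).
Proof.
move=> d1 f0 h.
apply: (@sasum_reindex _ _ (fun n : nat => i0 + n%:Z)).
- by move=> m n /addrI [].
- move=> j fj; have jj : i0 <= j by rewrite leNgt; apply: contraNN fj => /f0 ->.
  by exists `|j - i0|%N; lia.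
apply: asum_sasum.
under eq_bigr do rewrite -iter_diffz.
by apply: zdiv_aux => // n Nn; rewrite iter_diffz; exact: h.
Qed.

End UnorderedSums.

(** * Direct sums and generalized eigenspaces *)

Section FiniteSums.
Variables (I : choiceType) (M : nmodType).
Implicit Types (F G : I -> M).

Lemma fin_suppP F : finite_set [set i | F i != 0] <->
  exists r : seq I, uniq r /\ forall i, i \notin r -> F i = 0.
Proof.
split.
  move=> /finite_seqP [r rE]; exists (undup r); split; first exact: undup_uniq.
  move=> i; rewrite mem_undup => ir; apply/eqP; apply: contraNT ir => Fi.
  by have : [set i | F i != 0] i by []; rewrite rE.
move=> [r [_ hr]]; apply: (sub_finite_set _ (finite_seq r)) => i /= Fi.
by apply: contraNT Fi => /hr ->.
Qed.

Lemma fsum_seq F (r : seq I) : uniq r -> (forall i, i \notin r -> F i = 0) ->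
  \sum_(i \in [set: I]) F i = \sum_(i <- r) F i.
Proof.
move=> ur hr; rewrite (fsbigE r) //=.
  by apply: eq_bigl => i; rewrite in_setT.
by move=> i _; exact: hr.
Qed.

Lemma fsum_single F j : (forall i, i != j -> F i = 0) ->
  \sum_(i \in [set: I]) F i = F j.
Proof.
move=> h; rewrite (@fsum_seq _ [:: j]) ?big_seq1 //.
by move=> i; rewrite inE => /h.
Qed.

Lemma fsum_eq F G : F =1 G -> \sum_(i \in [set: I]) F i = \sum_(i \in [set: I]) G i.
Proof. by move=> /funext ->. Qed.

Lemma fsum_eq0 F : (forall i, F i = 0) -> \sum_(i \in [set: I]) F i = 0.
Proof. by move=> h; rewrite fsbig1. Qed.

Lemma fin_supp_sub F G : (forall i, F i != 0 -> G i != 0) ->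
  finite_set [set i | G i != 0] -> finite_set [set i | F i != 0].
Proof. by move=> h; apply: sub_finite_set => i /=; exact: h. Qed.

Lemma fin_suppD F G : finite_set [set i | F i != 0] ->
  finite_set [set i | G i != 0] -> finite_set [set i | F i + G i != 0].
Proof.
move=> hF hG; have := finite_setU [set i | F i != 0] [set i | G i != 0].
rewrite propeqE => -[_ h].
apply: (sub_finite_set _ (h (conj hF hG))) => i /=.
have [->|] := eqVneq (F i) 0; last by left.
by rewrite add0r; right.
Qed.

Lemma fsumD F G : finite_set [set i | F i != 0] ->
  finite_set [set i | G i != 0] ->
  \sum_(i \in [set: I]) (F i + G i) =
  \sum_(i \in [set: I]) F i + \sum_(i \in [set: I]) G i.
Proof.
move=> /fin_suppP [r [ur hr]] /fin_suppP [s [us hs]].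
pose t := undup (r ++ s).
have ut : uniq t by exact: undup_uniq.
have ht i : i \notin t -> i \notin r /\ i \notin s.
  by rewrite mem_undup mem_cat negb_or => /andP.
rewrite !(@fsum_seq _ t) ?big_split // => i /ht [ir iis].
- by rewrite hs.
- by rewrite hr.
- by rewrite hr // hs // addr0.
Qed.

End FiniteSums.

Lemma fsum_nat (M : nmodType) (F : nat -> M) N : (forall n, (N <= n)%N -> F n = 0) ->
  \sum_(n \in [set: nat]) F n = \sum_(n < N) F n.
Proof.
move=> h; rewrite (@fsum_seq _ _ _ (iota 0 N)) ?iota_uniq //.
  by rewrite -(big_mkord xpredT F) /index_iota subn0.
by move=> i; rewrite mem_iota /= -leqNgt; exact: h.
Qed.

Section LinearFacts.
Variables (K : pzRingType) (U V : lmodType K) (f : U -> V).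
Hypothesis hf : linear f.

Lemma linD x y : f (x + y) = f x + f y.
Proof. by have := hf 1 x y; rewrite !scale1r. Qed.
Lemma lin0 : f 0 = 0.
Proof. by have := linD 0 0; rewrite addr0 => /esym/eqP; rewrite -subr_eq0 addrK => /eqP. Qed.
Lemma linZ a x : f (a *: x) = a *: f x.
Proof. by have := hf a x 0; rewrite !addr0 lin0 addr0. Qed.
Lemma linN x : f (- x) = - f x.
Proof. by rewrite -scaleN1r linZ scaleN1r. Qed.
Lemma linB x y : f (x - y) = f x - f y.
Proof. by rewrite linD linN. Qed.
Lemma lin_sum (I : Type) (r : seq I) (P : pred I) (F : I -> U) :
  f (\sum_(i <- r | P i) F i) = \sum_(i <- r | P i) f (F i).
Proof. by elim/big_rec2: _ => [|i x y _ <-]; rewrite ?lin0 ?linD. Qed.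
Lemma lin_fsum (I : choiceType) (F : I -> U) :
  finite_set [set i | F i != 0] ->
  f (\sum_(i \in [set: I]) F i) = \sum_(i \in [set: I]) f (F i).
Proof.
move=> /fin_suppP [r [ur hr]]; rewrite !(@fsum_seq _ _ _ r) ?lin_sum // => i /hr.
by move=> ->; exact: lin0.
Qed.
End LinearFacts.

Lemma lin_id (K : pzRingType) (U : lmodType K) : linear (fun x : U => x).
Proof. by []. Qed.

Lemma lin_scaler (K : comPzRingType) (U : lmodType K) a : linear (fun x : U => a *: x).
Proof. by move=> b x y; rewrite scalerDr !scalerA mulrC. Qed.

Lemma lin_comp (K : pzRingType) (U V W : lmodType K) (f : V -> W) (g : U -> V) :
  linear f -> linear g -> linear (fun x => f (g x)).
Proof. by move=> hf hg a x y; rewrite hg hf. Qed.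

Lemma lin_iter (K : pzRingType) (U : lmodType K) (f : U -> U) n :
  linear f -> linear (iter n f).
Proof. by move=> hf; elim: n => [|n IH] a x y //=; rewrite IH hf. Qed.

Lemma lin_scale (K : comPzRingType) (U V : lmodType K) (f : U -> V) c :
  linear f -> linear (fun x => c *: f x).
Proof. by move=> hf a x y; rewrite hf scalerDr !scalerA mulrC. Qed.

Lemma lin_add (K : pzRingType) (U V : lmodType K) (f g : U -> V) :
  linear f -> linear g -> linear (fun x => f x + g x).
Proof. by move=> hf hg a x y; rewrite hf hg scalerDr addrACA. Qed.

Lemma lin_sub (K : pzRingType) (U V : lmodType K) (f g : U -> V) :
  linear f -> linear g -> linear (fun x => f x - g x).
Proof. by move=> hf hg a x y; rewrite hf hg scalerBr opprD addrACA. Qed.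

Lemma lin_bigsum (K : pzRingType) (U V : lmodType K) (J : Type) (r : seq J)
  (P : pred J) (F : J -> U -> V) :
  (forall j, linear (F j)) -> linear (fun x => \sum_(j <- r | P j) F j x).
Proof.
move=> h a x y; rewrite scaler_sumr -big_split; apply: eq_bigr => j _; exact: h.
Qed.

Lemma scale_fsum (K : comPzRingType) (V : lmodType K) (I : choiceType)
  (F : I -> V) a : finite_set [set i | F i != 0] ->
  a *: (\sum_(i \in [set: I]) F i) = \sum_(i \in [set: I]) a *: F i.
Proof. by move=> h; exact: (lin_fsum (lin_scaler a) h). Qed.

Lemma lin_fsums (K : comPzRingType) (U V : lmodType K) (I : choiceType)
  (F : I -> U -> V) : (forall i, linear (F i)) ->
  (forall x, finite_set [set i | F i x != 0]) ->
  linear (fun x => \sum_(i \in [set: I]) F i x).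
Proof.
move=> h hfin a x y.
have -> : \sum_(i \in [set: I]) F i (a *: x + y) =
    \sum_(i \in [set: I]) (a *: F i x + F i y) by apply: fsum_eq => i; exact: h.
have ha : finite_set [set i | a *: F i x != 0].
  apply: (fin_supp_sub _ (hfin x)) => i; apply: contraNN => /eqP ->.
  by rewrite scaler0.
by rewrite fsumD // scale_fsum.
Qed.

Section DirectSum.
Variables (R : realType) (M : lmodType R[i]) (I : choiceType) (A : I -> set M).
Local Notation C := R[i].

Lemma subspace0 (B : set M) : subspace B -> B 0. Proof. by case. Qed.
Lemma subspaceD (B : set M) x y : subspace B -> B x -> B y -> B (x + y).
Proof. by move=> [_ h] hx hy; have := h 1 x y hx hy; rewrite scale1r. Qed.
Lemma subspaceZ (B : set M) c x : subspace B -> B x -> B (c *: x).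
Proof. by move=> [h0 h] hx; have := h c x 0 hx h0; rewrite addr0. Qed.
Lemma subspaceN (B : set M) x : subspace B -> B x -> B (- x).
Proof. by move=> h hx; rewrite -scaleN1r; exact: subspaceZ. Qed.
Lemma subspaceB (B : set M) x y : subspace B -> B x -> B y -> B (x - y).
Proof. by move=> h hx hy; apply: subspaceD => //; exact: subspaceN. Qed.
Lemma subspace_sum (B : set M) (J : Type) (r : seq J) (P : pred J) (F : J -> M) :
  subspace B -> (forall j, P j -> B (F j)) -> B (\sum_(j <- r | P j) F j).
Proof.
move=> h hF; elim/big_rec: _ => [|j x Pj hx]; first exact: subspace0.
by apply: subspaceD => //; exact: hF.
Qed.
Lemma subspace_fsum (B : set M) (J : choiceType) (F : J -> M) :
  subspace B -> (forall j, B (F j)) -> B (\sum_(j \in [set: J]) F j).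
Proof. by move=> h hF; apply: subspace_sum => // j _; exact: hF. Qed.

(** Repeated indices are allowed, so that closure under addition is concatenation; equal indices are
    collected once, in [in_span_decomposition]. *)
Definition in_span x := exists l : seq (I * M),
  (forall p, p \in l -> A p.1 p.2) /\ x = \sum_(p <- l) p.2.

Lemma in_span_mem i x : A i x -> in_span x.
Proof.
move=> h; exists [:: (i, x)]; rewrite big_seq1; split => //.
by move=> p; rewrite inE => /eqP ->.
Qed.

Lemma in_spanD x y : in_span x -> in_span y -> in_span (x + y).
Proof.
move=> [l [hl ->]] [k [hk ->]]; exists (l ++ k); rewrite big_cat; split => //.
by move=> p; rewrite mem_cat => /orP[/hl|/hk].
Qed.

Lemma in_span0 : in_span 0.
Proof. by exists [::]; rewrite big_nil. Qed.

Lemma in_span_decomposition x : (forall i, subspace (A i)) -> in_span x ->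
  exists f, decomposition A x f.
Proof.
move=> sA [l [hl ->]]; exists (fun i => \sum_(p <- l | p.1 == i) p.2); split.
- move=> i; rewrite big_seq_cond; apply: subspace_sum => // p /andP[/hl h /eqP <-].
  exact: h.
- apply/fin_suppP; exists (undup (map fst l)); split; first exact: undup_uniq.
  move=> i; rewrite mem_undup => il; rewrite big_seq_cond big1 // => p /andP[pl /eqP e].
  by exfalso; move: il; rewrite -e map_f.
- rewrite (@fsum_seq _ _ _ (undup (map fst l))) ?undup_uniq //; last first.
    move=> i; rewrite mem_undup => il; rewrite big_seq_cond big1 // => p /andP[pl /eqP e].
    by exfalso; move: il; rewrite -e map_f.
  rewrite (exchange_big_dep xpredT) //= [LHS]big_seq [RHS]big_seq.
  apply: eq_bigr => p pl; rewrite big_mkcond /= (bigD1_seq p.1) ?undup_uniq //=; last first.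
    by rewrite mem_undup map_f.
  by rewrite eqxx big1 ?addr0 // => i; rewrite eq_sym => /negbTE ->.
Qed.

Lemma direct_sum_intro : (forall i, subspace (A i)) -> (forall x, in_span x) ->
  (forall f, decomposition A 0 f -> forall i, f i = 0) -> direct_sum A.
Proof.
move=> sA spA ind; split => // x.
have [f fx] := in_span_decomposition sA (spA x); exists f; split => // g [g1 g2 g3].
case: fx => [f1 f2 f3].
have fs : finite_set [set i | - g i != 0].
  by apply: (fin_supp_sub _ g2) => i; rewrite oppr_eq0.
apply/funext => i; apply/eqP; rewrite -subr_eq0; apply/eqP.
apply: (ind (fun i => f i - g i)); split.
- by move=> j; exact: subspaceB.
- exact: fin_suppD.
- rewrite fsumD // -f3 -[X in _ + X](_ : - x = _) ?subrr //.
  by rewrite {1}g3 -scaleN1r scale_fsum //; apply: fsum_eq => j; rewrite scaleN1r.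
Qed.

Hypothesis dA : direct_sum A.
Local Notation cmp := (component A).

Lemma component_dec x : decomposition A x (fun i => cmp i x).
Proof.
have [_ /(_ x) [f [fx _]]] := dA.
by rewrite /component; exact: (xgetI (fun=> 0) fx).
Qed.

Lemma component_uniq x f : decomposition A x f -> forall i, cmp i x = f i.
Proof.
have [_ /(_ x) [g [_ gu]]] := dA => fx i.
by have := gu _ (component_dec x); rewrite (gu _ fx) => ->.
Qed.

Lemma component_mem i x : A i (cmp i x). Proof. by case: (component_dec x). Qed.

Lemma component_fin x : finite_set [set i | cmp i x != 0].
Proof. by case: (component_dec x). Qed.

Lemma component_sum x : x = \sum_(i \in [set: I]) cmp i x.
Proof. by case: (component_dec x). Qed.

Lemma ds_subspace i : subspace (A i). Proof. by case: dA. Qed.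

Lemma component_linear i : linear (cmp i).
Proof.
move=> c x y; have [x1 x2 x3] := component_dec x; have [y1 y2 y3] := component_dec y.
apply: (component_uniq (f := fun i => c *: cmp i x + cmp i y)).
have h : finite_set [set i | c *: cmp i x != 0].
  by apply: (fin_supp_sub _ x2) => j; apply: contraNN => /eqP ->; rewrite scaler0.
split; [|exact: fin_suppD|].
  move=> j; apply: (subspaceD (ds_subspace j)) => //.
  exact: (subspaceZ _ (ds_subspace j)).
by rewrite fsumD // -scale_fsum // -x3 -y3.
Qed.

Lemma component_id i x : A i x -> forall j, cmp j x = if j == i then x else 0.
Proof.
move=> h; apply: component_uniq; split.
- move=> j; case: eqP => [->//|_]; exact: subspace0 (ds_subspace j).
- apply/fin_suppP; exists [:: i]; split => // j; rewrite inE => /negbTE -> //.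
- by rewrite (@fsum_single _ _ _ i) ?eqxx // => j /negbTE ->.
Qed.

Lemma component_self i x : A i x -> cmp i x = x.
Proof. by move=> /component_id ->; rewrite eqxx. Qed.

Lemma component_other i j x : A i x -> j != i -> cmp j x = 0.
Proof. by move=> /component_id -> /negbTE ->. Qed.

Lemma component_memP i x : A i x <-> forall j, j != i -> cmp j x = 0.
Proof.
split; first by move=> h j ji; exact: component_other h ji.
by move=> h; rewrite (component_sum x) (@fsum_single _ _ _ i h); exact: component_mem.
Qed.

Lemma ds_ind (P : M -> Prop) : (forall i x, A i x -> P x) -> P 0 ->
  (forall x y, P x -> P y -> P (x + y)) -> forall x, P x.
Proof.
move=> h h0 hD x; rewrite (component_sum x).
have [r [ur hr]] := (fin_suppP _).1 (component_fin x).
rewrite (fsum_seq ur hr).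
elim/big_rec: _ => // i y _ Py; apply: hD => //; exact: h (component_mem i x).
Qed.

Lemma ds_eq0 x : (forall i, cmp i x = 0) -> x = 0.
Proof. by move=> h; rewrite (component_sum x) fsum_eq0. Qed.

End DirectSum.

(** * Linear functionals separate points *)

Section SeparatingFunctionals.
Variables (R : realType) (M : lmodType R[i]).
Local Notation C := R[i].

(** The recursive form of the span exposes the coefficient along the head, on which
    [lspan_functional] argues. *)
Fixpoint lspan (s : seq M) (y : M) : Prop :=
  if s is x :: s' then exists c : C, lspan s' (y - c *: x) else y = 0.

Lemma lspan_subspace s : subspace (lspan s).
Proof.
elim: s => [|x s [h0 h]] /=; first by split => // c x y -> ->; rewrite scaler0 addr0.
split; first by exists 0; rewrite scale0r subr0.
move=> c y z [a ya] [b zb]; exists (c * a + b).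
have := h c _ _ ya zb; congr (lspan _ _).
by rewrite scalerBr scalerDl scalerA opprD addrACA.
Qed.

Lemma fin_dim_lspan (A : set M) : fin_dim A -> exists s, A `<=` lspan s.
Proof.
move=> [s hs]; exists s => y /hs [c ->]; elim: s c {hs} => [|x s IH] c /=.
  by rewrite big_ord0.
exists (c ord0); rewrite big_ord_recl /= addrAC subrr add0r.
exact: (IH (fun i => c (lift ord0 i))).
Qed.

(* Induction on the spanning list: either its head is not needed, or the
   coefficient along the head is a functional, up to normalization. *)
Lemma lspan_functional s (A : set M) : subspace A -> A `<=` lspan s ->
  forall y, A y -> y != 0 -> exists phi : M -> C,
    phi y != 0 /\ forall c x z, A x -> A z -> phi (c *: x + z) = c * phi x + phi z.
Proof.
elim: s A => [|x s IH] A sA hA y Ay y0.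
  by have := hA y Ay => /= yE; rewrite yE eqxx in y0.
have [hin|hout] := pselect (A `<=` lspan s); first exact: IH hin y Ay y0.
have [y1 [Ay1 ny1]] : exists y1, A y1 /\ ~ lspan s y1.
  by apply: contra_notP hout => h z Az; apply: contrapT => nz; apply: h; exists z.
have [c1 hc1] := hA y1 Ay1.
have sl := lspan_subspace s.
have c10 : c1 != 0.
  by apply/eqP => c0; apply: ny1; move: hc1; rewrite c0 scale0r subr0.
have ext z : A z -> exists t, lspan s (z - t *: y1).
  move=> /hA [c hc]; exists (c / c1).
  have := subspaceB sl hc (subspaceZ (c / c1) sl hc1).
  congr (lspan _ _); rewrite scalerBr scalerA divfK // opprB.
  by rewrite addrA subrK.
have uniqt z t t' : lspan s (z - t *: y1) -> lspan s (z - t' *: y1) -> t = t'.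
  move=> h h'; apply/eqP; rewrite -subr_eq0; apply/eqP; apply: contrapT => /eqP d0.
  apply: ny1; have := subspaceZ (t - t')^-1 sl (subspaceB sl h' h).
  have -> : z - t' *: y1 - (z - t *: y1) = (t - t') *: y1.
    by rewrite opprB [LHS]addrC addrA subrK scalerBl.
  by rewrite scalerA mulVf // scale1r.
pose t z := xget 0 [set t | lspan s (z - t *: y1)].
have tP z : A z -> lspan s (z - t z *: y1).
  by move=> /ext h; exact: (xgetPex 0 h).
have tlin c w z : A w -> A z -> t (c *: w + z) = c * t w + t z.
  move=> Aw Az; apply: uniqt (tP _ _) _; first exact: sA.2.
  have := sl.2 c _ _ (tP _ Aw) (tP _ Az); congr (lspan _ _).
  by rewrite scalerBr scalerDl scalerA opprD addrACA.
have [ty|ty] := eqVneq (t y) 0; last by exists t.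
(* Here y has no component along y1: a functional on the smaller subspace is taken from the
   induction hypothesis and extended by projecting along y1. *)
pose A' := A `&` lspan s.
have sA' : subspace A'.
  split; first by split; [exact: subspace0|exact: subspace0].
  by move=> c w z [a b] [a' b']; split; [exact: sA.2|exact: sl.2].
have A'y : A' y.
  by split => //; have := tP y Ay; rewrite ty scale0r subr0.
have [phi [phiy phil]] := IH A' sA' (fun z h => h.2) y A'y y0.
exists (fun z => phi (z - t z *: y1)); split; first by rewrite ty scale0r subr0.
move=> c w z Aw Az; rewrite tlin // -phil; last 2 first.
- by split; [apply: subspaceB => //; exact: subspaceZ|exact: tP].
- by split; [apply: subspaceB => //; exact: subspaceZ|exact: tP].
by congr phi; rewrite scalerBr scalerDl scalerA opprD addrACA.
Qed.

(** A nonzero component lies in a finite-dimensional subspace, where some functional detects it;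
    composed with the projection it is defined on all of M. Hence weak limits, as in [exp_op], are
    unique. *)
Lemma scalar_separation (I : choiceType) (A : I -> set M) :
  direct_sum A -> (forall i, fin_dim (A i)) ->
  forall x, (forall f : {scalar M}, f x = 0) -> x = 0.
Proof.
move=> dA fA x hx; apply: (ds_eq0 dA) => i; apply/eqP; apply: contrapT => /negP ci.
have [s hs] := fin_dim_lspan (fA i).
have [phi [p0 pl]] := lspan_functional (ds_subspace dA i) hs (component_mem dA i x) ci.
have pscal : scalar (fun z => phi (component A i z)).
  by move=> c w z /=; rewrite (component_linear dA) pl //; exact: component_mem.
pose f : {scalar M} := HB.pack (fun z => phi (component A i z))
  (GRing.isLinear.Build C M C *%R _ pscal).
by have := hx f; rewrite /= => h; move: p0; rewrite h eqxx.
Qed.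

End SeparatingFunctionals.

(** * Polynomials in an operator and its generalized eigenspaces *)

Section PolyAction.
Variables (R : realType) (M : lmodType R[i]).
Local Notation C := R[i].
Variable T : M -> M.
Hypothesis lT : linear T.
Implicit Types (p q : {poly C}) (x y : M) (a c : C).

Definition pact p x := \sum_(i < size p) p`_i *: iter i T x.

Lemma pact_wide n p x : (size p <= n)%N -> pact p x = \sum_(i < n) p`_i *: iter i T x.
Proof.
move=> pn; rewrite /pact (big_ord_widen n (fun i => p`_i *: iter i T x) pn) big_mkcond.
apply: eq_bigr => i _; case: ltnP => // h.
by rewrite nth_default ?scale0r.
Qed.

Lemma pact_linear p : linear (pact p).
Proof.
by apply: lin_bigsum => j; apply: lin_scale; exact: lin_iter.
Qed.

Lemma pactD p q x : pact (p + q) x = pact p x + pact q x.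
Proof.
pose n := maxn (size p) (size q).
rewrite !(@pact_wide n) ?leq_maxl ?leq_maxr ?size_polyD //.
by rewrite -big_split; apply: eq_bigr => i _; rewrite coefD scalerDl.
Qed.

Lemma pactZ c p x : pact (c *: p) x = c *: pact p x.
Proof.
rewrite (@pact_wide (size p)); last exact: size_scale_leq.
by rewrite scaler_sumr; apply: eq_bigr => i _; rewrite coefZ scalerA.
Qed.

Lemma pact_sum (I : Type) (r : seq I) (P : pred I) (F : I -> {poly C}) x :
  pact (\sum_(i <- r | P i) F i) x = \sum_(i <- r | P i) pact (F i) x.
Proof.
elim/big_rec2: _ => [|i q y _ <-]; last by rewrite pactD.
by rewrite /pact size_poly0 big_ord0.
Qed.

Lemma pactB p q x : pact (p - q) x = pact p x - pact q x.
Proof. by rewrite pactD -(scaleN1r q) pactZ scaleN1r. Qed.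

Lemma pactC c x : pact c%:P x = c *: x.
Proof.
rewrite (@pact_wide 1) ?size_polyC_leq1 // big_ord1 coefC /=.
by [].
Qed.

Lemma pact1 x : pact 1 x = x.
Proof. by rewrite pactC scale1r. Qed.

Lemma pactXM p x : pact ('X * p) x = T (pact p x).
Proof.
rewrite (@pact_wide (size p).+1); last first.
  by apply: leq_trans (size_polyMleq _ _) _; rewrite size_polyX.
rewrite big_ord_recl coefXM /= scale0r add0r (lin_sum lT).
by apply: eq_bigr => i _; rewrite coefXM /= (linZ lT).
Qed.

Lemma pactM p q x : pact (p * q) x = pact p (pact q x).
Proof.
elim/poly_ind: p => [|p c IH]; first by rewrite mul0r /pact !size_poly0 !big_ord0.
rewrite mulrDl [p * 'X]mulrC -mulrA !pactD !pactXM IH mul_polyC pactZ.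
by rewrite pactC.
Qed.

Lemma pactX x : pact 'X x = T x.
Proof. by rewrite -['X]mulr1 pactXM pact1. Qed.

Lemma pactXsubC c x : pact ('X - c%:P) x = T x - c *: x.
Proof. by rewrite pactB pactX pactC. Qed.

Lemma pactXsubC_exp c k x :
  pact (('X - c%:P) ^+ k) x = iter k (fun y => T y - c *: y) x.
Proof.
by elim: k => [|k IH]; rewrite ?expr0 ?pact1 // exprS pactM IH pactXsubC.
Qed.

Lemma pact_pact0 p q x : pact p x = 0 -> pact (q * p) x = 0.
Proof. by move=> h; rewrite pactM h (lin0 (pact_linear q)). Qed.

Local Notation gen := (gen_eigenspace T).

Lemma gen_pact c x : gen c x <-> exists k, pact (('X - c%:P) ^+ k) x = 0.
Proof. by split=> -[k hk]; exists k; move: hk; rewrite pactXsubC_exp. Qed.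

Lemma gen_pact_ge c k m x : (k <= m)%N -> pact (('X - c%:P) ^+ k) x = 0 ->
  pact (('X - c%:P) ^+ m) x = 0.
Proof. by move=> km h; rewrite -(subnK km) exprD; exact: pact_pact0. Qed.

Lemma gen_subspace c : subspace (gen c).
Proof.
split; first by exists 0%N.
move=> a x y /gen_pact [k hk] /gen_pact [m hm]; apply/gen_pact.
exists (maxn k m); rewrite (pact_linear _).
rewrite (gen_pact_ge (leq_maxl k m) hk) (gen_pact_ge (leq_maxr k m) hm).
by rewrite scaler0 addr0.
Qed.

Lemma coprime_XsubC_prod z (zs : seq C) k (m : C -> nat) : z \notin zs ->
  coprimep (('X - z%:P) ^+ k) (\prod_(w <- zs) ('X - w%:P) ^+ m w).
Proof.
move=> hz; apply: coprimep_expl; rewrite coprimep_sym coprimep_XsubC.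
elim: zs hz => [|w zs IH]; first by rewrite big_nil rootC oner_neq0.
rewrite inE negb_or big_cons rootM negb_or => /andP[zw /IH ->]; rewrite andbT.
case: (m w) => [|n]; first by rewrite expr0 rootC oner_neq0.
by rewrite rootE horner_exp hornerXsubC expf_eq0 subr_eq0 (negbTE zw) andbF.
Qed.

(** A power of X - i kills f i, and so does the product of the powers for the other eigenvalues,
    because f i is minus the sum of the other f j. The two polynomials are coprime, and Bezout gives
    f i = 0. *)
Lemma gen_independent f : decomposition gen 0 f -> forall i, f i = 0.
Proof.
move=> [f1 f2 f3] i.
have [r [ur hr]] := (fin_suppP _).1 f2.
have [ir|/hr //] := boolP (i \in r).
have [m hm] := choice (fun j => (gen_pact j (f j)).1 (f1 j)).
pose zs := rem i r.
have zsi : i \notin zs by rewrite mem_rem_uniq // !inE eqxx.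
have /Bezout_eq1_coprimepP [[u v] /= uv] := coprime_XsubC_prod (m i) m zsi.
rewrite -[f i]pact1 -uv pactD pact_pact0 // add0r.
have -> : f i = - \sum_(j <- zs) f j.
  apply/eqP; rewrite -addr_eq0; apply/eqP; rewrite [RHS]f3 (fsum_seq ur hr).
  by rewrite [RHS](big_rem i ir).
rewrite (linN (pact_linear _)) (lin_sum (pact_linear _)) big_seq big1 ?oppr0 //.
move=> j jz; rewrite pactM (big_rem j) //= mulrC (pact_pact0 _ (hm j)).
by rewrite (lin0 (pact_linear _)).
Qed.

(** Primary decomposition: p splits into linear factors, and a Bezout relation separates off one
    root at a time. *)
Lemma pact_in_span p x : p != 0 -> pact p x = 0 -> in_span gen x.
Proof.
move=> p0; have [rs pE] := closed_field_poly_normal p.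
have l0 : lead_coef p != 0 by rewrite lead_coef_eq0.
rewrite pE pactZ => /eqP; rewrite scaler_eq0 (negbTE l0) /= => /eqP.
rewrite -big_undup_iterop_count /=.
suff prod_span (m : C -> nat) zs y : uniq zs ->
    pact (\prod_(z <- zs) ('X - z%:P) ^+ m z) y = 0 -> in_span gen y.
  exact: (prod_span (fun i => count_mem i rs) _ _ (undup_uniq rs)).
elim: zs y => [|z zs IH] y /= uz; first by rewrite big_nil pact1 => ->; exact: in_span0.
case/andP: uz => zzs uz; rewrite big_cons => h.
have /Bezout_eq1_coprimepP [[u v] /= uv] := coprime_XsubC_prod (m z) m zzs.
rewrite -[y]pact1 -uv pactD; apply: in_spanD.
  apply: (IH _ uz); rewrite -pactM mulrCA; apply: pact_pact0.
  by rewrite mulrC.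
apply: (@in_span_mem _ _ _ _ z); apply/gen_pact; exists (m z).
by rewrite -pactM mulrCA; apply: pact_pact0.
Qed.

(** If d vectors span A, the d + 1 iterates of x up to order d are linearly dependent; a nonzero row
    of the left kernel of their coordinate matrix provides the coefficients. *)
Lemma fin_dim_pact (A : set M) x : fin_dim A -> (forall y, A y -> A (T y)) -> A x ->
  exists p, p != 0 /\ pact p x = 0.
Proof.
move=> [s hs] hT Ax.
have Ai i : A (iter i T x) by elim: i => //= i; exact: hT.
have [c hc] := choice (fun i => hs _ (Ai i)).
pose B : 'M[C]_((size s).+1, size s) := \matrix_(i, j) c i j.
have kB : kermx B != 0.
  rewrite -mxrank_eq0 mxrank_ker -lt0n subn_gt0.
  by apply: leq_ltn_trans (rank_leq_col B) _.
have [i ri] : exists i, row i (kermx B) != 0.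
  apply: contrapT => h; move/eqP: kB; apply; apply/row_matrixP => i.
  rewrite row0; apply/eqP; apply: contrapT => /negP hi; apply: h; by exists i.
pose v := row i (kermx B).
have vB : v *m B = 0 by rewrite -row_mul mulmx_ker row0.
exists (\poly_(k < (size s).+1) v 0 (inord k)); split.
  apply: contraNneq ri => p0; apply/eqP/rowP => k; rewrite [RHS]mxE.
  have := congr1 (fun p : {poly C} => p`_k) p0.
  by rewrite coef_poly ltn_ord coef0 inord_val.
rewrite (@pact_wide (size s).+1) ?size_poly //.
rewrite (eq_bigr (fun k : 'I_(size s).+1 => \sum_j (v 0 k * B k j) *: s`_j)); last first.
  move=> k _; rewrite coef_poly ltn_ord inord_val hc scaler_sumr.
  by apply: eq_bigr => j _; rewrite scalerA [B k j]mxE.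
rewrite exchange_big /= big1 // => j _; rewrite -scaler_suml.
have := congr1 (fun A : 'rV[C]__ => A 0 j) vB; rewrite mxE mxE => ->.
by rewrite scale0r.
Qed.

Lemma gen_direct_sum : (forall x, in_span gen x) -> direct_sum gen.
Proof.
move=> h; apply: direct_sum_intro => //; first exact: gen_subspace.
exact: gen_independent.
Qed.

Lemma iter_gen a k x : iter k T x =
  \sum_(j < k.+1) ('C(k, j)%:R * a ^+ (k - j)) *: iter j (fun y => T y - a *: y) x.
Proof.
have -> : iter k T x = pact ('X ^+ k) x.
  by elim: k => [|k IH]; rewrite ?expr0 ?pact1 // exprS pactXM -IH.
rewrite -{1}['X](subrK a%:P) exprDn_comm; last exact: mulrC.
rewrite pact_sum (reindex_inj rev_ord_inj) /=; apply: eq_bigr => j _.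
have jk : (j <= k)%N by rewrite -ltnS.
rewrite subSS (subKn jk) -scaler_nat pactZ -polyC_exp [_ * (a ^+ _)%:P]mulrC mul_polyC pactZ.
by rewrite pactXsubC_exp scalerA bin_sub.
Qed.

End PolyAction.

(** A - a and B - b commute and are nilpotent on x, so the power k + m of their sum kills x. The
    induction on k + m peels off one factor, lowering k or m, and takes the place of the binomial
    theorem. *)
Lemma gen_add (R : realType) (M : lmodType R[i]) (A B : M -> M) (a b : R[i]) x :
  linear A -> linear B -> (forall y, A (B y) = B (A y)) ->
  gen_eigenspace A a x -> gen_eigenspace B b x ->
  gen_eigenspace (fun y => A y + B y) (a + b) x.
Proof.
move=> lA lB cAB [k hk] [m hm].
pose A' y := A y - a *: y; pose B' y := B y - b *: y.
have cAB' y : A' (B' y) = B' (A' y).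
  rewrite /A' /B' (linB lA) (linB lB) (linZ lA) (linZ lB) cAB !scalerBr !scalerA.
  rewrite !opprB addrACA [RHS]addrACA [a * b]mulrC; congr (_ + _); exact: addrC.
have lA' : linear A' by apply: lin_sub => //; exact: lin_scaler.
have lB' : linear B' by apply: lin_sub => //; exact: lin_scaler.
exists (k + m)%N.
have -> : (fun y => A y + B y - (a + b) *: y) = (fun y => A' y + B' y).
  by apply/funext => y; rewrite /A' /B' scalerDl opprD addrACA.
have {hk} : iter k A' x = 0 by [].
have {hm} : iter m B' x = 0 by [].
have [n nE] : {n | n = (k + m)%N} by exists (k + m)%N.
rewrite -nE; elim: n k m nE x => [|n IH] k m nE x hm hk.
  by move: hk; have -> : k = 0%N by lia.
have lin_n : linear (fun y => A' y + B' y) by exact: lin_add.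
have itB j y : iter j B' (A' y) = A' (iter j B' y).
  by elim: j => //= j ->; rewrite cAB'.
have itA j y : iter j A' (B' y) = B' (iter j A' y).
  by elim: j => //= j ->; rewrite cAB'.
rewrite iterSr (linD (lin_iter n lin_n)).
case: k nE hk => [|k] nE hk.
  have x0 : x = 0 by [].
  by rewrite x0 (lin0 lA') (lin0 lB') !(lin0 (lin_iter n lin_n)) addr0.
case: m nE hm => [|m] nE hm.
  have x0 : x = 0 by [].
  by rewrite x0 (lin0 lA') (lin0 lB') !(lin0 (lin_iter n lin_n)) addr0.
rewrite (IH k m.+1) ?add0r; [|lia| |by rewrite -iterSr].
  by apply: (IH k.+1 m); [lia|rewrite -iterSr|rewrite itA hk (lin0 lB')].
by rewrite itB hm (lin0 lA').
Qed.

Lemma triangle_full (V : nmodType) (F : nat -> nat -> V) n :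
  (forall i j, (n <= i + j)%N -> F i j = 0) ->
  \sum_(m < n) \sum_(i < m.+1) F i (m - i)%N = \sum_(i < n) \sum_(j < n) F i j.
Proof.
move=> h; rewrite triangle_sum; apply: eq_bigr => i _.
rewrite big_mkcond /=; apply: eq_bigr => j _; case: ltnP => // ij.
by rewrite h.
Qed.

(** * Exponentials of an operator with generalized eigenspace decomposition *)

Section Exponentials.
Variables (R : realType) (M : lmodType R[i]).
Local Notation C := R[i].
Variable T : M -> M.
Hypothesis lT : linear T.
Local Notation gen := (gen_eigenspace T).
Hypothesis dT : direct_sum gen.
Local Notation cmp := (component gen).
Implicit Types (x y : M) (a b c d : C).

(** The Jordan decomposition of T: [ssp] is semisimple and [nilp] locally nilpotent. So [nexp] is a
    finite sum on each vector, and [eexp c], which stands for exp(c T), needs no limit in M. *)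
Definition ssp x := \sum_(a \in [set: C]) a *: cmp a x.
Definition nilp x := T x - ssp x.
Definition nexp c x := \sum_(k \in [set: nat]) (c ^+ k / k`!%:R) *: iter k nilp x.
Definition sexp c x := \sum_(a \in [set: C]) cexp (c * a) *: cmp a x.
Definition eexp c x := sexp c (nexp c x).

Lemma fin_cmp (h : C -> C) x : finite_set [set a | h a *: cmp a x != 0].
Proof.
apply: (fin_supp_sub _ (component_fin dT x)) => a; apply: contraNN => /eqP ->.
by rewrite scaler0.
Qed.

Lemma cmp_sum_linear (h : C -> C) : linear (fun x => \sum_(a \in [set: C]) h a *: cmp a x).
Proof.
apply: lin_fsums; last exact: fin_cmp.
by move=> a; apply: lin_scale; exact: component_linear.
Qed.

Lemma cmp_sum_gen (h : C -> C) a x : gen a x ->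
  \sum_(b \in [set: C]) h b *: cmp b x = h a *: x.
Proof.
move=> gx; rewrite (@fsum_single _ _ _ a) ?(component_self dT gx) // => b ba.
by rewrite (component_other dT gx ba) scaler0.
Qed.

Lemma ssp_linear : linear ssp. Proof. exact: cmp_sum_linear. Qed.
Lemma sexp_linear c : linear (sexp c). Proof. exact: cmp_sum_linear. Qed.
Lemma nilp_linear : linear nilp. Proof. exact: lin_sub lT ssp_linear. Qed.

Lemma ssp_gen a x : gen a x -> ssp x = a *: x.
Proof. exact: cmp_sum_gen. Qed.
Lemma sexp_gen c a x : gen a x -> sexp c x = cexp (c * a) *: x.
Proof. exact: cmp_sum_gen. Qed.
Lemma nilp_gen a x : gen a x -> nilp x = T x - a *: x.
Proof. by move=> gx; rewrite /nilp (ssp_gen gx). Qed.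

Lemma gen_T a x : gen a x -> gen a (T x).
Proof.
move=> /(gen_pact lT) [k hk]; apply/(gen_pact lT); exists k.
rewrite -(pactX lT x) -(pactM lT) mulrC; exact: pact_pact0.
Qed.

Lemma gen_nilp a x : gen a x -> gen a (nilp x).
Proof.
move=> gx; rewrite (nilp_gen gx).
have sg := gen_subspace lT a.
by apply: (subspaceB sg); [exact: gen_T|exact: subspaceZ].
Qed.

Lemma gen_iter_nilp a x k : gen a x -> gen a (iter k nilp x).
Proof. by move=> gx; elim: k => //= k; exact: gen_nilp. Qed.

Lemma iter_nilp_gen a x k : gen a x ->
  iter k nilp x = iter k (fun y => T y - a *: y) x.
Proof.
move=> gx; elim: k => //= k <-; exact: (nilp_gen (gen_iter_nilp k gx)).
Qed.

Lemma iter0_ge (f : M -> M) k m x : linear f -> (k <= m)%N -> iter k f x = 0 -> iter m f x = 0.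
Proof.
by move=> lf km h; rewrite -(subnK km) iterD h (lin0 (lin_iter _ lf)).
Qed.

Lemma nilp_locnil x : exists K, forall k, (K <= k)%N -> iter k nilp x = 0.
Proof.
suff [K hK] : exists K, iter K nilp x = 0.
  by exists K => k kK; exact: iter0_ge nilp_linear kK hK.
apply: (ds_ind dT (P := fun x => exists K, iter K nilp x = 0)) => {x}.
- by move=> a x gx; have [K hK] := gx; exists K; rewrite (iter_nilp_gen _ gx).
- by exists 0%N.
- move=> x y [K hK] [L hL]; exists (maxn K L).
  rewrite (linD (lin_iter _ nilp_linear)).
  by rewrite !(iter0_ge nilp_linear _ hK, iter0_ge nilp_linear _ hL) ?leq_maxl ?leq_maxr ?addr0.
Qed.

Lemma nilp_fin (h : nat -> C) x : finite_set [set k | h k *: iter k nilp x != 0].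
Proof.
have [K hK] := nilp_locnil x; apply/fin_suppP; exists (iota 0 K).
rewrite iota_uniq; split => // k; rewrite mem_iota /= -leqNgt => /hK ->.
by rewrite scaler0.
Qed.

Lemma nexp_linear c : linear (nexp c).
Proof.
apply: lin_fsums; last by move=> x; exact: nilp_fin.
by move=> k; apply: lin_scale; exact: lin_iter nilp_linear.
Qed.

Lemma nexpE c x K : (forall k, (K <= k)%N -> iter k nilp x = 0) ->
  nexp c x = \sum_(k < K) (c ^+ k / k`!%:R) *: iter k nilp x.
Proof. by move=> h; apply: fsum_nat => k /h ->; rewrite scaler0. Qed.

Lemma nexp0 x : nexp 0 x = x.
Proof.
rewrite /nexp (@fsum_single _ _ _ 0%N); last first.
  by move=> k; rewrite -lt0n => k0; rewrite expr0n gtn_eqF // mul0r scale0r.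
by rewrite expr0 fact0 divr1 scale1r.
Qed.

Lemma exp_coefD c d n : (c + d) ^+ n / n`!%:R =
  \sum_(i < n.+1) (c ^+ i / i`!%:R) * (d ^+ (n - i) / (n - i)`!%:R) :> C.
Proof. by rewrite -exp_conv. Qed.

Lemma nexpD c d x : nexp c (nexp d x) = nexp (c + d) x.
Proof.
have [K hK] := nilp_locnil x.
have hi i : iter i nilp (nexp d x) = \sum_(j < K) (d ^+ j / j`!%:R) *: iter (i + j) nilp x.
  rewrite (nexpE d hK) (lin_sum (lin_iter i nilp_linear)); apply: eq_bigr => j _.
  by rewrite (linZ (lin_iter i nilp_linear)) iterD.
have hK' k : (K <= k)%N -> iter k nilp (nexp d x) = 0.
  move=> kK; rewrite hi big1 // => j _; rewrite hK ?scaler0 //.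
  exact: leq_trans kK (leq_addr _ _).
rewrite (nexpE c hK') [RHS](@nexpE _ _ (K + K)); last first.
  by move=> k kK; apply: hK; apply: leq_trans kK; exact: leq_addr.
rewrite (eq_bigr (fun n : 'I_(K + K) => \sum_(i < n.+1)
    ((c ^+ i / i`!%:R) * (d ^+ (n - i) / (n - i)`!%:R)) *: iter (i + (n - i)) nilp x)); last first.
  move=> n _; rewrite exp_coefD scaler_suml; apply: eq_bigr => i _.
  by rewrite subnKC // -ltnS.
rewrite (triangle_full (F := fun i j => ((c ^+ i / i`!%:R) * (d ^+ j / j`!%:R)) *: iter (i + j) nilp x)); last first.
  by move=> i j ij; rewrite hK ?scaler0 //; apply: leq_trans ij; exact: leq_addr.
have z i j : (K <= i)%N || (K <= j)%N -> iter (i + j) nilp x = 0.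
  move=> h; apply: hK; case/orP: h => h; apply: leq_trans h _; [exact: leq_addr|exact: leq_addl].
rewrite big_split_ord /= [X in _ = _ + X]big1 ?addr0; last first.
  by move=> i _; rewrite big1 // => j _; rewrite z ?scaler0 // leq_addr.
apply: eq_bigr => i _; rewrite big_split_ord /= [X in _ = _ + X]big1 ?addr0; last first.
  by move=> j _; rewrite z ?scaler0 // leq_addr orbT.
by rewrite hi scaler_sumr; apply: eq_bigr => j _; rewrite scalerA.
Qed.

Lemma gen_nexp a c x : gen a x -> gen a (nexp c x).
Proof.
move=> gx; apply: subspace_fsum; first exact: gen_subspace.
by move=> k; apply: (subspaceZ _ (gen_subspace lT a)); exact: gen_iter_nilp.
Qed.

Lemma eexp_linear c : linear (eexp c).
Proof. exact: lin_comp (sexp_linear c) (nexp_linear c). Qed.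

Lemma eexp_gen a c x : gen a x -> eexp c x = cexp (c * a) *: nexp c x.
Proof. by move=> gx; rewrite /eexp (sexp_gen c (gen_nexp c gx)). Qed.

Lemma gen_eexp a c x : gen a x -> gen a (eexp c x).
Proof.
move=> gx; rewrite (eexp_gen c gx).
exact: (subspaceZ _ (gen_subspace lT a)) (gen_nexp c gx).
Qed.

Lemma eexpD c d x : eexp c (eexp d x) = eexp (c + d) x.
Proof.
apply: (ds_ind dT (P := fun x => eexp c (eexp d x) = eexp (c + d) x)) => {x}.
- move=> a x gx; rewrite (eexp_gen d gx) (linZ (eexp_linear c)).
  rewrite (eexp_gen c (gen_nexp d gx)) (eexp_gen _ gx) nexpD scalerA.
  by rewrite mulrC -cexpD -mulrDl.
- by rewrite !(lin0 (eexp_linear _)).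
- by move=> x y hx hy; rewrite !(linD (eexp_linear _)) hx hy.
Qed.

Lemma eexp0 x : eexp 0 x = x.
Proof.
apply: (ds_ind dT (P := fun x => eexp 0 x = x)) => {x}.
- by move=> a x gx; rewrite (eexp_gen 0 gx) mul0r cexp0 scale1r nexp0.
- by rewrite !(lin0 (eexp_linear _)).
- by move=> x y hx hy; rewrite !(linD (eexp_linear _)) hx hy.
Qed.

Lemma eexp_bij c : bijective (eexp c).
Proof.
exists (eexp (- c)) => x; rewrite eexpD ?addNr ?subrr; exact: eexp0.
Qed.

Lemma eexp_ker c x : T x = 0 -> eexp c x = x.
Proof.
move=> Tx; have gx : gen 0 x by exists 1%N; rewrite /= scale0r subr0.
rewrite (eexp_gen c gx) mulr0 cexp0 scale1r (@nexpE _ _ 1).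
  by rewrite big_ord1 expr0 fact0 divr1 scale1r.
move=> k k0; apply: (iter0_ge nilp_linear k0) => /=.
by rewrite (nilp_gen gx) Tx scale0r subr0.
Qed.

(** On the eigenspace of a, [eexp c] minus e^(c a) is e^(c a) times a combination of positive powers
    of [nilp], so each application lowers the nilpotency index. *)
Lemma gen_exp_gen a c : gen a `<=` gen_eigenspace (eexp c) (cexp (c * a)).
Proof.
move=> x gx; have [K hK] := nilp_locnil x.
have {}hK := hK K (leqnn K).
suff : iter K (fun y => eexp c y - cexp (c * a) *: y) x = 0 by exists K.
elim: K x gx hK => [|K IH] x gx hK //.
rewrite iterSr; apply: IH.
  apply: (subspaceB (gen_subspace lT a)); first exact: gen_eexp.
  exact: (subspaceZ _ (gen_subspace lT a)).
rewrite (eexp_gen c gx) -scalerBr (linZ (lin_iter K nilp_linear)).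
rewrite (@nexpE _ _ K.+1); last by move=> k kK; exact: iter0_ge nilp_linear kK hK.
rewrite big_ord_recl /= expr0 fact0 divr1 scale1r addrAC subrr add0r.
rewrite (lin_sum (lin_iter K nilp_linear)) big1 ?scaler0 // => k _.
rewrite (linZ (lin_iter K nilp_linear)) -iterS -iterD.
by rewrite (iter0_ge nilp_linear _ hK) ?scaler0 // addnS ltnS leq_addr.
Qed.

(** * Exponentials of derivations are multiplicative *)

Section Derivation.
Variable B : M -> M -> M.
Hypothesis lBl : forall y, linear (fun x => B x y).
Hypothesis lBr : forall x, linear (B x).
Hypothesis dB : forall x y, T (B x y) = B (T x) y + B x (T y).

(** T - (a + b) acts on B x y as (T - a) on the first argument plus (T - b) on the second; the
    induction is that of [gen_add]. *)
Lemma gen_bilinear a b x y : gen a x -> gen b y -> gen (a + b) (B x y).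
Proof.
move=> [k hk] [m hm].
pose A1 y := T y - a *: y; pose B1 y := T y - b *: y.
have h z w : T (B z w) - (a + b) *: B z w = B (A1 z) w + B z (B1 w).
  rewrite dB /A1 /B1 (linB (lBl _)) (linZ (lBl _)) (linB (lBr _)) (linZ (lBr _)).
  by rewrite scalerDl opprD addrACA.
have l1 : linear (fun y => T y - (a + b) *: y) by apply: lin_sub => //; exact: lin_scaler.
exists (k + m)%N; have [n nE] : {n | n = (k + m)%N} by exists (k + m)%N.
have {hk} : iter k A1 x = 0 by []. have {hm} : iter m B1 y = 0 by [].
rewrite -nE; elim: n k m nE x y => [|n IH] k m nE x y hm hk.
  have k0 : k = 0%N by lia.
  by move: hk; rewrite k0 /= => ->; rewrite (lin0 (lBl _)).
rewrite iterSr h (linD (lin_iter n l1)).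
case: k nE hk => [|k] nE hk.
  have -> : x = 0 by [].
  rewrite /A1 (lin0 lT) scaler0 subr0 !(lin0 (lBl _)) !(lin0 (lin_iter n l1)).
  by rewrite addr0.
case: m nE hm => [|m] nE hm.
  have -> : y = 0 by [].
  rewrite /B1 (lin0 lT) scaler0 subr0 !(lin0 (lBr _)) !(lin0 (lin_iter n l1)).
  by rewrite addr0.
rewrite (IH k m.+1) ?add0r; [|lia|by []|by rewrite -iterSr].
by apply: (IH k.+1 m); [lia|rewrite -iterSr|].
Qed.

(** Eigenvalues add under B, so the semisimple part is a derivation, and with T also the nilpotent
    part. *)
Lemma nilp_derivation x y : nilp (B x y) = B (nilp x) y + B x (nilp y).
Proof.
apply: (ds_ind dT (P := fun x => nilp (B x y) = B (nilp x) y + B x (nilp y))) => {x}.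
- move=> a x gx.
  apply: (ds_ind dT (P := fun y => nilp (B x y) = B (nilp x) y + B x (nilp y))) => {y}.
  + move=> b y gy; rewrite (nilp_gen (gen_bilinear gx gy)) (nilp_gen gx) (nilp_gen gy).
    rewrite (linB (lBl _)) (linZ (lBl _)) (linB (lBr _)) (linZ (lBr _)) dB.
    by rewrite scalerDl opprD addrACA.
  + by rewrite (lin0 nilp_linear) !(lin0 (lBr _)) (lin0 nilp_linear) addr0.
  + move=> z y hz hy; rewrite (linD (lBr x) z y) (linD nilp_linear) hz hy.
    by rewrite (linD nilp_linear z y) (linD (lBr (nilp x)) z y) (linD (lBr x) (nilp z)) addrACA.
- by rewrite (lin0 nilp_linear) !(lin0 (lBl _)) (lin0 nilp_linear) addr0.
- move=> z x hz hx; rewrite (linD (lBl y) z x) (linD nilp_linear) hz hx.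
  by rewrite (linD nilp_linear z x) (linD (lBl y) (nilp z)) (linD (lBl (nilp y)) z x) addrACA.
Qed.

Lemma iter_nilp_bilinear n x y : (n`!%:R)^-1 *: iter n nilp (B x y) =
  \sum_(i < n.+1) ((i`!%:R)^-1 / (n - i)`!%:R) *: B (iter i nilp x) (iter (n - i) nilp y).
Proof.
elim: n => [|n IH]; first by rewrite big_ord1 /= fact0 invr1 !scale1r mulr1 scale1r.
apply: (@scaleS_inj R _ n) => /=.
have -> : n.+1%:R *: ((n.+1)`!%:R^-1 *: nilp (iter n nilp (B x y))) =
   nilp ((n`!%:R)^-1 *: iter n nilp (B x y)).
  rewrite (linZ nilp_linear) scalerA factS natrM invfM mulrA divff ?natS_neq0 //.
  by rewrite mul1r.
rewrite IH (lin_sum nilp_linear).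
rewrite (eq_bigr (fun i : 'I_n.+1 =>
  ((i`!%:R)^-1 / (n - i)`!%:R) *: B (iter i.+1 nilp x) (iter (n - i) nilp y) +
  ((i`!%:R)^-1 / (n - i)`!%:R) *: B (iter i nilp x) (iter (n.+1 - i) nilp y))); last first.
  move=> i _; rewrite (linZ nilp_linear) nilp_derivation scalerDr.
  by rewrite subSn // -ltnS.
rewrite big_split /= scaler_sumr.
rewrite [RHS](eq_bigr (fun i : 'I_n.+2 =>
  (i%:R * ((i`!%:R)^-1 / (n.+1 - i)`!%:R)) *: B (iter i nilp x) (iter (n.+1 - i) nilp y) +
  ((n.+1 - i)%:R * ((i`!%:R)^-1 / (n.+1 - i)`!%:R)) *: B (iter i nilp x) (iter (n.+1 - i) nilp y))); last first.
  move=> i _; rewrite scalerA -scalerDl -mulrDl -natrD subnKC //.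
  by rewrite -ltnS.
rewrite big_split /=; congr (_ + _).
  rewrite [RHS]big_ord_recl /= mul0r scale0r add0r; apply: eq_bigr => i _.
  rewrite /bump /= add1n subSS; congr (_ *: _).
  by rewrite factS natrM invfM !mulrA divff ?natS_neq0 // mul1r.
rewrite [RHS]big_ord_recr /= subnn mul0r scale0r addr0; apply: eq_bigr => i _.
have i_n : (i <= n)%N by rewrite -ltnS.
rewrite subSn //; congr (_ *: _).
by rewrite factS natrM invfM [RHS]mulrCA mulVKf ?natS_neq0.
Qed.

Lemma nexp_bilinear c x y : nexp c (B x y) = B (nexp c x) (nexp c y).
Proof.
have [K hK] := nilp_locnil x; have [L hL] := nilp_locnil y.
pose n := (K + L)%N.
have z i j : (n <= i + j)%N -> B (iter i nilp x) (iter j nilp y) = 0.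
  move=> h; have [iK|/ltnW iK] := leqP K i; first by rewrite hK // (lin0 (lBl _)).
  by rewrite (hL j) ?(lin0 (lBr _)) //; rewrite /n in h; lia.
rewrite (@nexpE _ _ n); last first.
  move=> k kn.
  have := iter_nilp_bilinear k x y; rewrite big1; last first.
    by move=> i _; rewrite z ?scaler0 // subnKC // -ltnS.
  move=> /eqP; rewrite scaler_eq0 invr_eq0 pnatr_eq0 => /orP[|/eqP //].
  by rewrite eqn0Ngt fact_gt0.
rewrite (eq_bigr (fun k : 'I_n => \sum_(i < k.+1)
  ((c ^+ i / i`!%:R) * (c ^+ (k - i) / (k - i)`!%:R)) *: B (iter i nilp x) (iter (k - i) nilp y))); last first.
  move=> k _; rewrite -scalerA iter_nilp_bilinear scaler_sumr; apply: eq_bigr => i _.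
  rewrite scalerA; congr (_ *: _).
  have ik : (i <= k)%N by rewrite -ltnS.
  have -> : c ^+ k = c ^+ i * c ^+ (k - i) by rewrite -exprD subnKC.
  by ring.
rewrite (triangle_full (F := fun i j => ((c ^+ i / i`!%:R) * (c ^+ j / j`!%:R)) *: B (iter i nilp x) (iter j nilp y))); last first.
  by move=> i j /z ->; rewrite scaler0.
rewrite (@nexpE _ x n); last by move=> k kn; apply: hK; apply: leq_trans kn; exact: leq_addr.
rewrite (@nexpE _ y n); last by move=> k kn; apply: hL; apply: leq_trans kn; exact: leq_addl.
rewrite (lin_sum (lBl _)); apply: eq_bigr => i _.
rewrite (linZ (lBl _)) (lin_sum (lBr _)) scaler_sumr; apply: eq_bigr => j _.
by rewrite (linZ (lBr _)) scalerA.
Qed.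

Lemma eexp_bilinear c x y : eexp c (B x y) = B (eexp c x) (eexp c y).
Proof.
apply: (ds_ind dT (P := fun x => eexp c (B x y) = B (eexp c x) (eexp c y))) => {x}.
- move=> a x gx.
  apply: (ds_ind dT (P := fun y => eexp c (B x y) = B (eexp c x) (eexp c y))) => {y}.
  + move=> b y gy; rewrite (eexp_gen c (gen_bilinear gx gy)) (eexp_gen c gx) (eexp_gen c gy).
    rewrite nexp_bilinear (linZ (lBl _)) (linZ (lBr _)) scalerA -cexpD.
    by rewrite -mulrDr.
  + by rewrite !(lin0 (lBr _), lin0 (eexp_linear c)).
  + move=> z y hz hy; rewrite (linD (lBr x) z y) (linD (eexp_linear c)) hz hy.
    by rewrite (linD (eexp_linear c) z y) (linD (lBr (eexp c x)) (eexp c z)).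
- by rewrite !(lin0 (lBl _), lin0 (eexp_linear c)).
- move=> z x hz hx; rewrite (linD (lBl y) z x) (linD (eexp_linear c)) hz hx.
  by rewrite (linD (eexp_linear c) z x) (linD (lBl (eexp c y)) (eexp c z)).
Qed.

End Derivation.

Hypothesis sepM : forall x, (forall f : {scalar M}, f x = 0) -> x = 0.

(** Tested by a functional on an eigenvector, the exponential series is the Cauchy product of the
    series of e^(c a) with the finite series of exp(c [nilp]). Additivity extends this to all
    vectors, and the separating functionals make the limit unique. *)
Lemma exp_op_eexp c x : exp_op (fun y => c *: T y) x = eexp c x.
Proof.
have lim z : forall f : {scalar M}, seq_cvgC (fun n =>
    f (\sum_(k < n) (k`!%:R)^-1 *: iter k (fun y => c *: T y) z)) (f (eexp c z)).
  move=> f.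
  have lcT : linear (fun y => c *: T y) by exact: lin_scale.
  apply: (ds_ind dT (P := fun z => seq_cvgC (fun n =>
    f (\sum_(k < n) (k`!%:R)^-1 *: iter k (fun y => c *: T y) z)) (f (eexp c z)))) => {z}.
  - move=> a z gz.
    have [K hK] := nilp_locnil z.
    have h1 : asum (fun j => (c ^+ j / j`!%:R) * f (iter j nilp z)) (f (nexp c z)).
      rewrite (nexpE c hK) linear_sum.
      rewrite (eq_bigr (fun j : 'I_K => (c ^+ j / j`!%:R) * f (iter j nilp z))); last first.
        by move=> j _; rewrite linearZ.
      apply: (@asum_fin R (fun j => (c ^+ j / j`!%:R) * f (iter j nilp z))) => j jK.
      by rewrite hK // linear0 mulr0.
    have [_] := asum_conv h1 (asum_exp (c * a)).
    rewrite (eexp_gen c gz) linearZ /= [cexp (c * a) * _]mulrC.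
    congr (seq_cvgC _ _); apply/funext => n; rewrite linear_sum; apply: eq_bigr => k _.
    have -> : iter k (fun y => c *: T y) z = c ^+ k *: iter k T z.
      elim: (nat_of_ord k) => [|m IH]; first by rewrite scale1r.
      by rewrite /= IH (linZ lT) scalerA exprS.
    rewrite (iter_gen lT a) !linearZ /= linear_sum /conv !mulr_sumr.
    apply: eq_bigr => j _; rewrite linearZ /= (iter_nilp_gen _ gz).
    have jk : (j <= k)%N by rewrite -ltnS.
    rewrite exprMn -(bin_fact jk) !natrM.
    have -> : c ^+ k = c ^+ j * c ^+ (k - j) by rewrite -exprD subnKC.
    have f0 m : (m`!%:R : C) != 0 by rewrite pnatr_eq0 -lt0n fact_gt0.
    have b0 : ('C(k, j)%:R : C) != 0 by rewrite pnatr_eq0 -lt0n bin_gt0.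
    by field; rewrite !f0 b0.
  - rewrite (lin0 (eexp_linear c)) linear0.
    have -> : (fun n => f (\sum_(k < n) (k`!%:R)^-1 *: iter k (fun y => c *: T y) 0)) = fun=> 0.
      apply/funext => n; rewrite big1 ?linear0 // => k _.
      by rewrite (lin0 (lin_iter k lcT)) scaler0.
    exact: seq_cvgC_cst.
  - move=> z w hz hw; rewrite (linD (eexp_linear c)) linearD.
    have := seq_cvgCD hz hw; congr (seq_cvgC _ _); apply/funext => n.
    rewrite -linearD -big_split; congr (f _); apply: eq_bigr => k _.
    by rewrite (linD (lin_iter k lcT)) scalerDr.
apply: xget_unique => //= y hy.
apply/eqP; rewrite -subr_eq0; apply/eqP/sepM => f.
by rewrite linearB /= (seq_cvgC_uniq (hy f) (lim x f)) subrr.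
Qed.

End Exponentials.

(** * The coefficients of Delta *)

Section SeriesExp.
Variables (R : realType) (M : lmodType R[i]) (b : nat -> M -> M).
Local Notation C := R[i].
Hypothesis lb : forall n, linear (b n).
Hypothesis cb : forall n m x, b n (b m x) = b m (b n x).
Implicit Types (x : M) (j m n : nat).

Lemma series_pow_linear j m : linear (series_pow b j m).
Proof.
elim: j m => [|j IH] m; first by move=> c x y /=; case: eqP; rewrite ?scaler0 ?addr0.
by apply: lin_bigsum => n; exact: lin_comp (lb n) (IH _).
Qed.

Lemma series_pow_gt j m x : (m < j)%N -> series_pow b j m x = 0.
Proof.
elim: j m x => [|j IH] m x // mj /=; rewrite big_nat_cond big1 // => n /andP[/andP[n1 nm] _].
by rewrite IH ?(lin0 (lb n)) //; lia.
Qed.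

Lemma series_pow_comm (S : M -> M) j m x : linear S ->
  (forall n x, S (b n x) = b n (S x)) ->
  S (series_pow b j m x) = series_pow b j m (S x).
Proof.
move=> lS h; elim: j m => [|j IH] m /=; first by case: eqP => // _; exact: lin0.
by rewrite (lin_sum lS); apply: eq_bigr => n _; rewrite h IH.
Qed.

(** Coefficients of y d/dy B^(j+1) = (j + 1) (y B') B^j, valid because the operators b n commute. *)
Lemma series_pow_rec j m x : m%:R *: series_pow b j.+1 m x =
  j.+1%:R *: \sum_(1 <= n < m.+1) n%:R *: b n (series_pow b j (m - n) x).
Proof.
elim: j m => [|j IH] m.
  rewrite scale1r [LHS]/= scaler_sumr big_nat_cond [RHS]big_nat_cond.
  apply: eq_bigr => n /andP[/andP[n1 nm] _].
  rewrite [series_pow b 0 _ _]/=.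
  have [e|e] := eqVneq (m - n)%N 0%N; last by rewrite (lin0 (lb n)) !scaler0.
  by have -> : m = n by lia.
transitivity (\sum_(1 <= n < m.+1) m%:R *: b n (series_pow b j.+1 (m - n) x)).
  exact: scaler_sumr.
rewrite (eq_big_nat _ _ (F2 := fun n => n%:R *: b n (series_pow b j.+1 (m - n) x) +
   b n ((m - n)%:R *: series_pow b j.+1 (m - n) x))); last first.
  move=> n /andP[n1 nm]; rewrite (linZ (lb n)) -scalerDl -natrD subnKC //.
rewrite big_split /= -natr1 scalerDl scale1r addrC; congr (_ + _).
rewrite (eq_bigr (fun n => j.+1%:R *: \sum_(1 <= k < (m - n).+1)
   k%:R *: b k (b n (series_pow b j (m - n - k) x)))); last first.
  move=> n _; rewrite IH (linZ (lb n)) (lin_sum (lb n)); congr (_ *: _).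
  by apply: eq_bigr => k _; rewrite (linZ (lb n)) cb.
rewrite -scaler_sumr; congr (_ *: _).
have widen n : (1 <= n < m.+1)%N -> \sum_(1 <= k < (m - n).+1)
    k%:R *: b k (b n (series_pow b j (m - n - k) x)) =
    \sum_(1 <= k < m.+1 | (k + n <= m)%N) k%:R *: b k (b n (series_pow b j (m - n - k) x)).
  move=> /andP[n1 nm].
  rewrite [RHS](big_cat_nat (n := (m - n).+1)) //=; last by lia.
  rewrite [X in _ = _ + X]big_nat_cond [X in _ = _ + X]big1 ?addr0; last first.
    by move=> k /andP[/andP[k1 k2] k3]; lia.
  rewrite big_nat_cond [RHS]big_nat_cond; apply: eq_bigl => k; lia.
rewrite (eq_big_nat _ _ widen) (exchange_big_dep_nat xpredT) //=.
apply: eq_big_nat => k /andP[k1 km].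
have widen2 : \sum_(1 <= n < m.+1 | (k + n <= m)%N) k%:R *: b k (b n (series_pow b j (m - n - k) x)) =
    \sum_(1 <= n < (m - k).+1) k%:R *: b k (b n (series_pow b j (m - k - n) x)).
  rewrite [LHS](big_cat_nat (n := (m - k).+1)) //=; last by lia.
  rewrite [X in _ + X]big_nat_cond [X in _ + X]big1 ?addr0; last first.
    by move=> n /andP[/andP[n1 n2] n3]; lia.
  rewrite big_nat_cond [RHS]big_nat_cond; apply: eq_big => [n|n _]; first by lia.
  by rewrite subnAC.
by rewrite widen2 -scaler_sumr (lin_sum (lb k)).
Qed.

Lemma series_exp_wide m n x : (m < n)%N ->
  series_exp b m x = \sum_(j < n) (j`!%:R)^-1 *: series_pow b j m x.
Proof.
move=> mn; rewrite /series_exp.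
rewrite (big_ord_widen n (fun j => (j`!%:R)^-1 *: series_pow b j m x) mn).
rewrite big_mkcond; apply: eq_bigr => j _; case: ltnP => // h.
by rewrite series_pow_gt ?scaler0.
Qed.

Lemma series_exp_linear m : linear (series_exp b m).
Proof. by apply: lin_bigsum => j; apply: lin_scale; exact: series_pow_linear. Qed.

Lemma series_exp0 x : series_exp b 0 x = x.
Proof. by rewrite /series_exp big_ord1 /= fact0 invr1 scale1r. Qed.

Lemma series_exp_comm (S : M -> M) m x : linear S ->
  (forall n x, S (b n x) = b n (S x)) ->
  S (series_exp b m x) = series_exp b m (S x).
Proof.
move=> lS h; rewrite (lin_sum lS); apply: eq_bigr => j _.
by rewrite (linZ lS) series_pow_comm.
Qed.

(** Coefficients of y d/dy exp(B) = (y B') exp(B). *)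
Lemma series_exp_rec m x : m%:R *: series_exp b m x =
  \sum_(1 <= n < m.+1) n%:R *: b n (series_exp b (m - n) x).
Proof.
case: m => [|m]; first by rewrite scale0r big_nil.
rewrite /series_exp big_ord_recl /= scaler0 add0r scaler_sumr.
rewrite (eq_bigr (fun j : 'I_m.+1 => \sum_(1 <= n < m.+2)
   n%:R *: b n ((j`!%:R)^-1 *: series_pow b j (m.+1 - n) x))); last first.
  move=> j _; rewrite scalerA mulrC -scalerA -/(series_pow b j.+1 m.+1 x).
  rewrite [X in _ *: X](series_pow_rec j m.+1 x) scalerA /bump /= add1n factS natrM invfM.
  rewrite mulrAC mulVf ?natS_neq0 // mul1r scaler_sumr; apply: eq_bigr => n _.
  by rewrite (linZ (lb n)) !scalerA mulrC.
rewrite exchange_big /=.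
rewrite big_nat_cond [RHS]big_nat_cond; apply: eq_bigr => n /andP[/andP[n1 nm] _].
rewrite -scaler_sumr -(lin_sum (lb n)); congr (_ *: b n _).
by rewrite -(series_exp_wide (n := m.+1)) //; lia.
Qed.

End SeriesExp.

Section Binz.
Variable R : realType.

Lemma binz_nat (m i : nat) : binz R m i = 'C(m, i)%:R.
Proof.
elim: i => [|i IH]; first by rewrite binz0 bin0.
apply: (mulfI (natS_neq0 R i)); rewrite binzS IH -natrM mul_bin_left natrM.
have [im|mi] := leqP i m; first by rewrite natrB.
by rewrite bin_small // !mulr0.
Qed.

Lemma binz_m1 i : binz R (-1) i = (-1) ^+ i.
Proof.
elim: i => [|i IH]; first by rewrite binz0.
apply: (mulfI (natS_neq0 R i)); rewrite binzS IH exprS -natr1.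
by rewrite (_ : (-1)%:~R = -1 :> R[i]) //; ring.
Qed.

Lemma binz_neg (n i : nat) : binz R (- n.+1%:Z) i = (-1) ^+ i * 'C(n + i, i)%:R.
Proof.
elim: i => [|i IH]; first by rewrite binz0 bin0 expr0 mulr1.
apply: (mulfI (natS_neq0 R i)); rewrite binzS IH exprS.
have -> : i.+1%:R * (-1 * (-1) ^+ i * 'C(n + i.+1, i.+1)%:R) =
   - (-1) ^+ i * (i.+1 * 'C(n + i.+1, i.+1))%N%:R :> R[i] by rewrite natrM; ring.
rewrite addnS -mul_bin_diag natrM rmorphN /= -[n.+1%:~R]/(n.+1%:R) -!natr1 natrD; ring.
Qed.

End Binz.

(** * Commutator formulas *)

Section Modes.
Variables (R : realType) (V W : lmodType R[i]).
Local Notation C := R[i].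
Variables (YV : V -> int -> V -> V) (YW : V -> int -> W -> W).
Hypothesis bil : bilinear_modes YW.
Hypothesis jac : jacobi YV YW.

Lemma modes_linr v n : linear (YW v n). Proof. exact: bil.1. Qed.
Lemma modes_linl n w : linear (fun v => YW v n w). Proof. exact: bil.2. Qed.

(** The component l = 0 of the Jacobi identity, where both sums on the left reduce to i = 0. *)
Lemma commutator_int (m n : int) v1 v2 w :
  YW v1 m (YW v2 n w) - YW v2 n (YW v1 m w) =
  \sum_(i \in [set: nat]) binz R m i *: YW (YV v1 i%:Z v2) (m + n - i%:Z) w.
Proof.
have := jac v1 v2 w 0 m n.
have z i : i != 0%N -> binz R 0 i = 0.
  by case: i => // i _; rewrite (binz_nat R 0) bin0n.
rewrite (@fsum_single _ _ _ 0%N); last by move=> i /z ->; rewrite mulr0 scale0r.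
rewrite (@fsum_single _ _ _ 0%N); last by move=> i /z ->; rewrite mulr0 scale0r.
have -> : m + 0 - 0%:Z = m by lia.
have -> : n + 0 - 0%:Z = n by lia.
have -> : n + 0%:Z = n by lia.
have -> : m + 0%:Z = m by lia.
have -> : 0 + 0%:Z = 0 by [].
rewrite binz0 expr0 expr0z !mul1r !scale1r => ->.
by apply: fsum_eq => i; rewrite add0r.
Qed.

Lemma commutator (m : nat) (n : int) v1 v2 w :
  YW v1 m%:Z (YW v2 n w) - YW v2 n (YW v1 m%:Z w) =
  \sum_(i < m.+1) 'C(m, i)%:R *: YW (YV v1 i%:Z v2) (m%:Z + n - i%:Z) w.
Proof.
rewrite commutator_int (@fsum_nat _ _ m.+1).
  by apply: eq_bigr => i _; rewrite binz_nat.
by move=> i mi; rewrite binz_nat bin_small // scale0r.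
Qed.

Lemma commutator0 n v1 v2 w :
  YW v1 0 (YW v2 n w) = YW (YV v1 0 v2) n w + YW v2 n (YW v1 0 w).
Proof.
apply/eqP; rewrite -subr_eq; apply/eqP.
by rewrite (commutator 0 n) big_ord1 bin0 scale1r add0r subr0.
Qed.

End Modes.

Section TripleSums.
Variable V : nmodType.

Lemma triple_sum_l (F : nat -> nat -> nat -> V) K :
  \sum_(n < K) \sum_(p < K - n) \sum_(i < n.+1) F i (n - i)%N p =
  \sum_(i < K) \sum_(j < K) \sum_(p < K | (i + j + p < K)%N) F i j p.
Proof.
rewrite (eq_bigr (fun n : 'I_K => \sum_(i < n.+1) \sum_(p < K - (i + (n - i))) F i (n - i)%N p)); last first.
  move=> n _; rewrite exchange_big /=; apply: eq_bigr => i _.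
  by rewrite subnKC // -ltnS.
rewrite (triangle_sum (fun i j => \sum_(p < K - (i + j)) F i j p)).
apply: eq_bigr => i _; rewrite big_mkcond /=; apply: eq_bigr => j _.
have h : (K - (i + j) <= K)%N by exact: leq_subr.
rewrite (big_ord_widen K (fun p => F i j p) h) /=; case: ltnP => ij.
  by apply: eq_bigl => p; lia.
by rewrite big_pred0 // => p; lia.
Qed.

Lemma triple_sum_r (F : nat -> nat -> nat -> V) K :
  \sum_(q < K) \sum_(i < q.+1) \sum_(j < K - q) F i j (q - i)%N =
  \sum_(i < K) \sum_(j < K) \sum_(p < K | (i + j + p < K)%N) F i j p.
Proof.
rewrite (eq_bigr (fun q : 'I_K => \sum_(i < q.+1) \sum_(j < K - (i + (q - i))) F i j (q - i)%N)); last first.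
  by move=> q _; apply: eq_bigr => i _; rewrite subnKC // -ltnS.
rewrite (triangle_sum (fun i p => \sum_(j < K - (i + p)) F i j p)).
apply: eq_bigr => i _; rewrite [RHS](exchange_big_dep xpredT) //=.
rewrite big_mkcond /=; apply: eq_bigr => p _.
have h : (K - (i + p) <= K)%N by exact: leq_subr.
rewrite (big_ord_widen K (fun j => F i j p) h) /=; case: ltnP => ij.
  by apply: eq_bigl => j; lia.
by rewrite big_pred0 // => j; lia.
Qed.

End TripleSums.

Section L0Weights.
Variables (R : realType) (V W : lmodType R[i]).
Local Notation C := R[i].
Variables (YV : V -> int -> V -> V) (YW : V -> int -> W -> W) (omega : V).
Hypothesis jac : jacobi YV YW.
Hypothesis der : Lm1_derivative YV YW omega.

Lemma L0_commutator v n w : YW omega 1 (YW v n w) =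
  YW v n (YW omega 1 w) + YW (YV omega 1 v) n w - (n + 1)%:~R *: YW v n w.
Proof.
apply/eqP; rewrite -addrA addrC -subr_eq; apply/eqP.
rewrite (commutator jac 1 n) big_ord_recl big_ord1 /= bin0 bin1 !scale1r.
have -> : 1%:Z + n - 0%:Z = n + 1 by lia.
have -> : 1%:Z + n - (bump 0 0)%:Z = n by rewrite /bump /=; lia.
by rewrite der addrK addrC scaleNr.
Qed.

Lemma Lm1_commutator v n w : YW omega 0 (YW v n w) =
  YW v n (YW omega 0 w) - n%:~R *: YW v (n - 1) w.
Proof. by rewrite (commutator0 jac) der addrC scaleNr. Qed.

End L0Weights.

(** * The modes of u and the operators D_M on a vertex operator algebra *)

Section VOA.
Variables (R : realType) (V : lmodType R[i]).
Local Notation C := R[i].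
Variables (Vn : int -> set V) (Y : V -> int -> V -> V) (vac omega u : V) (mu : C).
Hypothesis voa : is_voa Vn Y vac omega.
Hypothesis Vneg : forall n : int, n < 0 -> Vn n `<=` [set 0].
Hypothesis u1 : Vn 1 u.
Hypothesis L1u : Y omega 2 u = 0.
Hypothesis muE : Y u 1 u = mu *: vac.

Let bil := voa_bilinear voa.
Let jac := voa_jacobi voa.
Let der := voa_derivative voa.
Let dV := voa_graded voa.
Let linr v n : linear (Y v n) := modes_linr bil v n.
Let linl n w : linear (fun v => Y v n w) := modes_linl bil n w.

Lemma L0E n v : Vn n v -> Y omega 1 v = n%:~R *: v.
Proof. exact: voa_L0 voa n v. Qed.

(** L(0) multiplies the component of weight k by k; comparison with n removes all components with k
    different from n. *)
Lemma Vn_eigen n v : Y omega 1 v = n%:~R *: v -> Vn n v.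
Proof.
move=> h; apply/(component_memP dV) => k kn.
have E : k%:~R *: component Vn k v = n%:~R *: component Vn k v.
  have <- : component Vn k (Y omega 1 v) = n%:~R *: component Vn k v.
    by rewrite h (linZ (component_linear dV k)).
  rewrite {2}(component_sum dV v) (lin_fsum (linr _ _) (component_fin dV v)).
  rewrite (lin_fsum (component_linear dV k)); last first.
    apply: (fin_supp_sub _ (component_fin dV v)) => i; apply: contraNN => /eqP ->.
    by rewrite (lin0 (linr _ _)).
  have c_i i : Y omega 1 (component Vn i v) = i%:~R *: component Vn i v.
    exact: L0E (component_mem dV i v).
  rewrite (@fsum_single _ _ _ k).
    by rewrite c_i (linZ (component_linear dV k)) (component_self dV (component_mem dV k v)).
  move=> i ik; rewrite c_i (linZ (component_linear dV k)).
  rewrite (component_other dV (component_mem dV i v)) ?scaler0 //.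
  by rewrite eq_sym.
apply/eqP; move/eqP: E; rewrite -subr_eq0 -scalerBl scaler_eq0 subr_eq0 eqr_int.
by rewrite (negbTE kn).
Qed.

Lemma mode_weight a b n v w : Vn a v -> Vn b w -> Vn (a + b - n - 1) (Y v n w).
Proof.
move=> va wb; apply: Vn_eigen.
rewrite (L0_commutator jac der) (L0E va) (L0E wb) (linZ (linr _ _)) (linZ (linl _ _)).
rewrite -scalerDl -scalerBl; congr (_ *: _).
by rewrite -rmorphD -rmorphB /=; congr (_%:~R); lia.
Qed.

Lemma mode_neg a b n v w : Vn a v -> Vn b w -> a + b - n - 1 < 0 -> Y v n w = 0.
Proof. by move=> va wb h; exact: (Vneg h (mode_weight n va wb)). Qed.

Lemma mode_vac n v : 0 <= n -> Y v n vac = 0.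
Proof. by move=> n0; have [h _] := voa_creation voa v; exact: h. Qed.

Lemma mode_vac1 v : Y v (-1) vac = v.
Proof. by have [_] := voa_creation voa v. Qed.

Local Notation T := (Y u 0).

Lemma T_linear : linear T. Proof. exact: linr. Qed.

Lemma T_Vn n x : Vn n x -> Vn n (T x).
Proof. by move=> hx; have := mode_weight 0 u1 hx; congr (Vn _ _); lia. Qed.

Lemma un_Vn n k x : Vn n x -> Vn (n - k%:Z) (Y u k%:Z x).
Proof. by move=> hx; have := mode_weight k%:Z u1 hx; congr (Vn _ _); lia. Qed.

Lemma T_span x : in_span (gen_eigenspace T) x.
Proof.
apply: (ds_ind dV (P := in_span (gen_eigenspace T))) => {x}.
- move=> n x hx.
  have [p [p0 hp]] := fin_dim_pact (voa_fin_dim voa n) (@T_Vn n) hx.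
  by have := pact_in_span T_linear p0 hp.
- exact: in_span0.
- exact: in_spanD.
Qed.

Lemma T_direct_sum : direct_sum (gen_eigenspace T).
Proof. exact: gen_direct_sum T_linear T_span. Qed.

Lemma T_derivation n x y : T (Y x n y) = Y (T x) n y + Y x n (T y).
Proof. exact: (commutator0 jac). Qed.

(** Skew-symmetry: commuting Y_(-1)(u) with Y_0(u) on the vacuum gives - u_0 u = u_0 u, since u_1 u
    = mu vac contributes the vacuum mode -2, which is 0. *)
Lemma u0u : Y u 0 u = 0.
Proof.
have h1 := commutator_int jac (-1) 0 u u vac.
rewrite mode_vac // (lin0 (linr _ _)) sub0r mode_vac1 in h1.
have h2 : \sum_(i \in [set: nat]) binz R (-1) i *: Y (Y u i%:Z u) (-1 + 0 - i%:Z) vac =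
   Y u 0 u.
  rewrite (@fsum_nat _ _ 2); last first.
    move=> i i2; rewrite (_ : Y u i%:Z u = 0) ?(lin0 (linl _ _)) ?scaler0 //.
    by apply: (mode_neg u1 u1); lia.
  rewrite big_ord_recl big_ord1 /= !binz_m1 expr0 scale1r /bump /= expr1.
  rewrite -[(1 + 0)%N]/1%N muE (linZ (linl _ _)) (voa_identity voa).
  by rewrite (_ : -1 + 0 - 0%:Z = -1) // mode_vac1 (_ : (_ == -1) = false) // !scaler0 addr0.
rewrite h2 in h1; move/eqP: h1; rewrite eq_sym -subr_eq0 opprK -mulr2n -scaler_nat scaler_eq0.
by rewrite pnatr_eq0 /= => /eqP.
Qed.

Lemma un_u n : (2 <= n)%N -> Y u n%:Z u = 0.
Proof. by move=> n2; apply: (mode_neg u1 u1); lia. Qed.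

(** In the commutator only i = 1 could survive, with a multiple of the vacuum mode n + m - 1; it
    occurs for n >= 1 only, where this mode is not -1. Commutativity is what [series_exp_rec]
    demands. *)
Lemma un_comm (n m : nat) x : Y u n%:Z (Y u m%:Z x) = Y u m%:Z (Y u n%:Z x).
Proof.
apply/eqP; rewrite -subr_eq0; apply/eqP.
rewrite (commutator jac n m%:Z) big1 // => i _.
case: i => -[|[|i]] iN /=.
- by rewrite u0u (lin0 (linl _ _)) scaler0.
- rewrite muE (linZ (linl _ _)) (voa_identity voa).
  have -> : (n%:Z + m%:Z - 1%:Z == -1) = false by apply/eqP; lia.
  by rewrite !scaler0.
- by rewrite un_u // (lin0 (linl _ _)) scaler0.
Qed.

(** Skew-symmetry again: omega_(-1) and u_n are commuted on the vacuum. The term i = 2 is L(1) u =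
    0; those of L(-1) u and L(0) u add up to - n u_(n-2) vac, which is - u for n = 1 and 0
    otherwise. *)
Lemma un_omega (n : nat) : Y u n%:Z omega = if n == 1%N then u else 0.
Proof.
have h := commutator_int jac (-1) n%:Z omega u vac.
rewrite mode_vac // (lin0 (linr _ _)) sub0r mode_vac1 in h.
have h2 : \sum_(i \in [set: nat]) binz R (-1) i *: Y (Y omega i%:Z u) (-1 + n%:Z - i%:Z) vac =
   - n%:R *: Y u (n%:Z - 2) vac.
  rewrite (@fsum_nat _ _ 2); last first.
    move=> i i2; rewrite (_ : Y omega i%:Z u = 0) ?(lin0 (linl _ _)) ?scaler0 //.
    case: i i2 => [|[|[|i]]] // _.
    by apply: (mode_neg (voa_omega voa) u1); lia.
  rewrite big_ord_recl big_ord1 /= !binz_m1 expr0 scale1r /bump /= expr1.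
  rewrite -[(1 + 0)%N]/1%N (L0E u1) scale1r der scaleN1r.
  have -> : -1 + n%:Z - 0%:Z - 1 = n%:Z - 2 by lia.
  have -> : -1 + n%:Z - 1%:Z = n%:Z - 2 by lia.
  rewrite -[X in _ - X]scale1r -scalerBl; congr (_ *: _).
  rewrite (_ : -1 + n%:Z - 0%:Z = n%:Z - 1); last by lia.
  by rewrite rmorphB /=; ring.
rewrite h2 scaleNr in h; move/oppr_inj: h => ->.
case: n h2 => [|[|n]] h2 /=; first by rewrite scale0r.
  by rewrite scale1r mode_vac1.
by rewrite mode_vac ?scaler0 //; lia.
Qed.

Lemma un_Lm1 (n : nat) x :
  Y u n.+1%:Z (Y omega 0 x) = Y omega 0 (Y u n.+1%:Z x) + n.+1%:R *: Y u n%:Z x.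
Proof.
rewrite (Lm1_commutator jac der) (_ : n.+1%:Z - 1 = n%:Z); last by lia.
by rewrite subrK.
Qed.

Lemma T_Lm1 x : T (Y omega 0 x) = Y omega 0 (T x).
Proof. by rewrite (Lm1_commutator jac der) scale0r subr0. Qed.

Local Notation D := (Delta_exp Y u).
Let bD (n : nat) (y : V) := ((-1) ^+ n / (- n%:R) : C) *: Y u n%:Z y.

Lemma bD_linear n : linear (bD n).
Proof. by apply: lin_scale; exact: linr. Qed.

Lemma bD_comm n m x : bD n (bD m x) = bD m (bD n x).
Proof.
by rewrite /bD !(linZ (linr _ _)) un_comm !scalerA mulrC.
Qed.

(** n times the coefficient (-1)^n / (- n) of the exponent of Delta. The value 0 at n = 0 reflects
    that the exponent starts at n = 1, and lets sums run from 0. *)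
Definition csgn (n : nat) : C := if n == 0%N then 0 else (-1) ^+ n.+1.

Lemma csgn_bD n x : n%:R *: bD n x = csgn n *: Y u n%:Z x.
Proof.
rewrite /bD scalerA /csgn; case: n => [|n] /=; first by rewrite mul0r.
congr (_ *: _); rewrite invrN !mulrN mulrCA divff ?natS_neq0 // mulr1.
by rewrite [in RHS]exprS mulN1r.
Qed.

Lemma D_linear m : linear (D m).
Proof. exact: series_exp_linear bD_linear m. Qed.

Lemma D0 x : D 0 x = x. Proof. exact: series_exp0. Qed.

Lemma D_rec m x : m%:R *: D m x = \sum_(n < m.+1) csgn n *: Y u n%:Z (D (m - n) x).
Proof.
have -> : m%:R *: D m x = \sum_(1 <= n < m.+1) n%:R *: bD n (D (m - n) x).
  exact: series_exp_rec bD_linear bD_comm m x.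
rewrite big_ord_recl /csgn /= scale0r add0r big_add1 big_mkord.
by apply: eq_bigr => n _; rewrite csgn_bD.
Qed.

Lemma D_inj m x y : m.+1%:R *: x = m.+1%:R *: y :> V -> x = y.
Proof. exact: scaleS_inj. Qed.

(** As [csgn 0] is 0, the recursion at m + 1 refers to smaller indices only. Commutation formulas
    for Delta are proved by checking it. *)
Lemma D_unique (F : nat -> V) x : F 0%N = x ->
  (forall m, m.+1%:R *: F m.+1 = \sum_(n < m.+2) csgn n *: Y u n%:Z (F (m.+1 - n)%N)) ->
  forall m, D m x = F m.
Proof.
move=> F0 FS m; have [n] := ubnP m; elim: n m => // n IH [|m] mn; first by rewrite D0 F0.
apply: (@D_inj m); rewrite D_rec FS; apply: eq_bigr => i _.
case: i => -[|i] iN /=; first by rewrite /csgn /= !scale0r.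
by rewrite IH //; lia.
Qed.

Lemma D_comm (S : V -> V) m x : linear S ->
  (forall (n : nat) x, S (Y u n%:Z x) = Y u n%:Z (S x)) -> S (D m x) = D m (S x).
Proof.
move=> lS h; apply: series_exp_comm => // n y.
by rewrite (linZ lS) h.
Qed.

Lemma D_T m x : T (D m x) = D m (T x).
Proof. apply: D_comm => [|n y]; [exact: T_linear|exact: (un_comm 0 n)]. Qed.

Lemma D_Vn n m x : Vn n x -> Vn (n - m%:Z) (D m x).
Proof.
move=> hx; have [k] := ubnP m; elim: k m => // k IH [|m] mk.
  by rewrite D0; move: hx; congr (Vn _ _); lia.
have sV := ds_subspace dV (n - m.+1%:Z).
have h : Vn (n - m.+1%:Z) (m.+1%:R *: D m.+1 x).
  rewrite D_rec; apply: subspace_sum => // i _.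
  case: i => -[|i] iN /=; first by rewrite /csgn scale0r; exact: subspace0.
  apply: (subspaceZ _ sV).
  have := un_Vn i.+1 (IH (m.+1 - i.+1)%N _); rewrite (_ : n - _ - _ = n - m.+1%:Z); last by lia.
  by apply; lia.
have := subspaceZ (m.+1%:R)^-1 sV h.
by rewrite scalerA mulVf ?natS_neq0 // scale1r.
Qed.

Lemma un_D_comm (n m : nat) x : Y u n%:Z (D m x) = D m (Y u n%:Z x).
Proof. by apply: D_comm => [|k y]; [exact: linr|exact: un_comm]. Qed.

(** Coefficient form of Delta(x) L(-1) = L(-1) Delta(x) + d/dx Delta(x): differentiating x^(T - m)
    yields the factor T - m. The L(-1)-derivative axiom comes from it. *)
Lemma D_Lm1 m x : D m (Y omega 0 x) = Y omega 0 (D m x) +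
   (if m is m'.+1 then T (D m' x) - m'%:R *: D m' x else 0).
Proof.
have lL : linear (Y omega 0) by exact: linr.
move: m; apply: D_unique; first by rewrite D0 addr0.
move=> m.
rewrite (eq_bigr (fun n : 'I_m.+2 =>
   (Y omega 0 (csgn n *: Y u n%:Z (D (m.+1 - n) x)) +
    (if n : nat is n'.+1 then (csgn n * n%:R) *: Y u n'%:Z (D (m - n') x) else 0)) +
   (csgn n *: (if (m.+1 - n)%N is k.+1 then Y u n%:Z (T (D k x) - k%:R *: D k x) else 0)))); last first.
  move=> n _; case: n => -[|n] nm /=.
    by rewrite /csgn /= !scale0r (lin0 lL) !addr0.
  rewrite (linD (linr _ _)) un_Lm1 !scalerDr (linZ lL) scalerA subSS.
  congr (_ + _); congr (_ *: _).
  by case: (m - n)%N => [|k]; rewrite ?(lin0 (linr _ _)).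
rewrite !big_split /= -(lin_sum lL) -D_rec (linZ lL) scalerDr -addrA; congr (_ + _).
rewrite big_ord_recl /= add0r.
rewrite [X in _ = _ + X]big_ord_recr /= subnn scaler0 addr0.
rewrite [X in _ = _ + X]big_ord_recl /csgn /= scale0r add0r.
rewrite [X in _ = X + _](eq_bigr (fun n : 'I_m.+1 =>
  ((-1) ^+ n * n.+1%:R) *: Y u n%:Z (D (m - n) x))); last first.
  by move=> n _; rewrite /bump /= !add0n add1n !exprS; congr (_ *: _); ring.
rewrite [X in _ = _ + X](eq_bigr (fun n : 'I_m =>
  csgn n.+1 *: (T (Y u n.+1%:Z (D (m - n.+1) x)) - (m - n.+1)%:R *: Y u n.+1%:Z (D (m - n.+1) x)))); last first.
  move=> n _; rewrite /bump /= add1n subSS /csgn /=.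
  have nm := ltn_ord n.
  have -> : (m - n = (m - n.+1).+1)%N by lia.
  rewrite (linB (linr _ _)) (linZ (linr _ _)).
  by rewrite (un_comm n.+1 0).
rewrite [X in _ = X + _]big_ord_recl /= expr0 mul1r scale1r subn0 -addrA -big_split /=.
rewrite [X in _ = _ + X](eq_bigr (fun n : 'I_m =>
   T (csgn n.+1 *: Y u n.+1%:Z (D (m - n.+1) x)) - m.+1%:R *: (csgn n.+1 *: Y u n.+1%:Z (D (m - n.+1) x)))); last first.
  move=> n _; rewrite /bump /= add1n (linZ T_linear) scalerBr addrCA; congr (_ + _).
  rewrite !scalerA -scalerBl -[RHS]scaleNr; congr (_ *: _).
  rewrite /csgn /= natrB ?ltn_ord // !exprS -!natr1; ring.
rewrite sumrB -(lin_sum T_linear) -scaler_sumr.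
have -> : \sum_(i < m) csgn i.+1 *: Y u i.+1%:Z (D (m - i.+1) x) = m%:R *: D m x.
  by rewrite D_rec big_ord_recl {1}/csgn /= scale0r add0r.
rewrite (linZ T_linear) scalerBr addrA -natr1 scalerDl scale1r [T _ + _]addrC.
by [].
Qed.


(** * The conjugation formula for Delta *)

Section Conjugation.
Variables (alpha : C) (v1 v2 : V).
Let Ta x := T x - alpha *: x.
Let lTa : linear Ta.
Proof. by apply: lin_sub; [exact: T_linear|exact: lin_scaler]. Qed.
(* binom(T - p, s), written in terms of T - alpha *)
Let B p s := pact Ta (fbp (alpha - p%:R) s).

Lemma pact_comm (S : V -> V) q x : linear S -> (forall y, S (Ta y) = Ta (S y)) ->
  S (pact Ta q x) = pact Ta q (S x).
Proof.
move=> lS h; rewrite (lin_sum lS); apply: eq_bigr => i _; rewrite (linZ lS).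
congr (_ *: _); elim: (nat_of_ord i) => //= k <-; exact: h.
Qed.

Lemma un_Ta n x : Y u (n : nat)%:Z (Ta x) = Ta (Y u n%:Z x).
Proof. by rewrite /Ta (linB (linr _ _)) (linZ (linr _ _)) (un_comm n 0). Qed.

(* The coefficient recursion of x2 d/dx2 on binom(T, s) (x2 + x0)^(T - p): an
   instance of Chu-Vandermonde. *)
Lemma B_rec p s x :
  \sum_(n < p.+1) \sum_(i < s.+1) ((-1) ^+ n.+1 * binz R (- n.+1%:Z) i) *:
     Y u n%:Z (B (p - n) (s - i) (D (p - n) x)) =
  (p + s)%:R *: B p s (D p x) - T (B p s (D p x)).
Proof.
pose X := fbp (alpha - p%:R - 1) s.
have TE y : T y = pact Ta ('X + alpha%:P) y.
  by rewrite (pactD Ta) (pactX lTa) (pactC Ta) /Ta subrK.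
have inner n : (n < p.+1)%N -> \sum_(i < s.+1) ((-1) ^+ n.+1 * binz R (- n.+1%:Z) i) *:
     Y u n%:Z (B (p - n) (s - i) (D (p - n) x)) =
   pact Ta X ((-1) ^+ n.+1 *: Y u n%:Z (D (p - n) x)).
  move=> np.
  rewrite (eq_bigr (fun i : 'I_s.+1 => (-1) ^+ n.+1 *: Y u n%:Z
     (pact Ta (binz R (- n.+1%:Z) i *: fbp (alpha - p%:R + n%:R) (s - i)) (D (p - n) x)))); last first.
    move=> i _; rewrite (pactZ Ta) (linZ (linr _ _)) scalerA; congr (_ *: Y u _ (pact Ta (fbp _ _) _)).
    by rewrite natrB //; ring.
  rewrite -scaler_sumr -(lin_sum (linr _ _)) -(pact_sum Ta).
  rewrite fbp_vandermonde (pact_comm _ _ (linr u n%:Z)); last exact: un_Ta.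
  rewrite (linZ (pact_linear lTa _)); congr (_ *: pact Ta (fbp _ _) _).
  by rewrite rmorphN /= -[n.+1%:~R]/(n.+1%:R) -natr1; ring.
rewrite (eq_bigr _ (fun (n : 'I_p.+1) _ => inner n (ltn_ord n))).
rewrite -(lin_sum (pact_linear lTa X)).
have -> : \sum_(n < p.+1) (-1) ^+ n.+1 *: Y u n%:Z (D (p - n) x) =
    pact Ta (p%:R%:P - ('X + alpha%:P)) (D p x).
  rewrite (pactB Ta) (pactC Ta) -TE D_rec !big_ord_recl /= /csgn /= scale0r add0r.
  by rewrite expr1 scaleN1r subn0 addrC.
rewrite -(pactM lTa) TE -(pactM lTa) -(pactZ Ta) -(pactB Ta); congr (pact Ta _ _).
have := fbp_shift (alpha - p%:R) s; rewrite -/X => h.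
have -> : X * (p%:R%:P - ('X + alpha%:P)) = - (('X + (alpha - p%:R)%:P) * X).
  by rewrite polyCB; ring.
rewrite h -mul_polyC natrD !polyCB !polyCD; ring.
Qed.

(** The coefficient of x2^-k x0^(-m-1) in Y(Delta(x2 + x0) v1, x0), with the factor x2^T on v1 left
    out: D_p v1 comes with x2 + x0 to the power T - p, of which the power k - p of x0 is taken. *)
Definition Gop k m x := \sum_(p < k.+1)
  Y (B p (k - p) (D p v1)) (m + (k - p)%:Z) x.

Lemma Gop_linear k m : linear (Gop k m).
Proof. by apply: lin_bigsum => p; exact: linr. Qed.

(** The coefficients [csgn (n + i)] binom(n + i, n) of the commutator formula agree with those of
    [B_rec] except at n = i = 0, where [csgn] is 0 instead of -1; the difference is the term with T
    in [B_rec]. *)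
Lemma B_rec_csgn p s x : (p + s)%:R *: B p s (D p x) =
  \sum_(n < p.+1) \sum_(i < s.+1) (csgn (n + i) * 'C(n + i, n)%:R) *:
     Y u n%:Z (B (p - n) (s - i) (D (p - n) x)).
Proof.
have cE (n i : nat) : csgn (n + i) * 'C(n + i, n)%:R =
    (-1) ^+ n.+1 * binz R (- n.+1%:Z) i + ((n == 0) && (i == 0))%:R.
  rewrite binz_neg -bin_sub ?leq_addr // addKn /csgn addn_eq0.
  case: eqP => [->|_] /=; first case: eqP => [->|_] /=.
  - by rewrite bin0 expr0 expr1; ring.
  - by rewrite addr0 mulrA -exprD.
  - by rewrite addr0 mulrA -exprD.
rewrite (eq_bigr (fun n : 'I_p.+1 => \sum_(i < s.+1) (((-1) ^+ n.+1 * binz R (- n.+1%:Z) i) *: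
     Y u n%:Z (B (p - n) (s - i) (D (p - n) x)) + ((n == 0 :> nat) && (i == 0 :> nat))%:R *:
     Y u n%:Z (B (p - n) (s - i) (D (p - n) x))))); last first.
  by move=> n _; apply: eq_bigr => i _; rewrite cE scalerDl.
under eq_bigr do rewrite big_split /=.
rewrite big_split /= B_rec big_ord_recl big_ord_recl /= scale1r !subn0.
rewrite big1; last by move=> i _; rewrite scale0r.
rewrite big1; last by move=> n _; rewrite big1 // => i _; rewrite scale0r.
by rewrite !addr0 subrK.
Qed.

(** The commutator formula turns the bracket with u_n into modes u_i with factor binom(n, i).
    Writing n = i + j and collecting the terms with equal p + i leads to [B_rec_csgn]. *)
Lemma Gop_rec k m x : k%:R *: Gop k m x = \sum_(n < k.+1) csgn n *:
  (Y u n%:Z (Gop (k - n) m x) - Gop (k - n) m (Y u n%:Z x)).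
Proof.
pose F (i j p : nat) := (csgn (i + j) * 'C(i + j, i)%:R) *:
  Y (Y u i%:Z (B p (k - p - i - j) (D p v1))) (m + (k - p - i)%:Z) x.
transitivity (\sum_(n < k.+1) \sum_(p < k.+1 - n) \sum_(i < n.+1) F i (n - i)%N p).
  rewrite triple_sum_l -triple_sum_r /Gop scaler_sumr; apply: eq_bigr => p _.
  have pk : (p <= k)%N by rewrite -ltnS.
  rewrite -(linZ (linl _ _)).
  have := B_rec_csgn p (k - p) v1; rewrite subnKC // => ->.
  rewrite (lin_sum (linl _ _)); apply: eq_bigr => n _.
  have np : (n <= p)%N by rewrite -ltnS.
  rewrite (lin_sum (linl _ _)) (_ : (k - p).+1 = k.+1 - p)%N; last by lia.
  apply: eq_bigr => j _; rewrite (linZ (linl _ _)) /F.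
  by have -> : (k - (p - n) - n = k - p)%N by lia.
apply: eq_bigr => n _.
have nk : (n <= k)%N by rewrite -ltnS.
rewrite /Gop (lin_sum (linr _ _)) -sumrB scaler_sumr (_ : k.+1 - n = (k - n).+1)%N; last by lia.
apply: eq_bigr => p _; have pk : (p <= k - n)%N by rewrite -ltnS.
rewrite (commutator jac n) scaler_sumr; apply: eq_bigr => i _.
have i_n : (i <= n)%N by rewrite -ltnS.
rewrite /F subnKC // scalerA; congr (_ *: Y (Y u _ (B p _ _)) _ _); first by lia.
by lia.
Qed.

(* The coefficient of Delta(x2) Y(v1, x0) = Y(Delta(x2 + x0) v1, x0) Delta(x2);
   alpha is arbitrary and serves to express T by the operator T - alpha, which
   is nilpotent on v1 when v1 has eigenvalue alpha. *)
Lemma Delta_conjugation M m : D M (Y v1 m v2) =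
  \sum_(k < M.+1) Gop k m (D (M - k) v2).
Proof.
move: M; apply: D_unique.
  rewrite big_ord1 /Gop big_ord1 /= subnn !D0 addr0 /B subr0.
  by rewrite fbp0 (pact1 Ta).
move=> M.
(* The factor M + 1 is split as k + (M + 1 - k). The first part produces brackets by [Gop_rec], the
   second puts modes on the argument by [D_rec]; the two families of [F2] terms cancel and [F1] is
   the recursion sought. *)
pose F1 n j := csgn n *: Y u n%:Z (Gop j m (D (M.+1 - n - j) v2)).
pose F2 n j := csgn n *: Gop j m (Y u n%:Z (D (M.+1 - n - j) v2)).
rewrite scaler_sumr (eq_bigr (fun k : 'I_M.+2 => \sum_(n < k.+1) (F1 n (k - n)%N - F2 n (k - n)%N) +
   \sum_(n < M.+2 - k) F2 n k)); last first.
  move=> k _; have kM : (k <= M.+1)%N by rewrite -ltnS.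
  have -> : M.+1%:R = k%:R + (M.+1 - k)%:R :> C by rewrite -natrD subnKC.
  rewrite scalerDl; congr (_ + _).
    rewrite Gop_rec; apply: eq_bigr => n _.
    have nk : (n <= k)%N by rewrite -ltnS.
    by rewrite scalerBr /F1 /F2 (_ : M.+1 - n - (k - n) = M.+1 - k)%N //; lia.
  rewrite -(linZ (Gop_linear k m)) D_rec (lin_sum (Gop_linear k m)).
  rewrite (_ : (M.+1 - k).+1 = M.+2 - k)%N; last by lia.
  by apply: eq_bigr => n _; rewrite (linZ (Gop_linear k m)) /F2 subnAC.
rewrite big_split /=; under eq_bigr do rewrite sumrB.
rewrite sumrB (triangle_sum F1) (triangle_sum F2).
have -> : \sum_(k < M.+2) \sum_(n < M.+2 - k) F2 n k =
   \sum_(i < M.+2) \sum_(j < M.+2 | (i + j < M.+2)%N) F2 i j.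
  rewrite [RHS](exchange_big_dep xpredT) //=; apply: eq_bigr => k _.
  rewrite (big_ord_widen M.+2 (fun n => F2 n k) (leq_subr _ _)).
  by apply: eq_bigl => n; lia.
rewrite subrK; apply: eq_bigr => n _.
have nM : (n <= M.+1)%N by rewrite -ltnS.
rewrite (lin_sum (linr _ _)) scaler_sumr (_ : (M.+1 - n).+1 = M.+2 - n)%N; last by lia.
rewrite (big_ord_widen M.+2 (fun j => csgn n *: Y u n%:Z (Gop j m (D (M.+1 - n - j) v2))) (leq_subr _ _)).
by apply: eq_bigl => j; lia.
Qed.

End Conjugation.

End VOA.

(** * Double gradings *)

Section SumOf.
Variables (R : realType) (M : lmodType R[i]) (I : choiceType) (A : I -> set M).
Local Notation C := R[i].

Lemma sum_of_subspace : (forall i, subspace (A i)) -> subspace (sum_of A).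
Proof.
move=> sA; split.
  exists (fun=> 0); split; [by move=> i; exact: subspace0| |by rewrite fsum_eq0].
  by apply/fin_suppP; exists [::].
move=> c x y [f [f1 f2 f3]] [g [g1 g2 g3]].
have fc : finite_set [set i | c *: f i != 0].
  by apply: (fin_supp_sub _ f2) => i; apply: contraNN => /eqP ->; rewrite scaler0.
exists (fun i => c *: f i + g i); split.
- by move=> i; exact: (sA i).2.
- exact: fin_suppD.
- by rewrite fsumD // -scale_fsum // -f3 -g3.
Qed.

Lemma sum_of_in i x : (forall i, subspace (A i)) -> A i x -> sum_of A x.
Proof.
move=> sA Ax; exists (fun j => if j == i then x else 0); split.
- by move=> j; case: eqP => [->//|_]; exact: subspace0.
- by apply/fin_suppP; exists [:: i]; split => // j; rewrite inE => /negbTE ->.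
- by rewrite (@fsum_single _ _ _ i) ?eqxx // => j /negbTE ->.
Qed.

Lemma sum_of_ind (P : M -> Prop) : (forall i x, A i x -> P x) -> P 0 ->
  (forall x y, P x -> P y -> P (x + y)) -> forall x, sum_of A x -> P x.
Proof.
move=> h h0 hD x [f [f1 f2 ->]].
have [r [ur hr]] := (fin_suppP _).1 f2.
rewrite (fsum_seq ur hr).
elim/big_rec: _ => // i y _ Py; apply: hD => //; exact: h (f1 i).
Qed.

Lemma component_comm (S : M -> M) i x : direct_sum A -> linear S ->
  (forall i x, A i x -> A i (S x)) -> component A i (S x) = S (component A i x).
Proof.
move=> dA lS h.
apply: (ds_ind dA (P := fun x => component A i (S x) = S (component A i x))) => {x}.
- move=> j x Ax; rewrite (component_id dA Ax) (component_id dA (h _ _ Ax)).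
  by case: eqP => // _; rewrite (lin0 lS).
- by rewrite !(lin0 (component_linear dA i), lin0 lS).
- move=> x y hx hy; rewrite (linD lS) !(linD (component_linear dA i)) (linD lS).
  by rewrite hx hy.
Qed.

End SumOf.

Section DoublyGraded.
Variables (R : realType) (W : lmodType R[i]) (Wg : R[i] -> R[i] -> set W).
Local Notation C := R[i].
Hypothesis dg : doubly_graded Wg.
Local Notation A := (fun i : C * C => Wg i.1 i.2).
Local Notation cmp := (component A).

Lemma dg_subspace n a : subspace (Wg n a).
Proof. by have := ds_subspace dg (n, a). Qed.

Lemma weight_subspace n : subspace (weight_space Wg n).
Proof. by apply: sum_of_subspace => a; exact: dg_subspace. Qed.

Lemma degree_subspace a : subspace (degree_space Wg a).
Proof. by apply: sum_of_subspace => n; exact: dg_subspace. Qed.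

Lemma weight_in n a w : Wg n a w -> weight_space Wg n w.
Proof. by apply: sum_of_in => b; exact: dg_subspace. Qed.

Lemma degree_in n a w : Wg n a w -> degree_space Wg a w.
Proof. by apply: (@sum_of_in _ _ _ (fun n => Wg n a)) => b; exact: dg_subspace. Qed.

Lemma weight_comp n w (i : C * C) : weight_space Wg n w -> i.1 != n -> cmp i w = 0.
Proof.
move=> hw ni; apply: (sum_of_ind (P := fun w => cmp i w = 0) _ _ _ hw).
- move=> a x hx; apply: (component_other dg (i := (n, a))) => //.
  by apply: contraNneq ni => ->.
- exact: lin0 (component_linear dg i).
- by move=> x y hx hy; rewrite (linD (component_linear dg i)) hx hy addr0.
Qed.

Lemma degree_comp a w (i : C * C) : degree_space Wg a w -> i.2 != a -> cmp i w = 0.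
Proof.
move=> hw ni; apply: (sum_of_ind (P := fun w => cmp i w = 0) _ _ _ hw).
- move=> n x hx; apply: (component_other dg (i := (n, a))) => //.
  by apply: contraNneq ni => ->.
- exact: lin0 (component_linear dg i).
- by move=> x y hx hy; rewrite (linD (component_linear dg i)) hx hy addr0.
Qed.

Lemma dg_mem n a w : Wg n a w <-> weight_space Wg n w /\ degree_space Wg a w.
Proof.
split; first by move=> h; split; [exact: weight_in h|exact: degree_in h].
move=> [hn ha]; apply/(component_memP dg (n, a)) => -[n' a'].
rewrite xpair_eqE negb_and => /orP[h|h]; [apply: (weight_comp hn); exact: h|apply: (degree_comp ha); exact: h].
Qed.

Lemma dg_ind (P : W -> Prop) : (forall n a x, Wg n a x -> P x) -> P 0 ->
  (forall x y, P x -> P y -> P (x + y)) -> forall x, P x.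
Proof. move=> h; apply: (ds_ind dg) => -[n a] x; exact: h. Qed.

Lemma weight_direct_sum : direct_sum (weight_space Wg).
Proof.
apply: direct_sum_intro.
- exact: weight_subspace.
- move=> x; apply: (dg_ind (P := in_span (weight_space Wg))) => {x}.
  + by move=> n a x /weight_in; exact: in_span_mem.
  + exact: in_span0.
  + exact: in_spanD.
- move=> f [f1 f2 f3] n; apply: (ds_eq0 dg) => i.
  have [<-|ni] := eqVneq i.1 n; last exact: weight_comp (f1 n) ni.
  have := congr1 (cmp i) f3; rewrite (lin0 (component_linear dg i)).
  rewrite (lin_fsum (component_linear dg i) f2) (@fsum_single _ _ _ i.1) // => m mi.
  by apply: weight_comp (f1 m) _; rewrite eq_sym.
Qed.

Lemma degree_direct_sum : direct_sum (degree_space Wg).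
Proof.
apply: direct_sum_intro.
- exact: degree_subspace.
- move=> x; apply: (dg_ind (P := in_span (degree_space Wg))) => {x}.
  + by move=> n a x /degree_in; exact: in_span_mem.
  + exact: in_span0.
  + exact: in_spanD.
- move=> f [f1 f2 f3] n; apply: (ds_eq0 dg) => i.
  have [<-|ni] := eqVneq i.2 n; last exact: degree_comp (f1 n) ni.
  have := congr1 (cmp i) f3; rewrite (lin0 (component_linear dg i)).
  rewrite (lin_fsum (component_linear dg i) f2) (@fsum_single _ _ _ i.2) // => m mi.
  by apply: degree_comp (f1 m) _; rewrite eq_sym.
Qed.

(** The functional is nonzero on finitely many bidegrees, hence sees finitely many weights. *)
Lemma graded_dual_fin (f : {scalar W}) (X : C -> W) : graded_dual Wg f ->
  (forall n, weight_space Wg n (X n)) -> finite_set [set n | f (X n) != 0].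
Proof.
move=> hf hX.
apply: (sub_finite_set _ (finite_set_fst hf)) => n /= fX.
apply: contrapT => hn; move/eqP: fX; apply.
apply: (sum_of_ind (P := fun w => f w = 0) _ _ _ (hX n)).
- move=> a x hx; apply/eqP; apply: contrapT => /negP fx; apply: hn.
  by exists a; exists x.
- exact: linear0.
- by move=> x y hx hy; rewrite linearD hx hy addr0.
Qed.

End DoublyGraded.

(** A intertwines S - a with S' - (a + c). For A a mode of a vertex operator, c is the amount by
    which it shifts the weight. *)
Lemma gen_shift (R : realType) (M N : lmodType R[i]) (S : M -> M) (S' : N -> N) (A : M -> N)
    (a c : R[i]) x : linear A ->
  (forall y, S' (A y) = A (S y) + c *: A y) ->
  gen_eigenspace S a x -> gen_eigenspace S' (a + c) (A x).
Proof.
move=> lA h [k hk]; exists k.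
have E y : S' (A y) - (a + c) *: A y = A (S y - a *: y).
  by rewrite h (linB lA) (linZ lA) scalerDl opprD addrACA subrr addr0.
have -> : iter k (fun y => S' y - (a + c) *: y) (A x) = A (iter k (fun y => S y - a *: y) x).
  by elim: k {hk} => //= k ->; rewrite E.
by rewrite hk (lin0 lA).
Qed.

Lemma gen_opp (R : realType) (M : lmodType R[i]) (S S' : M -> M) (a : R[i]) x :
  linear S -> (forall y, S' y = - S y) ->
  gen_eigenspace S a x <-> gen_eigenspace S' (- a) x.
Proof.
move=> lS h.
have E k y : iter k (fun y => S' y + a *: y) y = (-1) ^+ k *: iter k (fun y => S y - a *: y) y.
  elim: k => [|k IH] /=; first by rewrite scale1r.
  have lS' : linear (fun y => S y - a *: y) by apply: lin_sub => //; exact: lin_scaler.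
  rewrite h IH (linZ lS) exprS mulN1r scaleNr scalerBr opprB addrC !scalerA.
  by rewrite [a * _]mulrC.
have E2 : (fun y => S' y - (- a) *: y) = (fun y => S' y + a *: y).
  by apply/funext => y; rewrite scaleNr opprK.
split=> -[k hk]; exists k.
  by rewrite E2 E hk scaler0.
move: hk; rewrite E2 E => /eqP; rewrite scaler_eq0 => /orP[|/eqP //].
by rewrite expf_eq0 oppr_eq0 oner_eq0 andbF.
Qed.

(** * Products and iterates as expansions of one rational function *)

Section ThreeRegions.
Variable R : realType.
Local Notation C := R[i].
Local Notation nc := (@Normc.normc R).

Lemma zdiv_asum d t (f : int -> C) (i0 : int) N : nc d < 1 ->
  (forall i, i < i0 -> f i = 0) ->
  (forall n : nat, (N <= n)%N ->
     \sum_(k < t.+1) ('C(t, k)%:R * d ^+ k) * f (i0 + n%:Z - k%:Z) = 0) ->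
  asum (fun n : nat => f (i0 + n%:Z)) ((\sum_(n < N) \sum_(k < t.+1)
     ('C(t, k)%:R * d ^+ k) * f (i0 + n%:Z - k%:Z)) / (1 + d) ^+ t).
Proof.
move=> d1 f0 h; under eq_bigr do rewrite -iter_diffz.
by apply: zdiv_aux => // n Nn; rewrite iter_diffz; exact: h.
Qed.

Lemma nc_divlt (a b : C) : nc a < nc b -> nc (a / b) < 1.
Proof.
move=> h; have b0 : 0 < nc b by apply: le_lt_trans (nc_ge0 a) h.
have bn : b != 0 by rewrite -nc_gt0.
rewrite -(ltr_pM2r b0) mul1r -Normc.normcM divfK //.
Qed.

Lemma expz_div (a b : C) (n : int) : (a / b) ^ n = a ^ n * b ^ (- n).
Proof. by rewrite expfzMl -exprz_inv. Qed.

(* X, Z and I are the matrix coefficients of a product, of the opposite product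
   and of an iterate in a fixed total weight; hXZ is weak commutativity and hXI
   weak associativity. *)
Variables (X Z I : int -> C) (N t L : nat) (m0 : int).
Hypotheses (m0L : m0 + L%:Z = N%:Z)
  (hX : forall i, i < m0 + t%:Z -> X i = 0)
  (hZ : forall i, N%:Z <= i -> Z i = 0)
  (hI : forall i, t%:Z <= i -> I i = 0).

(** Multiplication by (1 - x)^t on coefficients, indexed so that m belongs to x^(m + t). *)
Definition diff_seq (F : int -> C) (m : int) :=
  \sum_(k < t.+1) ((-1) ^+ k * 'C(t, k)%:R) * F (m + t%:Z - k%:Z).
Local Notation P := (diff_seq X).

Hypotheses (hXZ : forall m, P m = diff_seq Z m)
  (hXI : forall l : int, \sum_(k < N.+1) 'C(N, k)%:R * I (l + k%:Z) =
     \sum_(i \in [set: nat]) ((-1) ^+ i * binz R l i) * X (N%:Z + l - i%:Z)).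

(** The rational function behind the three expansions: a Laurent polynomial over (z1 - z2)^t. The L
    terms suffice because [P] is supported in m0 <= m < m0 + L = N. *)
Definition common_sum (z1 z2 : C) := \sum_(r < L)
  P (m0 + r%:Z) * (z1 ^ (- (m0 + r%:Z)) * z2 ^ (m0 + r%:Z + t%:Z) * (z1 - z2) ^- t).

Lemma P_hi m : N%:Z <= m -> P m = 0.
Proof.
move=> h; rewrite hXZ /diff_seq big1 // => k _; rewrite hZ ?mulr0 //.
have := ltn_ord k; lia.
Qed.

Lemma P_lo m : m < m0 -> P m = 0.
Proof. by move=> h; rewrite /diff_seq big1 // => k _; rewrite hX ?mulr0 //; lia. Qed.

(** With x = z2 / z1, multiplying by (1 - x)^t leaves the finite sequence [P]; [zdiv] divides
    back. *)
Lemma region1 z1 z2 : nc z2 < nc z1 -> z2 != 0 ->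
  sasum (fun i : int => X i * (z2 / z1) ^ i) (common_sum z1 z2).
Proof.
move=> h z20; have z10 : z1 != 0 by rewrite -nc_gt0; apply: le_lt_trans (nc_ge0 _) h.
have e0 : z2 / z1 != 0 by rewrite mulf_neq0 ?invr_neq0.
have d1 : nc (- (z2 / z1)) < 1 by rewrite ncN; exact: nc_divlt.
have E (n : int) : \sum_(k < t.+1) ('C(t, k)%:R * (- (z2 / z1)) ^+ k) *
     (X (m0 + t%:Z + n - k%:Z) * (z2 / z1) ^ (m0 + t%:Z + n - k%:Z)) =
   (z2 / z1) ^ (m0 + n + t%:Z) * P (m0 + n).
  rewrite /diff_seq mulr_sumr; apply: eq_bigr => k _.
  have -> : m0 + t%:Z + n - k%:Z = m0 + n + t%:Z - k%:Z by lia.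
  have -> : (z2 / z1) ^ (m0 + n + t%:Z) = (z2 / z1) ^ (m0 + n + t%:Z - k%:Z) * (z2 / z1) ^+ k.
    by rewrite [_ ^+ k]exprnP -expfzDr // subrK.
  by rewrite (exprNn (z2 / z1)); ring.
have hf i : i < m0 + t%:Z -> X i * (z2 / z1) ^ i = 0 by move=> /hX ->; rewrite mul0r.
have hd n : (L <= n)%N -> \sum_(k < t.+1) ('C(t, k)%:R * (- (z2 / z1)) ^+ k) *
     (X (m0 + t%:Z + n%:Z - k%:Z) * (z2 / z1) ^ (m0 + t%:Z + n%:Z - k%:Z)) = 0.
  by move=> Ln; rewrite E P_hi ?mulr0 //; lia.
have := zdiv d1 hf hd.
congr sasum; rewrite /common_sum mulr_suml; apply: eq_bigr => n _.
rewrite E mulrAC mulrC; congr (_ * _).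
have -> : 1 + - (z2 / z1) = (z1 - z2) / z1 by rewrite mulrBl divff.
have -> : (z2 / z1) ^ (m0 + n%:Z + t%:Z) = z2 ^ (m0 + n%:Z + t%:Z) * (z1 ^ (- (m0 + n%:Z)) / z1 ^+ t).
  by rewrite expz_div (opprD (m0 + n%:Z) t%:Z) (expfzDr (- (m0 + n%:Z)) (- t%:Z) z10) -(invr_expz z1 t%:Z).
have zt : z1 ^+ t != 0 by rewrite expf_neq0.
rewrite expr_div_n invf_div -[RHS]mulr1 -(divff zt); ring.
Qed.

(** Z vanishes for large indices, so the series is read in powers of z1 / z2. Reversing the binomial
    sum brings in (-1)^t, the sign between (z1 - z2)^t and (z2 - z1)^t. *)
Lemma region2 z1 z2 : nc z1 < nc z2 -> z1 != 0 ->
  sasum (fun i : int => Z i * (z2 / z1) ^ i) (common_sum z1 z2).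
Proof.
move=> h z10; have z20 : z2 != 0 by rewrite -nc_gt0; apply: le_lt_trans (nc_ge0 _) h.
have e0 : z1 / z2 != 0 by rewrite mulf_neq0 ?invr_neq0.
have d1 : nc (- (z1 / z2)) < 1 by rewrite ncN; exact: nc_divlt.
pose f (i : int) := Z (- i) * (z1 / z2) ^ i.
have E (n : nat) : \sum_(k < t.+1) ('C(t, k)%:R * (- (z1 / z2)) ^+ k) *
     f (1 - N%:Z + n%:Z - k%:Z) =
   (z1 / z2) ^ (1 - N%:Z + n%:Z) * ((-1) ^+ t * P (N%:Z - 1 - n%:Z)).
  rewrite hXZ /diff_seq !mulr_sumr (reindex_inj rev_ord_inj) /=; apply: eq_bigr => k _.
  have kt : (k <= t)%N by rewrite -ltnS.
  rewrite subSS bin_sub // /f.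
  have -> : - (1 - N%:Z + n%:Z - (t - k)%N%:Z) = N%:Z - 1 - n%:Z + t%:Z - k%:Z by lia.
  have -> : (z1 / z2) ^ (1 - N%:Z + n%:Z) = (z1 / z2) ^ (1 - N%:Z + n%:Z - (t - k)%N%:Z) * (z1 / z2) ^+ (t - k).
    by rewrite [_ ^+ (t - k)]exprnP -expfzDr // subrK.
  rewrite (exprNn (z1 / z2)).
  have -> : (-1) ^+ t * ((-1) ^+ k * 'C(t, k)%:R * Z (N%:Z - 1 - n%:Z + t%:Z - k%:Z)) =
    (-1) ^+ (t - k) * ('C(t, k)%:R * Z (N%:Z - 1 - n%:Z + t%:Z - k%:Z)) :> C.
    rewrite !mulrA -exprD; congr (_ * _ * _).
    by rewrite -signr_odd -[in RHS]signr_odd oddD oddB.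
  by ring.
have hf i : i < 1 - N%:Z -> f i = 0.
  by move=> iN; rewrite /f hZ ?mul0r //; lia.
have hd n : (L <= n)%N -> \sum_(k < t.+1) ('C(t, k)%:R * (- (z1 / z2)) ^+ k) *
     f (1 - N%:Z + n%:Z - k%:Z) = 0.
  by move=> Ln; rewrite E P_lo ?mulr0 //; lia.
have hs := zdiv d1 hf hd.
apply: (@sasum_reindex _ _ _ (fun i : int => - i)); first exact: oppr_inj.
  by move=> j _; exists (- j); rewrite opprK.
apply: (sasum_eq (f := f)).
  by move=> i /=; rewrite /f !expz_div opprK mulrC [in RHS]mulrC; congr (_ * _); rewrite mulrC.
move: hs; congr sasum; rewrite /common_sum mulr_suml (reindex_inj rev_ord_inj) /=.
apply: eq_bigr => n _; rewrite E.
have nL := ltn_ord n.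
have -> : (L - n.+1)%N%:Z = L%:Z - n%:Z - 1 by lia.
have -> : N%:Z - 1 - (L%:Z - n%:Z - 1) = m0 + n%:Z by lia.
have -> : 1 - N%:Z + (L%:Z - n%:Z - 1) = - (m0 + n%:Z) by lia.
have -> : 1 + - (z1 / z2) = -1 * (z1 - z2) / z2 by field.
have zt : z2 ^+ t != 0 by rewrite expf_neq0.
rewrite expz_div opprK exprMn exprMn exprVn (expfzDr (m0 + n%:Z) t%:Z z20) -exprnP !invfM invrK.
have sg : ((-1) ^+ t)^-1 = (-1) ^+ t :> C by rewrite invr_sign.
rewrite sg; have s2 : (-1) ^+ t * (-1) ^+ t = 1 :> C by rewrite -expr2 sqrr_sign.
transitivity (((-1) ^+ t * (-1) ^+ t) * (P (m0 + n%:Z) * (z1 ^ (- (m0 + n%:Z)) * (z2 ^ (m0 + n%:Z) * z2 ^+ t) / (z1 - z2) ^+ t))); first by ring.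
by rewrite s2 mul1r.
Qed.

(** With the shift S this is ((S - 1)^l F)(N), expanded in powers of S^-1; for l < 0 it is an
    iterated summation, finite when F vanishes far to the left. So [diff_step] and [xdiff_dif] are
    laws of exponents. *)
Definition xdiff (F : int -> C) (l : int) :=
  \sum_(i \in [set: nat]) ((-1) ^+ i * binz R l i) * F (N%:Z + l - i%:Z).

(** Pascal's rule for binom(l + 1, i) with l of either sign; the lower bound x0 makes the sums
    finite. *)
Lemma diff_step (F : int -> C) (x0 : int) l : (forall i, i < x0 -> F i = 0) ->
  xdiff F (l + 1) = xdiff (fun m => F (m + 1) - F m) l.
Proof.
move=> hF.
pose b : int := N%:Z + l - x0; pose B := (`|b|%N).+2.
have hB (i : nat) : (B <= i)%N -> F (N%:Z + l - i%:Z) = 0 by move=> Bi; apply: hF; rewrite /B /b in Bi; lia.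
have hB1 (i : nat) : (B <= i)%N -> F (N%:Z + l + 1 - i%:Z) = 0 by move=> Bi; apply: hF; rewrite /B /b in Bi; lia.
rewrite /xdiff (@fsum_nat _ _ B.+1) => [|i Bi]; last first.
  by rewrite addrA hB1 ?mulr0 //; exact: ltnW.
rewrite (@fsum_nat _ _ B) => [|i Bi]; last first.
  by rewrite addrAC hB1 // hB // subr0 mulr0.
rewrite big_ord_recl /= binz0 expr0 mul1r mul1r subr0 addrA.
have pascal (i : nat) : binz R (l + 1) i.+1 = binz R l i.+1 + binz R l i.
  elim: i => [|i IH].
    have h1 := binzS R (l + 1) 0; have h2 := binzS R l 0.
    move: h1 h2; rewrite !binz0 !mulr1 !mul1r !subr0 => -> ->.
    by rewrite rmorphD.
  apply: (@mulfI _ (i.+2%:R : C)); first exact: natS_neq0.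
  rewrite mulrDr !binzS IH mulrDr.
  have -> : i.+2%:R * binz R l i.+1 = i.+1%:R * binz R l i.+1 + binz R l i.+1.
    by rewrite -[i.+2]addn1 natrD mulrDl mul1r.
  rewrite [X in _ = _ + (X + _)]binzS rmorphD /=.
  have h := binzS R l i.
  have -> : i.+1%:R = i%:R + 1 :> C by rewrite -natr1.
  rewrite -natr1 in h.
  have h' : binz R l i.+1 * (i%:R + 1) = (l%:~R - i%:R) * binz R l i by rewrite mulrC.
  ring: h'.
rewrite [in RHS](eq_bigr (fun i : 'I_B => ((-1) ^+ i * binz R l i) * F (N%:Z + l + 1 - i%:Z)
   - ((-1) ^+ i * binz R l i) * F (N%:Z + l - i%:Z))); last first.
  by move=> i _; rewrite mulrBr addrAC.
rewrite sumrB.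
rewrite (eq_bigr (fun i : 'I_B => ((-1) ^+ i.+1 * binz R l i.+1) * F (N%:Z + l + 1 - i.+1%:Z)
   - ((-1) ^+ i * binz R l i) * F (N%:Z + l - i%:Z))); last first.
  move=> i _; rewrite /bump /= add1n pascal.
  have -> : N%:Z + l + 1 - i.+1%:Z = N%:Z + l - i%:Z by lia.
  by rewrite exprS; ring.
rewrite sumrB addrA; congr (_ - _).
transitivity (\sum_(i < B.+1) ((-1) ^+ i * binz R l i) * F (N%:Z + l + 1 - i%:Z)).
  by rewrite [RHS]big_ord_recl /= binz0 expr0 mul1r mul1r subr0.
by rewrite big_ord_recr /= hB1 // mulr0 addr0.
Qed.

Fixpoint dif (r : nat) (F : int -> C) : int -> C :=
  if r is r'.+1 then fun m => dif r' F (m + 1) - dif r' F m else F.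

Lemma difE r F m : dif r F m = \sum_(k < r.+1) ((-1) ^+ k * 'C(r, k)%:R) * F (m + r%:Z - k%:Z).
Proof.
elim: r m => [|r IH] m; first by rewrite big_ord1 /= bin0 !mul1r addr0 subr0.
rewrite /= !IH big_ord_recl [in RHS]big_ord_recl /= !bin0 -!addrA; congr (_ + _).
rewrite [X in _ = X](eq_bigr (fun k : 'I_r.+1 =>
   ((-1) ^+ k.+1 * 'C(r, k.+1)%:R) * F (m + (1 + r%:Z) - k.+1%:Z) -
   ((-1) ^+ k * 'C(r, k)%:R) * F (m + r%:Z - k%:Z))); last first.
  move=> k _; rewrite /bump /= add1n binS natrD exprS.
  have -> : m + r.+1%:Z - k.+1%:Z = m + r%:Z - k%:Z by lia.
  by ring.
rewrite sumrB; congr (_ - _).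
rewrite [RHS]big_ord_recr /= bin_small // mulr0 mul0r addr0; apply: eq_bigr => k _.
by rewrite /bump /= add1n; congr (_ * F _); lia.
Qed.

Lemma dif_lo r F (x0 : int) : (forall i, i < x0 -> F i = 0) -> forall i, i < x0 - r%:Z -> dif r F i = 0.
Proof. by move=> h i hi; rewrite difE big1 // => k _; rewrite h ?mulr0 //; lia. Qed.

Lemma xdiff_dif r F (x0 : int) l : (forall i, i < x0 -> F i = 0) ->
  xdiff F (l + r%:Z) = xdiff (dif r F) l.
Proof.
move=> hF; elim: r l => [|r IH] l; first by rewrite addr0.
have -> : l + r.+1%:Z = (l + 1) + r%:Z by lia.
by rewrite IH (diff_step _ (@dif_lo r F x0 hF)).
Qed.

(** In the exponent t - 1 - s = t + (- s - 1), the t differences turn X into [P]; then binom(- s -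
    1, i) = (-1)^i binom(s + i, i) cancels the alternating sign, and only finitely many terms are
    left. *)
Lemma Qval s : \sum_(k < N.+1) 'C(N, k)%:R * I (t%:Z - 1 - s%:Z + k%:Z) =
  \sum_(i < L | (s + i < L)%N) 'C(s + i, s)%:R * P (N%:Z - 1 - (s + i)%N%:Z).
Proof.
rewrite hXI -/(xdiff X _).
have -> : t%:Z - 1 - s%:Z = (- s%:Z - 1) + t%:Z by lia.
rewrite (xdiff_dif _ _ hX) /xdiff.
have PE m : dif t X m = P m by rewrite difE.
rewrite (@fsum_nat _ _ L) => [|i Li]; last first.
  by rewrite PE P_lo ?mulr0 //; lia.
rewrite [RHS]big_mkcond /=; apply: eq_bigr => i _.
have -> : binz R (- s%:Z - 1) i = (-1) ^+ i * 'C(s + i, i)%:R.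
  by rewrite -binz_neg; congr (binz R _ i); lia.
rewrite mulrA -expr2 sqrr_sign mul1r PE.
have -> : N%:Z + (- s%:Z - 1) - i%:Z = N%:Z - 1 - (s + i)%N%:Z by lia.
have -> : 'C(s + i, i) = 'C(s + i, s) by rewrite -[in RHS]bin_sub ?leq_addr // addKn.
case: ifP => // /negbT; rewrite -leqNgt => h.
by rewrite P_lo ?mulr0 //; lia.
Qed.

(** For y = (z1 - z2) / z2, multiplication by (1 + y)^N = (z1 / z2)^N makes the iterate finite, by
    [Qval]. The factor (z1 - z2) / z1 makes up for the factors 1 / (z1 - z2) and 1 / z1 omitted from
    the iterate and from the product. *)
Lemma region3 z1 z2 : nc (z1 - z2) < nc z2 -> z1 - z2 != 0 ->
  asum (fun n : nat => I (t%:Z - 1 - n%:Z) * ((z1 - z2) / z2) ^ (n%:Z + 1 - t%:Z))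
    ((z1 - z2) / z1 * common_sum z1 z2).
Proof.
move=> h z00; have z20 : z2 != 0 by rewrite -nc_gt0; apply: le_lt_trans (nc_ge0 _) h.
have z10 : z1 != 0.
  apply: contraTneq h => ->; by rewrite sub0r ncN ltxx.
pose y := (z1 - z2) / z2; have y1 : nc y < 1 by exact: nc_divlt.
have y0 : y != 0 by rewrite mulf_neq0 ?invr_neq0.
have y10 : 1 + y = z1 / z2 by rewrite /y; field.
pose f (i : int) := I (- i) * y ^ i.
have E (n : nat) : \sum_(k < N.+1) ('C(N, k)%:R * y ^+ k) * f (1 - t%:Z + n%:Z - k%:Z) =
  y ^ (1 - t%:Z + n%:Z) *
  \sum_(i < L | (n + i < L)%N) 'C(n + i, n)%:R * P (N%:Z - 1 - (n + i)%N%:Z).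
  rewrite -Qval mulr_sumr; apply: eq_bigr => k _; rewrite /f.
  have -> : - (1 - t%:Z + n%:Z - k%:Z) = t%:Z - 1 - n%:Z + k%:Z by lia.
  have -> : y ^ (1 - t%:Z + n%:Z) = y ^ (1 - t%:Z + n%:Z - k%:Z) * y ^+ k.
    by rewrite [_ ^+ k]exprnP -expfzDr // subrK.
  by ring.
have hf i : i < 1 - t%:Z -> f i = 0 by move=> it; rewrite /f hI ?mul0r //; lia.
have hd n : (L <= n)%N -> \sum_(k < N.+1) ('C(N, k)%:R * y ^+ k) *
     f (1 - t%:Z + n%:Z - k%:Z) = 0.
  by move=> Ln; rewrite E big1 ?mulr0 // => i; lia.
have := zdiv_asum y1 hf hd.
have -> : (fun n : nat => f (1 - t%:Z + n%:Z)) =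
  (fun n : nat => I (t%:Z - 1 - n%:Z) * y ^ (n%:Z + 1 - t%:Z)).
  by apply/funext => n; rewrite /f; congr (I _ * _ ^ _); lia.
congr asum.
under eq_bigr do rewrite E mulr_sumr.
rewrite (eq_bigr (fun n : 'I_L => \sum_(i < L | (n + i < L)%N)
  y ^ (1 - t%:Z) * (P (N%:Z - 1 - (n + i)%N%:Z) * ('C(n + i, n)%:R * y ^+ n)))); last first.
  move=> n _; apply: eq_bigr => i _; rewrite (expfzDr _ _ y0) -exprnP; ring.
pose F (n i : nat) := y ^ (1 - t%:Z) * (P (N%:Z - 1 - (n + i)%N%:Z) * ('C(n + i, n)%:R * y ^+ n)).
rewrite -(triangle_sum F) /F {F}.
(* For fixed r = n + i the inner sum is the binomial expansion of (1 + y)^r. *)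
rewrite (eq_bigr (fun r : 'I_L => y ^ (1 - t%:Z) * P (N%:Z - 1 - r%:Z) * (1 + y) ^+ r)); last first.
  move=> r _; rewrite (addrC 1 y) exprDn mulr_sumr.
  rewrite [RHS](reindex_inj rev_ord_inj) /=; apply: eq_bigr => n _.
  have nr : (n <= r)%N by rewrite -ltnS.
  rewrite subSS subnKC // subKn // expr1n mulr1 bin_sub // -mulr_natl.
  by ring.
rewrite mulr_suml /common_sum mulr_sumr [RHS](reindex_inj rev_ord_inj) /=.
apply: eq_bigr => r _; have rL := ltn_ord r.
have -> : m0 + (L - r.+1)%N%:Z = N%:Z - 1 - r%:Z by lia.
set m := N%:Z - 1 - r%:Z.
rewrite y10.
have y1n : z1 / z2 != 0 by rewrite mulf_neq0 ?invr_neq0.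
have -> : y ^ (1 - t%:Z) * P m * (z1 / z2) ^+ r / (z1 / z2) ^+ N =
   P m * (y ^ (1 - t%:Z) * (z1 / z2) ^ (- m - 1)).
  have -> : - m - 1 = r%:Z - N%:Z by rewrite /m; lia.
  by rewrite (expfzDr _ _ y1n) -invr_expz -!exprnP; ring.
have -> : (z1 - z2) / z1 * (P m * (z1 ^ (- m) * z2 ^ (m + t%:Z) / (z1 - z2) ^+ t)) =
  P m * ((z1 - z2) / z1 * (z1 ^ (- m) * z2 ^ (m + t%:Z) / (z1 - z2) ^+ t)) by ring.
congr (_ * _).
have -> : y ^ (1 - t%:Z) = (z1 - z2) ^ (1 - t%:Z) * z2 ^ (t%:Z - 1).
  by rewrite /y expz_div opprB.
have -> : (z1 / z2) ^ (- m - 1) = z1 ^ (- m - 1) * z2 ^ (m + 1).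
  by rewrite expz_div; congr (_ * _ ^ _); lia.
rewrite (expfzDr _ _ z00) (expfzDr (-m) _ z10).
rewrite (expfzDr t%:Z (-1) z20) (expfzDr m t%:Z z20) (expfzDr m 1 z20).
rewrite -!invr_expz -!exprnP !expr1.
move: ((z1 - z2) ^+ t)^-1 (z1 ^ m)^-1 (z2 ^ m) => A B E'.
by rewrite -[RHS]mulr1 -(divff z20); ring.
Qed.

End ThreeRegions.

(** * Finite sums of monomials in powers and logarithms *)

Section LogFunctions.
Variable R : realType.
Local Notation C := R[i].
Local Notation nc := (@Normc.normc R).

Definition log_monomial (x : C * (C * nat) * (C * nat)) (l1 l2 : C) :=
  x.1.1 * cexp (x.1.2.1 * l1) * l1 ^+ x.1.2.2 * cexp (x.2.1 * l2) * l2 ^+ x.2.2.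

(** A list of monomials is easy to add up and to multiply by constants; the rigid array of the
    duality axiom is filled only in [elog_f_branch]. *)
Definition elog (G : C -> C -> C) := exists ts : seq (C * (C * nat) * (C * nat)),
  forall l1 l2, G l1 l2 = \sum_(x <- ts) log_monomial x l1 l2.

Lemma elog_monomial x : elog (log_monomial x).
Proof. by exists [:: x] => l1 l2; rewrite big_seq1. Qed.

Lemma elog0 : elog (fun _ _ => 0).
Proof. by exists [::] => l1 l2; rewrite big_nil. Qed.

Lemma elogD F G : elog F -> elog G -> elog (fun l1 l2 => F l1 l2 + G l1 l2).
Proof. by move=> [s hs] [r hr]; exists (s ++ r) => l1 l2; rewrite big_cat hs hr. Qed.

Lemma elog_sum (J : Type) (r : seq J) (G : J -> C -> C -> C) :
  (forall j, elog (G j)) -> elog (fun l1 l2 => \sum_(j <- r) G j l1 l2).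
Proof.
move=> h; elim: r => [|j r [s hs]].
  by exists [::] => l1 l2; rewrite !big_nil.
have [s' hs'] := h j.
by exists (s' ++ s) => l1 l2; rewrite big_cons big_cat hs hs'.
Qed.

(** The s-th monomial of the list is placed at i = j = s, with k and l its log exponents; N bounds
    the length of the list and these exponents. *)
Lemma elog_f_branch t G : elog G -> exists N a m n, forall z1 z2 l1 l2,
  f_branch N a m n t z1 z2 l1 l2 = G l1 l2 * (z1 - z2) ^- t.
Proof.
move=> [ts hts].
pose x0 : C * (C * nat) * (C * nat) := (0, (0, 0%N), (0, 0%N)).
pose K := \max_(x <- ts) maxn x.1.2.2 x.2.2.
have hK i : (i < size ts)%N -> ((nth x0 ts i).1.2.2 <= K)%N /\ ((nth x0 ts i).2.2 <= K)%N.
  move=> it; have /(@leq_bigmax_seq _ _ xpredT (fun x => maxn x.1.2.2 x.2.2)) := mem_nth x0 it.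
  by move=> /(_ isT); rewrite geq_max => /andP.
pose N := maxn (size ts) K.
exists N, (fun i j k l => if [&& i == j, k == (nth x0 ts i).1.2.2 & l == (nth x0 ts i).2.2]
  then (if (i < size ts)%N then (nth x0 ts i).1.1 else 0) else 0),
  (fun i => (nth x0 ts i).1.2.1), (fun i => (nth x0 ts i).2.1) => z1 z2 l1 l2.
rewrite hts mulr_suml (big_nth x0) big_mkord.
have sN : (size ts <= N.+1)%N by apply: leq_trans (leq_maxl _ K) (leqnSn _).
rewrite (big_ord_widen _ (fun i => log_monomial (nth x0 ts i) l1 l2 * (z1 - z2) ^- t) sN).
rewrite [RHS]big_mkcond /=; apply: eq_bigr => i _.
have z (V : nmodType) (F : 'I_N.+1 -> V) (j : 'I_N.+1) : (forall k, k != j -> F k = 0) -> \sum_k F k = F j.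
  by move=> h; rewrite (bigD1 j) //= big1 ?addr0 // => k /h.
rewrite (z _ _ i); last first.
  move=> j ji; rewrite big1 // => k _; rewrite big1 // => l _.
  by rewrite [_ == _ :> nat]eq_sym -[_ == _ :> nat]/(j == i) (negbTE ji) /= !mul0r.
case: ifP => it; last first.
  by rewrite big1 // => k _; rewrite big1 // => l _; case: ifP; rewrite !mul0r.
have [k1 k2] := hK i it.
have kN : ((nth x0 ts i).1.2.2 < N.+1)%N by rewrite ltnS; apply: leq_trans k1 (leq_maxr _ _).
have lN : ((nth x0 ts i).2.2 < N.+1)%N by rewrite ltnS; apply: leq_trans k2 (leq_maxr _ _).
rewrite (z _ _ (Ordinal kN)); last first.
  move=> k kk; rewrite big1 // => l _.
  have -> : ((k : nat) == (nth x0 ts i).1.2.2) = false by exact: negbTE kk.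
  by rewrite /= andbF !mul0r.
rewrite (z _ _ (Ordinal lN)); last first.
  move=> l ll.
  have -> : ((l : nat) == (nth x0 ts i).2.2) = false by exact: negbTE ll.
  by rewrite !andbF !mul0r.
by rewrite /= !eqxx /log_monomial /=; ring.
Qed.

(* The common shape of the three expansions in the duality axiom. *)
Definition dual_series (t : nat) (I1 I2 I3 : choiceType)
    (f1 : int -> C -> C -> I1 -> C) (f2 : int -> C -> C -> I2 -> C)
    (f3 : int -> C -> C -> I3 -> C) : Prop :=
  exists G, elog G /\ forall p z1 z2, [/\
    nc z2 < nc z1 -> z2 != 0 ->
      sasum (f1 p z1 z2) (G (lbr p z1) (lbr p z2) * (z1 - z2) ^- t),
    nc z1 < nc z2 -> z1 != 0 ->
      sasum (f2 p z1 z2) (G (lbr p z1) (lbr p z2) * (z1 - z2) ^- t)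
  & nc (z1 - z2) < nc z2 -> z1 - z2 != 0 -> forall q : int,
      `|complex.Im (lbr q z1 - lbr p z2)| < pi / 2 ->
      sasum (f3 p z1 z2) (G (lbr q z1) (lbr p z2) * (z1 - z2) ^- t)].

Lemma dual_series0 t (I1 I2 I3 : choiceType) :
  dual_series t (fun _ _ _ (_ : I1) => 0) (fun _ _ _ (_ : I2) => 0) (fun _ _ _ (_ : I3) => 0).
Proof.
exists (fun _ _ => 0); split; first exact: elog0.
by move=> p z1 z2; split => *; rewrite mul0r; exact: sasum0.
Qed.

Lemma dual_seriesD t (I1 I2 I3 : choiceType) (f1 g1 : int -> C -> C -> I1 -> C)
  (f2 g2 : int -> C -> C -> I2 -> C) (f3 g3 : int -> C -> C -> I3 -> C) :
  dual_series t f1 f2 f3 -> dual_series t g1 g2 g3 ->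
  dual_series t (fun p z1 z2 i => f1 p z1 z2 i + g1 p z1 z2 i)
    (fun p z1 z2 i => f2 p z1 z2 i + g2 p z1 z2 i)
    (fun p z1 z2 i => f3 p z1 z2 i + g3 p z1 z2 i).
Proof.
move=> [F [eF hF]] [G [eG hG]]; exists (fun l1 l2 => F l1 l2 + G l1 l2); split; first exact: elogD.
move=> p z1 z2; have [F1 F2 F3] := hF p z1 z2; have [G1 G2 G3] := hG p z1 z2.
split => *; rewrite mulrDl; apply: sasumD.
- exact: F1.
- exact: G1.
- exact: F2.
- exact: G2.
- exact: F3.
- exact: G3.
Qed.

Lemma dual_series_sum t (J : Type) (r : seq J) (I1 I2 I3 : choiceType)
  (f1 : J -> int -> C -> C -> I1 -> C) (f2 : J -> int -> C -> C -> I2 -> C)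
  (f3 : J -> int -> C -> C -> I3 -> C) :
  (forall j, dual_series t (f1 j) (f2 j) (f3 j)) ->
  dual_series t (fun p z1 z2 i => \sum_(j <- r) f1 j p z1 z2 i)
    (fun p z1 z2 i => \sum_(j <- r) f2 j p z1 z2 i)
    (fun p z1 z2 i => \sum_(j <- r) f3 j p z1 z2 i).
Proof.
move=> h; elim: r => [|j r IH].
  have := dual_series0 t I1 I2 I3; congr dual_series; do 4 apply/funext => ?; by rewrite big_nil.
have := dual_seriesD (h j) IH.
congr dual_series; do 4 apply/funext => ?; by rewrite big_cons.
Qed.

Lemma dual_series_reindex t (I1 I2 I3 J1 J2 J3 : choiceType)
  (h1 : I1 -> J1) (h2 : I2 -> J2) (h3 : I3 -> J3)
  (f1 : int -> C -> C -> I1 -> C) (f2 : int -> C -> C -> I2 -> C) (f3 : int -> C -> C -> I3 -> C)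
  (g1 : int -> C -> C -> J1 -> C) (g2 : int -> C -> C -> J2 -> C) (g3 : int -> C -> C -> J3 -> C) :
  injective h1 -> injective h2 -> injective h3 ->
  (forall p z1 z2, z1 != 0 -> z2 != 0 -> z1 - z2 != 0 -> [/\
    (forall j, g1 p z1 z2 j != 0 -> exists i, j = h1 i) /\ (forall i, g1 p z1 z2 (h1 i) = f1 p z1 z2 i),
    (forall j, g2 p z1 z2 j != 0 -> exists i, j = h2 i) /\ (forall i, g2 p z1 z2 (h2 i) = f2 p z1 z2 i) &
    (forall j, g3 p z1 z2 j != 0 -> exists i, j = h3 i) /\ (forall i, g3 p z1 z2 (h3 i) = f3 p z1 z2 i)]) ->
  dual_series t f1 f2 f3 -> dual_series t g1 g2 g3.
Proof.
move=> i1 i2 i3 h [G [eG hG]]; exists G; split => // p z1 z2.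
have [G1 G2 G3] := hG p z1 z2.
have nz (a b : C) : nc a < nc b -> b != 0.
  by move=> ab; rewrite -nc_gt0; apply: le_lt_trans (nc_ge0 a) ab.
have nd (a b : C) : nc a < nc b -> a - b != 0.
  by move=> ab; rewrite subr_eq0; apply: contraTneq ab => ->; rewrite ltxx.
split.
- move=> lt0 z20; have z0 : z1 - z2 != 0 by rewrite -oppr_eq0 opprB; exact: nd.
  have [[s1 e1] _ _] := h p z1 z2 (nz _ _ lt0) z20 z0.
  apply: (sasum_reindex i1 s1); apply: sasum_eq (G1 lt0 z20) => i /=; exact/esym/e1.
- move=> lt0 z10; have [_ [s1 e1] _] := h p z1 z2 z10 (nz _ _ lt0) (nd _ _ lt0).
  apply: (sasum_reindex i2 s1); apply: sasum_eq (G2 lt0 z10) => i /=; exact/esym/e1.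
- move=> lt0 z00 q hq.
  have z10 : z1 != 0 by apply: contraTneq lt0 => ->; rewrite sub0r ncN ltxx.
  have [_ _ [s1 e1]] := h p z1 z2 z10 (nz _ _ lt0) z00.
  apply: (sasum_reindex i3 s1); apply: sasum_eq (G3 lt0 z00 q hq) => i /=; exact/esym/e1.
Qed.

Lemma asum0 : asum (fun _ : nat => 0 : C) 0.
Proof.
have := @asum_fin R (fun=> 0) 0 (fun _ _ => erefl).
by rewrite big_ord0.
Qed.

Lemma asum_sum (J : Type) (r : seq J) (F : J -> nat -> C) (S : J -> C) :
  (forall j, asum (F j) (S j)) -> asum (fun n => \sum_(j <- r) F j n) (\sum_(j <- r) S j).
Proof.
move=> h; elim: r => [|j r IH].
  by rewrite big_nil; under eq_fun do rewrite big_nil; exact: asum0.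
by rewrite big_cons; under eq_fun do rewrite big_cons; exact: asumD.
Qed.

(** The coefficient of y^q in (1 + y)^a (l + log(1 + y))^k / k!. For l = log z2 and 1 + y = z1 / z2
    the second factor is a divided power of log z1. *)
Definition log_beta (k : nat) (a l : C) (q : nat) : C :=
  \sum_(i < k.+1) (l ^+ i / i`!%:R) * beta (k - i) q a.

Lemma asum_log_beta k a l y : nc y < 1 ->
  asum (fun q => log_beta k a l q * y ^+ q)
    (cexp (a * lam y) * ((l + lam y) ^+ k / k`!%:R)).
Proof.
move=> y1; rewrite exp_coefD mulr_sumr.
have := @asum_sum _ (index_enum 'I_k.+1) (fun i q => (l ^+ i / i`!%:R) * (beta (k - i) q a * y ^+ q))
  (fun i => (l ^+ i / i`!%:R) * (cexp (a * lam y) * (lam y ^+ (k - i) / (k - i)`!%:R)))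
  (fun i => asumZ _ (asum_beta_exp (k - i) a y1)).
have -> : (fun n : nat => \sum_i l ^+ (i : 'I_k.+1) / i`!%:R * (beta (k - i) n a * y ^+ n)) =
  (fun q => log_beta k a l q * y ^+ q).
  by apply/funext => q; rewrite /log_beta mulr_suml; apply: eq_bigr => i _; rewrite mulrA.
by congr asum; apply: eq_bigr => i _; ring.
Qed.

End LogFunctions.

Lemma lt_int_ex (t : nat) (j : int) : j < t%:Z -> exists i : nat, j = t%:Z - 1 - i%:Z.
Proof. by move=> jt; pose d : int := t%:Z - 1 - j; exists `|d|%N; rewrite /d; lia. Qed.

Lemma conv_index (t : int) (n r : nat) : (r <= n)%N ->
  t - 1 - (n - r)%N%:Z = t - 1 - n%:Z + r%:Z /\
  (n - r)%N%:Z + 1 - t = - (t - 1 - n%:Z + r%:Z).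
Proof. by move=> h; split; lia. Qed.

(** * Matrix coefficients of the untwisted module *)

Section Untwisted.
Variable R : realType.
Local Notation C := R[i].
Local Notation nc := (@Normc.normc R).
Variables (V W : lmodType C) (Y : V -> int -> V -> V) (YW : V -> int -> W -> W).
Hypotheses (bil : bilinear_modes YW) (trW : truncated YW) (jac : jacobi Y YW).
Let wlinr v n : linear (YW v n) := modes_linr bil v n.
Let wlinl n w : linear (fun v => YW v n w) := modes_linl bil n w.
Variables (A1 A2 : V) (w : W) (phi : {scalar W}) (kap : int) (t : nat).
Hypothesis hY : forall i, t%:Z <= i -> Y A1 i A2 = 0.

(** Fixing the sum [kap] of the two modes leaves one free index, so that each series depends on the
    ratio z2 / z1 or (z1 - z2) / z2 up to a common monomial. *)
Definition prod12 i := phi (YW A1 i (YW A2 (kap - i) w)).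
Definition prod21 i := phi (YW A2 (kap - i) (YW A1 i w)).
Definition iterate i := phi (YW (Y A1 i A2) (kap - i) w).

Lemma prod12_lo : exists x0 : int, forall i, i < x0 -> prod12 i = 0.
Proof.
have [n hn] := trW A2 w; exists (kap - n + 1) => i hi.
by rewrite /prod12 hn ?(lin0 (wlinr _ _)) ?linear0 //; lia.
Qed.

Lemma iterate_hi i : t%:Z <= i -> iterate i = 0.
Proof. by move=> h; rewrite /iterate hY // (lin0 (wlinl _ _)) linear0. Qed.

Lemma phi_fsum (c : nat -> C) (F : nat -> W) B : (forall i, (B <= i)%N -> c i *: F i = 0) ->
  phi (\sum_(i \in [set: nat]) c i *: F i) = \sum_(i < B) c i * phi (F i).
Proof.
move=> h; rewrite (fsum_nat h) linear_sum; apply: eq_bigr => i _.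
by rewrite linearZ.
Qed.

(** Weak commutativity: at l = t the hypothesis [hY] makes the right side of the Jacobi identity
    vanish. *)
Lemma prod_comm m : diff_seq t prod12 m = diff_seq t prod21 m.
Proof.
have := congr1 phi (jac A1 A2 w t%:Z m (kap - m - t%:Z)).
rewrite linearB /=.
have b0 i : (t.+1 <= i)%N -> binz R t%:Z i = 0 by move=> h; rewrite binz_nat bin_small.
rewrite (@phi_fsum _ _ t.+1) => [|i /b0 ->]; last by rewrite mulr0 scale0r.
rewrite (@phi_fsum _ _ t.+1) => [|i /b0 ->]; last by rewrite mulr0 scale0r.
rewrite (@phi_fsum _ _ 0) ?big_ord0 => [|i _]; last first.
  by rewrite hY ?(lin0 (wlinl _ _)) ?scaler0 //; lia.
move/eqP; rewrite subr_eq0 => /eqP h; rewrite /diff_seq.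
transitivity (\sum_(i < t.+1) (-1) ^+ i * binz R t i * phi (YW A1 (m + t%:Z - i%:Z) (YW A2 (kap - m - t%:Z + i%:Z) w))).
  apply: eq_bigr => i _; rewrite binz_nat /prod12; congr (_ * phi (YW _ _ (YW _ _ _))); lia.
rewrite h (reindex_inj rev_ord_inj) /=; apply: eq_bigr => i _.
have it : (i <= t)%N by rewrite -ltnS.
rewrite subSS binz_nat bin_sub // /prod21.
have -> : (-1) ^ (t%:Z + (t - i)%N%:Z) = (-1) ^+ i :> C.
  have -> : t%:Z + (t - i)%N%:Z = (t + (t - i))%N%:Z by [].
  rewrite -exprnP (_ : (t + (t - i) = i + 2 * (t - i))%N); last by lia.
  by rewrite exprD exprM sqrrN !expr1n mulr1.
have -> : kap - m - t%:Z + t%:Z - (t - i)%N%:Z = kap - (m + t%:Z - i%:Z) by lia.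
by have -> : m + (t - i)%N%:Z = m + t%:Z - i%:Z by lia.
Qed.

(** Weak associativity: with first mode N, the second product of the Jacobi identity involves only
    modes of [A1] that kill w. *)
Lemma prod_iterate (N : nat) l : (forall i, N%:Z <= i -> YW A1 i w = 0) ->
  \sum_(k < N.+1) 'C(N, k)%:R * iterate (l + k%:Z) =
     \sum_(i \in [set: nat]) ((-1) ^+ i * binz R l i) * prod12 (N%:Z + l - i%:Z).
Proof.
move=> hN.
have := congr1 phi (jac A1 A2 w l N%:Z (kap - N%:Z - l)).
have [x0 hx0] := prod12_lo.
have [n hn] := trW A2 w.
pose b1 : int := N%:Z + l - x0; pose b2 : int := n - (kap - N%:Z - l).
pose B := (`|b1| + `|b2|)%N.+1.
rewrite linearB /=.
rewrite (@phi_fsum _ _ B) => [|i hi]; last first.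
  have hi' : n <= kap - N%:Z - l + i%:Z by move: hi; rewrite /B /b2; lia.
  by rewrite (hn _ hi') (lin0 (wlinr _ _)) scaler0.
rewrite (@phi_fsum _ _ 0) ?big_ord0 ?subr0 => [|i _]; last first.
  by rewrite hN ?(lin0 (wlinr _ _)) ?scaler0 //; lia.
rewrite (@phi_fsum _ _ N.+1) => [|i hi]; last by rewrite binz_nat bin_small // scale0r.
rewrite (@fsum_nat _ _ B) => [|i hi]; last first.
  by rewrite hx0 ?mulr0 //; move: hi; rewrite /B /b1; lia.
move=> h; transitivity (\sum_(i < N.+1) binz R N i * phi (YW (Y A1 (l + i%:Z) A2) (N%:Z + (kap - N%:Z - l) - i%:Z) w)).
  by apply: eq_bigr => i _; rewrite binz_nat /iterate; congr (_ * phi (YW _ _ _)); lia.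
rewrite -h; apply: eq_bigr => i _; rewrite /prod12; congr (_ * phi (YW _ _ (YW _ _ _))); lia.
Qed.

Lemma untwisted_regions : exists (N L : nat) (m0 : int), forall z1 z2 : C, [/\
  nc z2 < nc z1 -> z2 != 0 ->
    sasum (fun i : int => prod12 i * (z2 / z1) ^ i) (common_sum prod12 t L m0 z1 z2),
  nc z1 < nc z2 -> z1 != 0 ->
    sasum (fun i : int => prod21 i * (z2 / z1) ^ i) (common_sum prod12 t L m0 z1 z2) &
  nc (z1 - z2) < nc z2 -> z1 - z2 != 0 ->
    asum (fun n : nat => iterate (t%:Z - 1 - n%:Z) * ((z1 - z2) / z2) ^ (n%:Z + 1 - t%:Z))
      ((z1 - z2) / z1 * common_sum prod12 t L m0 z1 z2)].
Proof.
have [x0 hx0] := prod12_lo; have [n hn] := trW A1 w.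
(* N bounds the modes of [A1] not killing w and is at least m0, so that N - m0 is a natural
   number. *)
pose m0 : int := x0 - t%:Z; pose N := (`|n| + `|m0|)%N.
exists N, (`|N%:Z - m0|%N), m0 => z1 z2.
have hL : m0 + `|N%:Z - m0|%N%:Z = N%:Z by rewrite /N; lia.
have hX i : i < m0 + t%:Z -> prod12 i = 0 by rewrite /m0 subrK; exact: hx0.
have hN i : N%:Z <= i -> YW A1 i w = 0 by move=> h; apply: hn; rewrite /N in h; lia.
have hZ i : N%:Z <= i -> prod21 i = 0.
  by move=> /hN h; rewrite /prod21 h (lin0 (wlinr _ _)) linear0.
split.
- exact: (region1 hL hX hZ prod_comm).
- exact: (region2 hL hX hZ prod_comm).
- exact: (region3 hL hX iterate_hi (fun l => prod_iterate l hN)).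
Qed.

Variables (b1 b2 : C) (k1 k2 : nat).

Definition log_prefactor (l1 l2 : C) := (cexp (b1 * l1) * (l1 ^+ k1 / k1`!%:R)) *
  (cexp (b2 * l2) * (l2 ^+ k2 / k2`!%:R)).

(** The number of q >= 0 with m + q < t; for other q the mode m + q of the iterate vanishes. *)
Definition iter_bound (m : int) := if m < t%:Z then `|t%:Z - m|%N else 0%N.

Lemma iter_boundE (n : nat) : iter_bound (t%:Z - 1 - n%:Z) = n.+1.
Proof.
rewrite /iter_bound; have -> : (t%:Z - 1 - n%:Z < t%:Z)%R = true by lia.
by lia.
Qed.

(** In the third region the factor z1^b1 (log z1)^k1 is expanded around z2 by [asum_log_beta] and
    multiplied with [region3] as a Cauchy product. The exponent b1 + 1 absorbs the factor 1 / z1 of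
    [region3]. *)
Lemma untwisted_dual_series : dual_series t
  (fun p z1 z2 (i : int) => log_prefactor (lbr p z1) (lbr p z2) * (prod12 i * (z2 / z1) ^ i))
  (fun p z1 z2 (i : int) => log_prefactor (lbr p z1) (lbr p z2) * (prod21 i * (z2 / z1) ^ i))
  (fun p z1 z2 (m : int) => (cexp ((b1 + 1 + b2) * lbr p z2) * (lbr p z2 ^+ k2 / k2`!%:R) / (z1 - z2)) *
     \sum_(q < iter_bound m) (log_beta k1 (b1 + 1) (lbr p z2) q * ((z1 - z2) / z2) ^+ q) *
        (iterate (m + q%:Z) * ((z1 - z2) / z2) ^ (- (m + q%:Z)))).
Proof.
have [N [L [m0 hreg]]] := untwisted_regions.
pose G l1 l2 := \sum_(r < L) log_monomial
  (diff_seq t prod12 (m0 + r%:Z) / (k1`!%:R * k2`!%:R),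
    (b1 - (m0 + r%:Z)%:~R, k1), (b2 + (m0 + r%:Z + t%:Z)%:~R, k2)) l1 l2.
exists G; split; first by apply: elog_sum => r; exact: elog_monomial.
have GE (l1 l2 z1 z2 : C) : z1 != 0 -> z2 != 0 -> cexp l1 = z1 -> cexp l2 = z2 ->
    log_prefactor l1 l2 * common_sum prod12 t L m0 z1 z2 = G l1 l2 * (z1 - z2) ^- t.
  move=> z10 z20 e1 e2; rewrite /common_sum /G mulr_sumr mulr_suml; apply: eq_bigr => r _.
  rewrite /log_prefactor /log_monomial /= mulrBl mulrDl (cexpD (b1 * l1)) (cexpD (b2 * l2)).
  rewrite cexpN !cexpMz e1 e2 invr_expz invfM; ring.
move=> p z1 z2; have [h1 h2 h3] := hreg z1 z2.
have nz (a b : C) : nc a < nc b -> b != 0.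
  by move=> ab; rewrite -nc_gt0; apply: le_lt_trans (nc_ge0 a) ab.
split.
- move=> lt0 z20; have z10 := nz _ _ lt0.
  rewrite -(GE _ _ z1 z2) ?cexp_lbr //; exact: sasumZ (h1 lt0 z20).
- move=> lt0 z10; have z20 := nz _ _ lt0.
  rewrite -(GE _ _ z1 z2) ?cexp_lbr //; exact: sasumZ (h2 lt0 z10).
move=> lt0 z00 q hq; have z20 := nz _ _ lt0.
have z10 : z1 != 0 by apply: contraTneq lt0 => ->; rewrite sub0r ncN ltxx.
rewrite -(GE _ _ z1 z2) ?cexp_lbr // (lbr_lam lt0 hq).
set y := (z1 - z2) / z2; set l2 := lbr p z2.
have y1 : nc y < 1 by exact: nc_divlt.
have y0 : y != 0 by rewrite mulf_neq0 ?invr_neq0.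
have := asum_conv (asum_log_beta k1 (b1 + 1) l2 y1) (h3 lt0 z00).
rewrite -/y => hc; have {}hc := asumZ (cexp ((b1 + 1 + b2) * l2) * (l2 ^+ k2 / k2`!%:R) / (z1 - z2)) hc.
have sE : cexp ((b1 + 1 + b2) * l2) * (l2 ^+ k2 / k2`!%:R) / (z1 - z2) *
    (cexp ((b1 + 1) * lam y) * ((l2 + lam y) ^+ k1 / k1`!%:R) * ((z1 - z2) / z1 * common_sum prod12 t L m0 z1 z2)) =
  log_prefactor (l2 + lam y) l2 * common_sum prod12 t L m0 z1 z2.
  rewrite /log_prefactor.
  have -> : cexp ((b1 + 1 + b2) * l2) = cexp ((b1 + 1) * l2) * cexp (b2 * l2) by rewrite mulrDl cexpD.
  have e1 : cexp ((b1 + 1) * l2) * cexp ((b1 + 1) * lam y) = cexp (b1 * (l2 + lam y)) * z1.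
    rewrite -cexpD -mulrDr mulrDl mul1r cexpD; congr (_ * _).
    by rewrite -(lbr_lam lt0 hq) cexp_lbr.
  set S := common_sum _ _ _ _ _ _; set F1 := _ ^+ k1 / _; set F2 := _ ^+ k2 / _.
  transitivity ((cexp ((b1 + 1) * l2) * cexp ((b1 + 1) * lam y)) * (cexp (b2 * l2) * F1 * F2 * S / z1 * ((z1 - z2) / (z1 - z2)))).
    by ring.
  rewrite e1 divff // mulr1.
  transitivity ((z1 / z1) * (cexp (b1 * (l2 + lam y)) * F1 * (cexp (b2 * l2) * F2) * S)); first by ring.
  by rewrite divff // mul1r.
rewrite -sE.
apply: (@sasum_reindex _ _ _ (fun n : nat => t%:Z - 1 - n%:Z)).
- by move=> m n /addrI /oppr_inj [].
- move=> j; rewrite /iter_bound; case: ifP => [jt _|_]; last by rewrite big_ord0 mulr0 eqxx.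
  exact: lt_int_ex.
apply: asum_sasum; apply: eq_asum hc => n /=; congr (_ * _); rewrite /conv iter_boundE.
apply: eq_bigr => r _; have rn : (r <= n)%N by rewrite -ltnS.
by have [-> ->] := conv_index t rn.
Qed.

End Untwisted.

(** * The twisted module *)

Section Auxiliary.
Variable R : realType.
Local Notation C := R[i].

Lemma gen_id_shift (M : lmodType C) (A B : M -> M) (a c : C) x :
  (forall y, B y = A y + c *: y) -> gen_eigenspace A a x -> gen_eigenspace B (a + c) x.
Proof. by move=> h; apply: (gen_shift (A := fun y => y)) => //; exact: lin_id. Qed.

Lemma direct_sum_reindex (M : lmodType C) (I J : choiceType) (A : I -> set M)
    (s : J -> I) (s' : I -> J) : cancel s s' -> cancel s' s ->
  direct_sum A -> direct_sum (fun j => A (s j)).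
Proof.
move=> sK s'K dA; apply: direct_sum_intro.
- by move=> j; exact: ds_subspace dA (s j).
- move=> x; apply: (ds_ind dA (P := in_span (fun j => A (s j)))) => {x}.
  + by move=> i x Ax; apply: (in_span_mem (i := s' i)); rewrite s'K.
  + exact: in_span0.
  + by move=> x y; exact: in_spanD.
- move=> f [f1 f2 f3] j.
  have dec : decomposition A 0 (fun i => f (s' i)).
    have [r [ur hr]] := (fin_suppP _).1 f2.
    have hr' i : i \notin map s r -> f (s' i) = 0.
      by move=> hi; apply: hr; apply: contra hi => h; apply/mapP; exists (s' i).
    split.
    + by move=> i; rewrite -{1}(s'K i); exact: f1.
    + apply/fin_suppP; exists (map s r); split => //.
      by rewrite map_inj_uniq //; exact: can_inj sK.
    + rewrite (fsum_seq _ hr') ?map_inj_uniq //; last exact: can_inj sK.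
      rewrite {1}f3 big_map (fsum_seq ur hr); apply: eq_bigr => k _.
      by rewrite sK.
  have := component_uniq dA dec (s j); rewrite sK => <-.
  exact: lin0 (component_linear dA _).
Qed.

Lemma direct_sum_opp (M : lmodType C) (A : C -> set M) :
  direct_sum A -> direct_sum (fun a => A (- a)).
Proof. exact: (direct_sum_reindex (s := fun a => - a) (s' := fun a => - a) (@opprK _) (@opprK _)). Qed.

(** On eigenvalue a the twisted operator involves only the powers x^(a - j - 1) with j integral;
    every argument about a coefficient begins with this alternative. *)
Lemma int_or_not (a b : C) : (exists j : int, b = a - j%:~R - 1) \/ (forall j : int, b <> a - j%:~R - 1).
Proof.
have [h|h] := pselect (exists j : int, b = a - j%:~R - 1); [by left|right => j hj].
by apply: h; exists j.
Qed.

Lemma sum_shrink (V : nmodType) (F : nat -> V) n B : (n <= B)%N -> (forall i, (n <= i)%N -> F i = 0) ->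
  \sum_(i < B) F i = \sum_(i < n) F i.
Proof.
move=> nB h; rewrite -(fsum_nat h) (@fsum_nat _ _ B) // => i Bi.
by apply: h; exact: leq_trans Bi.
Qed.

Lemma sum5 (V : nmodType) (B1 K1 B2 K2 Q : nat)
  (H : nat -> nat -> nat -> nat -> nat -> V) :
  \sum_(r < B2) \sum_(p < B1) \sum_(q < Q) \sum_(k1 < K1) \sum_(k2 < K2) H p k1 r k2 q =
  \sum_(x1 : 'I_B1 * 'I_K1) \sum_(x2 : 'I_B2 * 'I_K2) \sum_(q < Q) H x1.1 x1.2 x2.1 x2.2 q.
Proof.
rewrite -(pair_bigA _ (fun (p : 'I_B1) (k1 : 'I_K1) =>
  \sum_(x2 : 'I_B2 * 'I_K2) \sum_(q < Q) H p k1 x2.1 x2.2 q)) /=.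
rewrite exchange_big /=; apply: eq_bigr => p _.
under eq_bigr do rewrite exchange_big /=.
rewrite exchange_big /=; apply: eq_bigr => k1 _.
rewrite -(pair_bigA _ (fun (r : 'I_B2) (k2 : 'I_K2) => \sum_(q < Q) H p k1 r k2 q)) /=.
by apply: eq_bigr => r _; rewrite exchange_big.
Qed.

Lemma exp_shift (b1 b2 l1 l2 z1 z2 : C) (i : int) : z1 != 0 -> z2 != 0 ->
  cexp l1 = z1 -> cexp l2 = z2 ->
  cexp ((b1 - i%:~R) * l1) * cexp ((b2 + i%:~R) * l2) = cexp (b1 * l1) * cexp (b2 * l2) * (z2 / z1) ^ i.
Proof.
move=> z10 z20 e1 e2; rewrite mulrBl mulrDl (cexpD (b1 * l1)) (cexpD (b2 * l2)) cexpN !cexpMz e1 e2.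
by rewrite expz_div invr_expz; ring.
Qed.

Lemma cexp_shift_int (b l z : C) (m : int) : cexp l = z ->
  cexp ((b + m%:~R) * l) = cexp (b * l) * z ^ m.
Proof. by move=> <-; rewrite mulrDl cexpD cexpMz. Qed.

End Auxiliary.

(* The element u of this record is the negative of the u of the theorem: the
   operator Y u 0 has eigenvalue - a in degree a. *)
Record twist_setup (R : realType) (V : lmodType R[i]) (Vn : int -> set V)
    (Y : V -> int -> V -> V) (vac omega u : V) (mu : R[i]) (W : lmodType R[i])
    (Wm : R[i] -> R[i] -> set W) (YW : V -> int -> W -> W) : Prop := {
  ts_voa : is_voa Vn Y vac omega;
  ts_neg : forall n : int, n < 0 -> Vn n `<=` [set 0];
  ts_u1 : Vn 1 u;
  ts_L1u : Y omega 2 u = 0;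
  ts_mu : Y u 1 u = mu *: vac;
  ts_module : strongly_C_graded_module Y vac omega
    (fun a => gen_eigenspace (Y u 0) (- a)) Wm YW;
  ts_degree : forall a, degree_space Wm a = gen_eigenspace (YW u 0) (- a);
  ts_lower : real_lower_bounded Wm
}.

(** * Gradings and coefficients of the modified operator *)

Section Twist.
Variables (R : realType).
Local Notation C := R[i].
Variables (V : lmodType C) (Vn : int -> set V) (Y : V -> int -> V -> V)
  (vac omega u : V) (mu : C)
  (W : lmodType C) (Wm : C -> C -> set W) (YW : V -> int -> W -> W).
Hypothesis hS : twist_setup Vn Y vac omega u mu Wm YW.

Local Notation T := (Y u 0).
Local Notation genT := (gen_eigenspace T).
Local Notation N := (nilp T).
Local Notation D := (Delta_exp Y u).
Local Notation TW := (YW u 0).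
Local Notation LW := (YW omega 1).

Let voa := ts_voa hS.
Let Vneg := ts_neg hS.
Let u1 := ts_u1 hS.
Let L1u := ts_L1u hS.
Let muE := ts_mu hS.
Let wmod := ts_module hS.
Let bil := voa_bilinear voa.
Let jac := voa_jacobi voa.
Let der := voa_derivative voa.
Let dV := voa_graded voa.
Let linr v n : linear (Y v n) := modes_linr bil v n.
Let linl n w : linear (fun v => Y v n w) := modes_linl bil n w.
Let bilW := gm_bilinear wmod.
Let jacW := gm_jacobi wmod.
Let derW := gm_derivative wmod.
Let dW := gm_graded wmod.
Let wlinr v n : linear (YW v n) := modes_linr bilW v n.
Let wlinl n w : linear (fun v => YW v n w) := modes_linl bilW n w.
Let lT : linear T := linr u 0.
Let dT : direct_sum genT := T_direct_sum voa u1.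
Let Tder n x y : T (Y x n y) = Y (T x) n y + Y x n (T y) := T_derivation u voa n x y.

Definition hom (m : int) (a : C) (v : V) := Vn m v /\ genT a v.

Lemma hom_subspace m a : subspace (hom m a).
Proof.
have s1 := ds_subspace dV m; have s2 := gen_subspace lT a.
split; first by split; exact: subspace0.
by move=> c x y [x1 x2] [y1 y2]; split; [exact: s1.2|exact: s2.2].
Qed.

(** L(0) commutes with T because u has weight 1, hence with the projections to the eigenspaces of
    T. *)
Lemma Vn_component m a x : Vn m x -> Vn m (component genT a x).
Proof.
move=> hx; apply: (Vn_eigen voa).
have LT y : Y omega 1 (T y) = T (Y omega 1 y).
  rewrite (L0_commutator jac der) (L0E voa u1) scale1r.
  by rewrite (_ : (0 + 1)%:~R = 1) // scale1r addrK.
rewrite -(component_comm a x dT (linr omega 1)).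
  by rewrite (L0E voa hx) (linZ (component_linear dT a)).
move=> b y hy; rewrite -[b]addr0; apply: (gen_shift (S := T)) hy => //.
by move=> z; rewrite LT scale0r addr0.
Qed.

Lemma gen_component m a x : genT a x -> genT a (component Vn m x).
Proof.
move=> [k hk]; exists k.
have lTa : linear (fun y => T y - a *: y) by apply: lin_sub => //; exact: lin_scaler.
rewrite -(component_comm m x dV (lin_iter k lTa)); first by rewrite hk (lin0 (component_linear dV m)).
move=> n y hy; elim: k {hk} => //= k IH.
have sV := ds_subspace dV n.
by apply: (subspaceB sV); [exact: (T_Vn voa u1)|exact: subspaceZ].
Qed.

Lemma Vn_ind m (P : V -> Prop) : (forall a x, hom m a x -> P x) -> P 0 ->
  (forall x y, P x -> P y -> P (x + y)) -> forall x, Vn m x -> P x.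
Proof.
move=> h h0 hD x hx; rewrite (component_sum dT x).
have [r [ur hr]] := (fin_suppP _).1 (component_fin dT x).
rewrite (fsum_seq ur hr).
elim/big_rec: _ => // i y _ Py; apply: hD => //; apply: (h i); split.
  exact: Vn_component.
exact: (component_mem dT i x).
Qed.

Lemma gen_ind a (P : V -> Prop) : (forall m x, hom m a x -> P x) -> P 0 ->
  (forall x y, P x -> P y -> P (x + y)) -> forall x, genT a x -> P x.
Proof.
move=> h h0 hD x hx; rewrite (component_sum dV x).
have [r [ur hr]] := (fin_suppP _).1 (component_fin dV x).
rewrite (fsum_seq ur hr).
elim/big_rec: _ => // i y _ Py; apply: hD => //; apply: (h i); split.
  exact: (component_mem dV i x).
exact: gen_component.
Qed.

Lemma hom_ind (P : V -> Prop) : (forall m a x, hom m a x -> P x) -> P 0 ->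
  (forall x y, P x -> P y -> P (x + y)) -> forall x, P x.
Proof.
move=> h h0 hD; apply: (ds_ind dV) => // m x; apply: Vn_ind => // a y.
exact: h.
Qed.

Lemma ker_gen x : T x = 0 -> genT 0 x.
Proof. by move=> Tx; exists 1%N; rewrite /= scale0r subr0. Qed.

Lemma T_vac : T vac = 0. Proof. exact: (mode_vac voa). Qed.
Lemma T_omega : T omega = 0. Proof. exact: un_omega voa Vneg u1 L1u 0. Qed.

Lemma hom_vac : hom 0 0 vac.
Proof. by split; [exact: voa_vac voa|exact: ker_gen T_vac]. Qed.
Lemma hom_omega : hom 2 0 omega.
Proof. by split; [exact: voa_omega voa|exact: ker_gen T_omega]. Qed.

Lemma nilp_ker x : T x = 0 -> N x = 0.
Proof. by move=> Tx; rewrite (nilp_gen dT (ker_gen Tx)) Tx scale0r subr0. Qed.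

Lemma hom_D m a M v : hom m a v -> hom (m - M%:Z) a (D M v).
Proof.
move=> [h1 h2]; split; first exact: (D_Vn voa Vneg u1 muE).
rewrite -[a]addr0; apply: (gen_shift (S := T)) h2; first exact: (D_linear u voa).
by move=> z; rewrite (D_T voa Vneg u1 muE) scale0r addr0.
Qed.

Lemma hom_N m a v : hom m a v -> hom m a (N v).
Proof.
move=> [h1 h2]; split; last exact: gen_nilp.
rewrite (nilp_gen dT h2); have sV := ds_subspace dV m.
by apply: (subspaceB sV); [exact: (T_Vn voa u1)|exact: subspaceZ].
Qed.

Lemma hom_iterN m a k v : hom m a v -> hom m a (iter k N v).
Proof. by move=> h; elim: k => //= k; exact: hom_N. Qed.

Lemma hom_Y m a n b j v w : hom m a v -> hom n b w -> hom (m + n - j - 1) (a + b) (Y v j w).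
Proof.
move=> [v1 v2] [w1 w2]; split; first exact: (mode_weight voa).
exact: (gen_bilinear lT (linl j) (linr^~ j) (Tder j)).
Qed.

Lemma hom_nexp m a c v : hom m a v -> hom m a (nexp T c v).
Proof.
move=> h; apply: subspace_fsum; first exact: hom_subspace.
by move=> k; apply: (subspaceZ _ (hom_subspace m a)); exact: hom_iterN.
Qed.

Lemma hom_neg m a v : hom m a v -> m < 0 -> v = 0.
Proof. by move=> [h _] m0; exact: (Vneg m0 h). Qed.

(** D_M lowers the weight by M and there are no negative weights. *)
Lemma D_trunc v : exists K, forall M, (K <= M)%N -> D M v = 0.
Proof.
apply: (hom_ind (P := fun v => exists K, forall M, (K <= M)%N -> D M v = 0)) => {v}.
- move=> m a v h; exists (`|m|%N).+1 => M hM; apply: (hom_neg (hom_D M h)); lia.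
- by exists 0%N => M _; rewrite (lin0 (D_linear u voa M)).
- move=> x y [K hK] [L hL]; exists (maxn K L) => M; rewrite geq_max => /andP[a b].
  by rewrite (linD (D_linear u voa M)) hK // hL // addr0.
Qed.

Lemma hom_D0 m a v M : hom m a v -> m < M%:Z -> D M v = 0.
Proof. move=> h mM; apply: (hom_neg (hom_D M h)); lia. Qed.

Local Notation Dl := (Delta Y u).

Definition Dterm (b : C) k (M : nat) v :=
  component genT (b + M%:R) ((k`!%:R)^-1 *: iter k N (D M v)).

Lemma DeltaE v b k : Dl v b k = \sum_(M \in [set: nat]) Dterm b k M v.
Proof. by []. Qed.

Lemma Dterm_linear b k M : linear (Dterm b k M).
Proof.
apply: lin_comp; first exact: component_linear.
apply: lin_scale; apply: lin_comp; first exact: lin_iter (nilp_linear lT dT).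
exact: (D_linear u voa).
Qed.

Lemma Dterm0 b k M v : D M v = 0 -> Dterm b k M v = 0.
Proof.
move=> h; rewrite /Dterm h (lin0 (lin_iter k (nilp_linear lT dT))) scaler0.
exact: lin0 (component_linear dT _).
Qed.

Lemma Dterm_fin b k v : finite_set [set M | Dterm b k M v != 0].
Proof.
have [K hK] := D_trunc v; apply/fin_suppP; exists (iota 0 K).
rewrite iota_uniq; split => // M; rewrite mem_iota /= -leqNgt => /hK.
exact: Dterm0.
Qed.

Lemma Delta_linear b k : linear (fun v => Dl v b k).
Proof.
apply: (lin_fsums (F := Dterm b k)) => [M|v]; [exact: Dterm_linear|exact: Dterm_fin].
Qed.

Lemma Delta_hom m a v : hom m a v -> forall b k, (forall M : nat, b + M%:R <> a) -> Dl v b k = 0.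
Proof.
move=> h b k hb; rewrite DeltaE; apply: fsum_eq0 => M; rewrite /Dterm.
rewrite (linZ (component_linear dT _)) (component_other dT (hom_iterN k (hom_D M h)).2) ?scaler0 //.
by apply/eqP/hb.
Qed.

Lemma Delta_hom_eq m a v (M : nat) k : hom m a v ->
  Dl v (a - M%:R) k = (k`!%:R)^-1 *: iter k N (D M v).
Proof.
move=> h; rewrite DeltaE (@fsum_single _ _ _ M).
  rewrite /Dterm subrK (linZ (component_linear dT _)).
  by rewrite (component_self dT (hom_iterN k (hom_D M h)).2).
move=> M' ne; rewrite /Dterm (linZ (component_linear dT _)).
rewrite (component_other dT (hom_iterN k (hom_D M' h)).2) ?scaler0 //.
rewrite -subr_eq0 addrAC [X in X + _]addrAC subrr add0r addrC subr_eq0.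
by rewrite eqr_nat.
Qed.

Lemma Delta_fin v k : finite_set [set b | Dl v b k != 0].
Proof.
apply: (hom_ind (P := fun v => finite_set [set b | Dl v b k != 0])) => {v}.
- move=> m a v h; apply/fin_suppP.
  exists (undup [seq a - M%:R | M <- iota 0 (`|m|%N).+1]); split; first exact: undup_uniq.
  move=> b; rewrite mem_undup => hb; apply: contrapT => /eqP nz; move/negP: hb; apply.
  have [M hM] : exists M : nat, b + M%:R = a.
    by apply: contrapT => hn; move/eqP: nz; apply; apply: (Delta_hom h) => M hM; apply: hn; exists M.
  have bE : b = a - M%:R by rewrite -hM addrK.
  apply/mapP; exists M => //; rewrite mem_iota /= add0n ltnNge; apply/negP => mM.
  move/eqP: nz; apply; rewrite bE (Delta_hom_eq _ _ h) (hom_D0 h) ?(lin0 (lin_iter _ (nilp_linear lT dT))) ?scaler0 //.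
  lia.
- by apply/fin_suppP; exists [::]; split => // b _; rewrite (lin0 (Delta_linear b k)).
- move=> x y hx hy; have := fin_suppD hx hy.
  by apply: sub_finite_set => b /=; rewrite (linD (Delta_linear b k)).
Qed.

Local Notation Yg := (Delta_modified Y u YW).

Lemma Yg_fin v w a k : finite_set [set n : int | YW (Dl v (a + (n + 1)%:~R) k) n w != 0].
Proof.
have inj : set_inj ((fun n : int => a + (n + 1)%:~R) @^-1` [set b | Dl v b k != 0])
    (fun n : int => a + (n + 1)%:~R).
  by move=> m n _ _ /addrI/eqP; rewrite eqr_int => /eqP/addIr.
apply: sub_finite_set (finite_preimage inj (Delta_fin v k)) => n /=.
by apply: contraNN => /eqP ->; rewrite (lin0 (wlinl _ _)).
Qed.

Lemma Yg_linear_l w a k : linear (fun v => Yg v w a k).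
Proof.
apply: (lin_fsums (F := fun n v => YW (Dl v (a + (n + 1)%:~R) k) n w)) => [n|v].
  exact: lin_comp (wlinl n w) (Delta_linear _ k).
exact: Yg_fin.
Qed.

Lemma Yg_linear_r v a k : linear (fun w => Yg v w a k).
Proof.
apply: (lin_fsums (F := fun n w => YW (Dl v (a + (n + 1)%:~R) k) n w)) => [n|w].
  exact: wlinr.
exact: Yg_fin.
Qed.

Lemma Yg_hom0 m a v w b k : hom m a v -> (forall j : int, b <> a - j%:~R - 1) ->
  Yg v w b k = 0.
Proof.
move=> h hb; apply: fsum_eq0 => n; rewrite (Delta_hom h) ?(lin0 (wlinl _ _)) // => M hM.
apply: (hb (n + M%:Z)); rewrite -hM rmorphD rmorphD /= -[M%:~R]/(M%:R); ring.
Qed.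

(** D_M v comes with x^(a - M), and the mode j - M with x^(- j + M - 1); the product is x^(a - j -
    1) for every M. *)
Lemma Yg_hom m a v w (j : int) k B : hom m a v ->
  (forall M, (B <= M)%N -> D M v = 0) ->
  Yg v w (a - j%:~R - 1) k =
  \sum_(M < B) YW ((k`!%:R)^-1 *: iter k N (D M v)) (j - M%:Z) w.
Proof.
move=> h hB; rewrite /Delta_modified.
have injf : injective (fun M : nat => j - M%:Z) by move=> x y; lia.
rewrite (@fsum_seq _ _ _ [seq j - M%:Z | M <- iota 0 B]); last first.
- move=> n hn.
  have [jn|jn] := leP n j; last first.
    rewrite (Delta_hom h) ?(lin0 (wlinl _ _)) // => M hM.
    have : (n - j + M%:Z)%:~R = 0 :> C.
      have -> : (n - j + M%:Z)%:~R = (a - j%:~R - 1 + (n + 1)%:~R + M%:R) - a :> C.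
        by rewrite !rmorphD rmorphN /= -[M%:~R]/(M%:R); ring.
      by rewrite hM subrr.
    by move=> /eqP; rewrite intr_eq0 => /eqP; lia.
  have -> : a - j%:~R - 1 + (n + 1)%:~R = a - `|j - n|%N%:R.
    rewrite natr_absz ger0_norm; last by lia.
    by rewrite !rmorphD !rmorphN /=; ring.
  rewrite (Delta_hom_eq _ _ h) hB ?(lin0 (lin_iter _ (nilp_linear lT dT))) ?scaler0 ?(lin0 (wlinl _ _)) //.
  rewrite leqNgt; apply: contra hn => jB; apply/mapP; exists `|j - n|%N; last by lia.
  by rewrite mem_iota.
- by rewrite map_inj_uniq ?iota_uniq.
rewrite big_map -{1}(subn0 B) -/(index_iota 0 B) big_mkord; apply: eq_bigr => M _.
have -> : a - j%:~R - 1 + (j - M%:Z + 1)%:~R = a - M%:R.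
  by rewrite !rmorphD rmorphN /= -[M%:~R]/(M%:R); ring.
by rewrite (Delta_hom_eq _ _ h).
Qed.

Lemma D1_omega : D 1 omega = u.
Proof.
have := D_rec voa Vneg u1 muE 1 omega.
rewrite scale1r big_ord_recl big_ord1 /= /csgn /= scale0r add0r subnn D0.
by rewrite (un_omega voa Vneg u1 L1u 1) /= sqrrN expr1n scale1r.
Qed.

Lemma D2_omega : D 2 omega = (mu / 2) *: vac.
Proof.
have := D_rec voa Vneg u1 muE 2 omega.
rewrite !big_ord_recl big_ord0 /= /csgn /= /bump /= scale0r add0r addr0 subnn D0.
rewrite (un_omega voa Vneg u1 L1u 2) /= scaler0 addr0 -/(D 1 omega) D1_omega muE.
rewrite sqrrN expr1n scale1r => h; apply: (@scaleS_inj R _ 1); rewrite h scalerA; congr (_ *: _).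
by field.
Qed.

Lemma Dge3_omega M : (3 <= M)%N -> D M omega = 0.
Proof. by move=> h; apply: (hom_D0 (hom_omega)); lia. Qed.

Definition LWu w := Yg omega w (- 2) 0.

Lemma LWuE w : LWu w = LW w + TW w + (mu / 2) *: w.
Proof.
have := Yg_hom w 1 0 (hom_omega) Dge3_omega.
rewrite fact0 invr1 !big_ord_recr big_ord0 /= add0r !scale1r D0 D1_omega D2_omega.
rewrite (linZ (wlinl _ _)) (gm_identity wmod) subr0 subrr /= add0r => h.
have e : (- 2 : C) = - 1%:~R - 1 by ring.
by rewrite /LWu e.
Qed.

Lemma LW_TW w : LW (TW w) = TW (LW w).
Proof.
by rewrite (L0_commutator jacW derW) (L0E voa u1) add0r !scale1r addrK.
Qed.

Lemma TW_LWu w : LWu (TW w) = TW (LWu w).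
Proof. by rewrite !LWuE !(linD (wlinr _ _)) (linZ (wlinr _ _)) LW_TW. Qed.

Lemma LWu_linear : linear LWu.
Proof. exact: (Yg_linear_r). Qed.

Definition Wt (n a : C) := gen_eigenspace LWu n `&` gen_eigenspace TW (- a).

Lemma gm_weightE n : weight_space Wm n = gen_eigenspace LW n.
Proof. exact: (gm_weight wmod n). Qed.

(** [LWu] is [LW] plus the commuting operator [TW] plus mu / 2, so [gen_add] moves generalized
    eigenvalues between them in both directions; [TW] has eigenvalue - a here. *)
Lemma WtE n a : Wt n a = Wm (n + a - mu / 2) a.
Proof.
have lTW := wlinr u 0; have lLW := wlinr omega 1.
apply/seteqP; split => w.
- move=> [h1 h2]; apply/(dg_mem dW); split; last by rewrite (ts_degree hS).
  rewrite gm_weightE.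
  have h3 : gen_eigenspace (fun y => - TW y) a w.
    by rewrite -[a]opprK; apply/(gen_opp (S := TW)).
  have h4 := gen_add LWu_linear (lin_scale (-1) lTW) _ h1.
  have {h4} := h4 a; have -> : (fun x => -1 *: TW x) = (fun y => - TW y).
    by apply/funext => y; rewrite scaleN1r.
  move=> h; have {}h := h (fun y => _) h3.
  apply: gen_id_shift (h _) => y.
    by rewrite LWuE scaleN1r scaleNr (addrAC (LW y + TW y)) !addrK.
  by rewrite (linZ LWu_linear) TW_LWu.
- move=> /(dg_mem dW) [h1 h2]; rewrite (ts_degree hS) in h2; split => //.
  rewrite gm_weightE in h1.
  have h := gen_id_shift _ (gen_add lLW lTW LW_TW h1 h2).
  have := h LWu (mu / 2) LWuE.
  by rewrite (_ : n + a - mu / 2 - a + mu / 2 = n) //; ring.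
Qed.

Lemma Wt_graded : doubly_graded Wt.
Proof.
have h : (fun i : C * C => Wt i.1 i.2) = (fun i => Wm (i.1 + i.2 - mu / 2) i.2).
  by apply/funext => i; exact: WtE.
rewrite /doubly_graded h.
apply: (direct_sum_reindex (A := fun i : C * C => Wm i.1 i.2)
  (s := fun i => (i.1 + i.2 - mu / 2, i.2))
  (s' := fun i => (i.1 - i.2 + mu / 2, i.2))) dW.
- by move=> [a b] /=; congr (_, _); ring.
- by move=> [a b] /=; congr (_, _); ring.
Qed.

Local Notation WS := (weight_space Wt).
Let gW : doubly_graded Wt := Wt_graded.
Let dS : direct_sum WS := weight_direct_sum gW.

(** Besides the usual shift m - j - 1 of [LW], the weight gains a, the amount by which v shifts
    [TW]. *)
Lemma YW_Wt m a v n b w j : hom m a v -> Wt n b w ->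
  Wt (n + (m%:~R + a - j%:~R - 1)) (b - a) (YW v j w).
Proof.
move=> [v1 v2]; rewrite !WtE => /(dg_mem dW) [w1 w2]; apply/(dg_mem dW); split; last first.
  rewrite addrC; apply: (gm_degree wmod) w2.
  by rewrite /= opprK.
move: w1; rewrite !gm_weightE => w1.
have -> : n + (m%:~R + a - j%:~R - 1) + (b - a) - mu / 2 =
   (n + b - mu / 2) + (m - j - 1)%:~R :> C.
  by rewrite !rmorphB /=; ring.
apply: (gen_shift (S := LW)) w1 => // y.
rewrite (L0_commutator jacW derW) (L0E voa v1) (linZ (wlinl _ _)) -addrA -scalerBl.
by congr (_ + _ *: _); rewrite !rmorphB rmorphD /=; ring.
Qed.

Lemma Wt_WS n b w : Wt n b w -> WS n w.
Proof. exact: (weight_in Wt_graded). Qed.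

Lemma WS_ind n (P : W -> Prop) : (forall b x, Wt n b x -> P x) -> P 0 ->
  (forall x y, P x -> P y -> P (x + y)) -> forall x, WS n x -> P x.
Proof. exact: sum_of_ind. Qed.

Lemma YW_WS m a v n w j : hom m a v -> WS n w ->
  WS (n + (m%:~R + a - j%:~R - 1)) (YW v j w).
Proof.
move=> hv; apply: (WS_ind (P := fun w => WS _ (YW v j w))) => {w}.
- by move=> b x hx; exact: Wt_WS (YW_Wt j hv hx).
- by rewrite (lin0 (wlinr _ _)); exact: (subspace0 (weight_subspace Wt_graded _)).
- by move=> x y hx hy; rewrite (linD (wlinr _ _)); exact: (subspaceD (weight_subspace Wt_graded _)).
Qed.

Lemma Yg_WS m a v n w j k : hom m a v -> WS n w ->
  WS (n + (m%:~R + a - j%:~R - 1)) (Yg v w (a - j%:~R - 1) k).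
Proof.
move=> hv hw; have [B hB] := D_trunc v; rewrite (Yg_hom w j k hv hB).
apply: subspace_sum => [|M _]; first exact: (weight_subspace Wt_graded).
rewrite (linZ (wlinl _ _)); apply: (subspaceZ _ (weight_subspace Wt_graded _)).
have := YW_WS (j - M%:Z) (hom_iterN k (hom_D M hv)) hw.
by congr (WS (_ + _) _); rewrite !rmorphB /= -[M%:~R]/(M%:R); ring.
Qed.

Lemma Yg_Wt m a v n b w j k : hom m a v -> Wt n b w ->
  Wt (n + (m%:~R + a - j%:~R - 1)) (b - a) (Yg v w (a - j%:~R - 1) k).
Proof.
move=> hv hw; have [B hB] := D_trunc v; rewrite (Yg_hom w j k hv hB).
have sW := dg_subspace Wt_graded.
apply: subspace_sum => [|M _]; first exact: sW.
rewrite (linZ (wlinl _ _)); apply: (subspaceZ _ (sW _ _)).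
have := YW_Wt (j - M%:Z) (hom_iterN k (hom_D M hv)) hw.
by congr (Wt (_ + _) _ _); rewrite !rmorphB /= -[M%:~R]/(M%:R); ring.
Qed.

Lemma twist_weight (m : int) n v w a k : Vn m v -> WS n w ->
  WS (m%:~R + n + a) (Yg v w a k).
Proof.
move=> hv hw; apply: (Vn_ind (m := m) (P := fun v => WS _ (Yg v w a k))) hv => {v}.
- move=> al v hv; have [[j ->]|h] := int_or_not al a.
    by have := Yg_WS j k hv hw; congr (WS _ _); ring.
  by rewrite (Yg_hom0 w k hv h); exact: (subspace0 (weight_subspace Wt_graded _)).
- by rewrite (lin0 (Yg_linear_l w a k)); exact: (subspace0 (weight_subspace Wt_graded _)).
- by move=> x y hx hy; rewrite (linD (Yg_linear_l w a k)); exact: (subspaceD (weight_subspace Wt_graded _)).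
Qed.

Lemma twist_degree al be v w a k : genT (- al) v -> degree_space Wt be w ->
  degree_space Wt (al + be) (Yg v w a k).
Proof.
move=> hv hw; have sD := degree_subspace Wt_graded (al + be).
apply: (gen_ind (a := - al) (P := fun v => degree_space Wt _ (Yg v w a k))) hv => {v}.
- move=> m v hv; apply: (sum_of_ind (P := fun w => degree_space Wt _ (Yg v w a k))) hw => {w}.
  + move=> n w hw; have [[j ->]|h] := int_or_not (- al) a.
      have /(degree_in Wt_graded) := Yg_Wt j k hv hw.
      by rewrite opprK addrC.
    by rewrite (Yg_hom0 w k hv h); exact: subspace0.
  + by rewrite (lin0 (Yg_linear_r v a k)); exact: subspace0.
  + by move=> x y hx hy; rewrite (linD (Yg_linear_r v a k)); exact: subspaceD.
- by rewrite (lin0 (Yg_linear_l w a k)); exact: subspace0.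
- by move=> x y hx hy; rewrite (linD (Yg_linear_l w a k)); exact: subspaceD.
Qed.

Let lN : linear N := nilp_linear lT dT.

(** One K serves for all M, since only finitely many D_M v are nonzero. *)
Lemma DN_bound v : exists B K : nat, (forall M, (B <= M)%N -> D M v = 0) /\
  (forall M k, (K <= k)%N -> iter k N (D M v) = 0).
Proof.
have [B hB] := D_trunc v; exists B.
have [K hK] : exists K, forall M k, (M < B)%N -> (K <= k)%N -> iter k N (D M v) = 0.
  elim: B {hB} => [|B [K hK]]; first by exists 0%N.
  have [L hL] := nilp_locnil lT dT (D B v).
  exists (maxn K L) => M k; rewrite ltnS leq_eqVlt geq_max => /orP[/eqP ->|MB] /andP[h1 h2].
    exact: hL.
  exact: hK.
exists K; split => // M k hk; have [MB|MB] := ltnP M B; first exact: hK.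
by rewrite hB // (lin0 (lin_iter k lN)).
Qed.

Lemma twist_log v w : exists K : nat, forall a k, (K <= k)%N -> Yg v w a k = 0.
Proof.
apply: (hom_ind (P := fun v => exists K : nat, forall a k, (K <= k)%N -> Yg v w a k = 0)) => {v}.
- move=> m a v hv; have [B [K [hB hK]]] := DN_bound v.
  exists K => b k kK; have [[j ->]|h] := int_or_not a b; last exact: (Yg_hom0 w k hv h).
  rewrite (Yg_hom w j k hv hB) big1 // => M _.
  by rewrite hK // scaler0 (lin0 (wlinl _ _)).
- by exists 0%N => a k _; rewrite (lin0 (Yg_linear_l w a k)).
- move=> x y [K hK] [L hL]; exists (maxn K L) => a k; rewrite geq_max => /andP[h1 h2].
  by rewrite (linD (Yg_linear_l w a k)) hK // hL // addr0.
Qed.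

Lemma D_vac M : D M vac = if M == 0%N then vac else 0.
Proof.
case: M => [|M]; first exact: D0.
by apply: (hom_D0 (hom_vac)); lia.
Qed.

Lemma iterN_ker k x : T x = 0 -> iter k N x = if k == 0%N then x else 0.
Proof.
case: k => // k Tx; elim: k => [|k /= ->]; first exact: (nilp_ker Tx).
exact: lin0 (nilp_linear lT dT).
Qed.

Lemma twist_identity w a k :
  Yg vac w a k = if (a == 0) && (k == 0%N) then w else 0.
Proof.
have [[j ->]|h] := int_or_not 0 a; last first.
  rewrite (Yg_hom0 w k (hom_vac) h); case: eqP => //= a0.
  by case: (h (-1)); rewrite a0; ring.
rewrite (@Yg_hom _ _ _ w j k 1 (hom_vac)); last first.
  by move=> M M0; rewrite D_vac gtn_eqF.
rewrite big_ord1 D0 (iterN_ker k (T_vac)) (linZ (wlinl _ _)).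
case: eqP => [->|_]; last by rewrite (lin0 (wlinl _ _)) scaler0 andbF.
rewrite fact0 invr1 scale1r (gm_identity wmod) andbT subr0.
have -> : (0 - j%:~R - 1 == 0 :> C) = (j == -1); last by [].
have -> : (0 - j%:~R - 1) = (- j - 1)%:~R :> C by rewrite rmorphB rmorphN sub0r.
by rewrite intr_eq0; lia.
Qed.

Lemma T_Domega M : T (D M omega) = 0.
Proof.
rewrite (un_D_comm voa Vneg u1 muE 0) (T_omega).
exact: lin0 (D_linear u voa M).
Qed.

Lemma twist_omega w a k : Yg omega w a k != 0 -> k = 0%N /\ exists n : int, a = n%:~R.
Proof.
move=> nz; have [[j aE]|h] := int_or_not 0 a; last first.
  by rewrite (Yg_hom0 w k (hom_omega) h) eqxx in nz.
split; last by exists (- j - 1); rewrite aE rmorphB rmorphN sub0r.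
apply: contraNeq nz => k0; rewrite aE (Yg_hom w j k (hom_omega) Dge3_omega) big1 // => M _.
by rewrite (iterN_ker _ (T_Domega M)) (negbTE k0) scaler0 (lin0 (wlinl _ _)).
Qed.

Lemma nilp_comm (A : V -> V) x : linear A -> (forall y, T (A y) = A (T y)) -> N (A x) = A (N x).
Proof.
move=> lA hA.
apply: (ds_ind dT (P := fun x => N (A x) = A (N x))) => {x}.
- move=> a x gx.
  have g0 : genT a (A x).
    rewrite -[a]addr0; apply: (gen_shift (S := T)) gx => // y.
    by rewrite hA scale0r addr0.
  by rewrite (nilp_gen dT gx) (nilp_gen dT g0) hA (linB lA) (linZ lA).
- by rewrite (lin0 lA) (lin0 (nilp_linear lT dT)) (lin0 lA).
- by move=> x y hx hy; rewrite (linD lA) !(linD (nilp_linear lT dT)) (linD lA) hx hy.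
Qed.

Lemma nexp_comm (A : V -> V) c x : linear A -> (forall y, T (A y) = A (T y)) ->
  nexp T c (A x) = A (nexp T c x).
Proof.
move=> lA hA; have [K hK] := nilp_locnil lT dT x.
have iN k : iter k N (A x) = A (iter k N x) by elim: k => //= k ->; rewrite nilp_comm.
rewrite (nexpE c hK) (@nexpE _ _ _ _ _ K) ?(lin_sum lA); last by move=> k hk; rewrite iN hK // lin0.
by apply: eq_bigr => k _; rewrite iN (linZ lA).
Qed.

Lemma N_Lm1 x : N (Y omega 0 x) = Y omega 0 (N x).
Proof. by apply: nilp_comm => // y; exact: (T_Lm1 u voa). Qed.

Lemma iterN_Lm1 k x : iter k N (Y omega 0 x) = Y omega 0 (iter k N x).
Proof. by elim: k => //= k ->; rewrite N_Lm1. Qed.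

Lemma hom_Lm1 m a x : hom m a x -> hom (m + 1) a (Y omega 0 x).
Proof.
move=> h; have := hom_Y 0 (hom_omega) h.
by rewrite add0r; congr (hom _ _ _); lia.
Qed.

(** The product rule on coefficients: [D_Lm1] differentiates Delta(x), and the L(-1)-derivative
    property of W differentiates the vertex operator. *)
Lemma twist_derivative v w a k :
  Yg (Y omega 0 v) w a k =
    (a + 1) *: Yg v w (a + 1) k + k.+1%:R *: Yg v w (a + 1) k.+1.
Proof.
apply: (hom_ind (P := fun v => Yg (Y omega 0 v) w a k =
    (a + 1) *: Yg v w (a + 1) k + k.+1%:R *: Yg v w (a + 1) k.+1)) => {v}; last first.
- move=> x y hx hy; rewrite (linD (linr _ _)) !(linD (Yg_linear_l w _ _)) hx hy !scalerDr.
  by rewrite addrACA.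
- by rewrite (lin0 (linr _ _)) !(lin0 (Yg_linear_l w _ _)) !scaler0 addr0.
move=> m al v hv; have [B hB] := D_trunc v.
have hv1 := hom_Lm1 hv.
have [[j aE]|h] := int_or_not al a; last first.
  have h' (j : int) : a + 1 <> al - j%:~R - 1.
    by move=> hj; apply: (h (j + 1)); rewrite rmorphD /= -[a](addrK 1) hj; ring.
  by rewrite (Yg_hom0 w k hv1 h) !(Yg_hom0 w _ hv h') !scaler0 addr0.
have a1E : a + 1 = al - (j - 1)%:~R - 1 by rewrite aE rmorphB /=; ring.
have hB1 M : (B.+1 <= M)%N -> D M (Y omega 0 v) = 0.
  case: M => // M hM; rewrite (D_Lm1 voa Vneg u1 muE) /= !hB //; last by lia.
  by rewrite !(lin0 (linr _ _)) scaler0 subr0 addr0.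
rewrite a1E !(Yg_hom w _ _ hv hB) aE (Yg_hom w j k hv1 hB1).
rewrite !scaler_sumr.
pose X k M l := YW (iter k N (D M v)) l w.
have XE k' M l : YW (k'`!%:R^-1 *: iter k' N (D M v)) l w = k'`!%:R^-1 *: X k' M l.
  by rewrite (linZ (wlinl _ _)).
have Lw x l : YW (Y omega 0 x) l w = - l%:~R *: YW x (l - 1) w by exact: derW.
have E M : YW (k`!%:R^-1 *: iter k N (D M (Y omega 0 v))) (j - M%:Z) w =
   k`!%:R^-1 *: (- (j - M%:Z)%:~R *: X k M (j - M%:Z - 1) +
     (if M is M'.+1 then X k.+1 M' (j - M%:Z) + (al - M'%:R) *: X k M' (j - M%:Z) else 0)).
  rewrite (linZ (wlinl _ _)); congr (_ *: _).
  rewrite (D_Lm1 voa Vneg u1 muE) (linD (lin_iter k (nilp_linear lT dT))) iterN_Lm1.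
  rewrite (linD (wlinl _ _)) Lw; congr (_ + _).
  case: M => [|M]; first by rewrite (lin0 (lin_iter k (nilp_linear lT dT))) (lin0 (wlinl _ _)).
  have -> : T (D M v) = N (D M v) + al *: D M v.
    by rewrite (nilp_gen dT (hom_D M hv).2) subrK.
  rewrite -addrA -scalerBl (linD (lin_iter k (nilp_linear lT dT))) -iterSr.
  rewrite (linZ (lin_iter k (nilp_linear lT dT))) (linD (wlinl _ _)) (linZ (wlinl _ _)).
  by [].
(* The first family loses its vanishing top term and the second is shifted by one in M; then -(j -
   M) + (al - M) = al - j = a + 1 is the coefficient common to all M. *)
under eq_bigr do rewrite E scalerDr.
rewrite big_split /= big_ord_recr /= [X in _ + X + _](_ : _ = 0); last first.
  by rewrite /X hB // (lin0 (lin_iter k (nilp_linear lT dT))) (lin0 (wlinl _ _)) !scaler0.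
rewrite addr0 [X in _ + X]big_ord_recl /= scaler0 add0r -!big_split /=.
apply: eq_bigr => M _; rewrite !XE /bump /= add1n.
have -> : j - Posz M.+1 = j - 1 - M%:Z by lia.
have -> : j - M%:Z - 1 = j - 1 - M%:Z by lia.
rewrite scalerDr addrCA addrC !scalerA add0n; congr (_ + _).
  rewrite -scalerDl; congr (_ *: _); rewrite -mulrDr mulrC; congr (_ * _).
  by rewrite !rmorphB /= -[M%:~R]/(M%:R); ring.
congr (_ *: _); rewrite factS natrM invfM mulrA divff ?mul1r // natS_neq0.
Qed.


(** * Analytic branches and equivariance *)

Definition tm (l : C) (v : V) (j : int) (w : W) :=
  \sum_(M \in [set: nat]) YW (nexp T l (D M v)) (j - M%:Z) w.

Lemma tmE l v j w B : (forall M, (B <= M)%N -> D M v = 0) ->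
  tm l v j w = \sum_(M < B) YW (nexp T l (D M v)) (j - M%:Z) w.
Proof.
move=> hB; apply: fsum_nat => M /hB ->.
by rewrite (lin0 (nexp_linear lT dT l)) (lin0 (wlinl _ _)).
Qed.

Lemma tm_fin l v j w : finite_set [set M : nat | YW (nexp T l (D M v)) (j - M%:Z) w != 0].
Proof.
have [B hB] := D_trunc v; apply/fin_suppP; exists (iota 0 B).
rewrite iota_uniq; split => // M; rewrite mem_iota /= -leqNgt => /hB ->.
by rewrite (lin0 (nexp_linear lT dT l)) (lin0 (wlinl _ _)).
Qed.

Lemma tm_linear_r l v j : linear (tm l v j).
Proof.
apply: (lin_fsums (F := fun (M : nat) w => YW (nexp T l (D M v)) (j - M%:Z) w)) => [M|w]; last exact: tm_fin.
exact: wlinr.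
Qed.

(** With log x set to l, the divided powers of N sum up to exp(l N), so a branch is a scalar
    exponential times [tm] ([branch_hom]). *)
Lemma Yg_tm m a v w j l K : hom m a v ->
  (forall k, (K <= k)%N -> Yg v w (a - j%:~R - 1) k = 0) ->
  \sum_(k < K) l ^+ k *: Yg v w (a - j%:~R - 1) k = tm l v j w.
Proof.
move=> hv hK; have [B [L [hB hL]]] := DN_bound v.
rewrite -(fsum_nat (F := fun k => l ^+ k *: Yg v w (a - j%:~R - 1) k)); last first.
  by move=> k /hK ->; rewrite scaler0.
rewrite (@fsum_nat _ _ L); last first.
  move=> k Lk; rewrite (Yg_hom w j k hv hB) big1 ?scaler0 // => M _.
  by rewrite hL // scaler0 (lin0 (wlinl _ _)).
rewrite (tmE l j w hB).
under eq_bigr do rewrite (Yg_hom w j _ hv hB) scaler_sumr.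
rewrite exchange_big /=; apply: eq_bigr => M _.
rewrite (nexpE l (hL M)) (lin_sum (wlinl _ w)).
apply: eq_bigr => k _; rewrite !(linZ (wlinl _ w)) scalerA; congr (_ *: _).
Qed.

Local Notation br := (branch Wt Yg).

(** For homogeneous v and w the weight s fixes the power of x, and the powers of log x are
    bounded. *)
Lemma branch_fin v w s : finite_set [set ak : C * nat | component WS s (Yg v w ak.1 ak.2) != 0].
Proof.
have lc := component_linear dS s.
apply: (ds_ind dV (P := fun v => finite_set [set ak : C * nat | component WS s (Yg v w ak.1 ak.2) != 0])) => {v}.
- move=> m v hv; apply: (ds_ind dS (P := fun w => finite_set [set ak : C * nat | component WS s (Yg v w ak.1 ak.2) != 0])) => {w}.
  + move=> n w hw; have [K hK] := twist_log v w.
    apply/fin_suppP; exists [seq (s - n - m%:~R, k) | k <- iota 0 K]; split.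
      by rewrite map_inj_uniq ?iota_uniq // => x y [].
    move=> [a k] /= h; have [aE|aE] := eqVneq s (m%:~R + n + a).
      have Kk : (K <= k)%N.
        rewrite leqNgt; apply: contra h => kK; apply/mapP; exists k; first by rewrite mem_iota.
        by rewrite aE; congr (_, _); ring.
      by rewrite hK // (lin0 lc).
    exact: (component_other dS (twist_weight a k hv hw)).
  + by apply/fin_suppP; exists [::]; split => // i _; rewrite (lin0 (Yg_linear_r _ _ _)) (lin0 lc).
  + move=> x y hx hy; apply: sub_finite_set (fin_suppD hx hy) => i /=.
    by rewrite (linD (Yg_linear_r _ _ _)) (linD lc).
- by apply/fin_suppP; exists [::]; split => // i _; rewrite (lin0 (Yg_linear_l _ _ _)) (lin0 lc).
- move=> x y hx hy; apply: sub_finite_set (fin_suppD hx hy) => i /=.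
  by rewrite (linD (Yg_linear_l _ _ _)) (linD lc).
Qed.

Lemma branch_fin_scale (c : C * nat -> C) v w s :
  finite_set [set ak : C * nat | c ak *: component WS s (Yg v w ak.1 ak.2) != 0].
Proof.
apply: (fin_supp_sub _ (branch_fin v w s)) => ak; apply: contraNN => /eqP ->.
by rewrite scaler0.
Qed.

Lemma branch_linear_l p z w s : linear (fun v => br p v z w s).
Proof.
apply: (lin_fsums (F := fun (ak : C * nat) v => (cexp (ak.1 * lbr p z) * lbr p z ^+ ak.2) *:
  component WS s (Yg v w ak.1 ak.2))) => [ak|v]; last exact: branch_fin_scale.
apply: lin_scale; apply: (lin_comp (component_linear dS s)); exact: (Yg_linear_l).
Qed.

Lemma branch_linear_r p z v s : linear (fun w => br p v z w s).
Proof.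
apply: (lin_fsums (F := fun (ak : C * nat) w => (cexp (ak.1 * lbr p z) * lbr p z ^+ ak.2) *:
  component WS s (Yg v w ak.1 ak.2))) => [ak|w]; last exact: branch_fin_scale.
apply: lin_scale; apply: (lin_comp (component_linear dS s)); exact: (Yg_linear_r).
Qed.

Lemma branch_WS p z v w s : WS s (br p v z w s).
Proof.
apply: subspace_fsum => [|ak]; first exact: weight_subspace.
apply: subspaceZ; first exact: weight_subspace.
exact: component_mem.
Qed.

Lemma branch_hom p z m a v n w j : hom m a v -> WS n w ->
  br p v z w (n + (m%:~R + a - j%:~R - 1)) =
    cexp ((a - j%:~R - 1) * lbr p z) *: tm (lbr p z) v j w.
Proof.
move=> hv hw; have [K hK] := twist_log v w.
rewrite -(Yg_tm (lbr p z) hv (fun k h => hK (a - j%:~R - 1) k h)) scaler_sumr /branch.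
rewrite (@fsum_seq _ _ _ [seq (a - j%:~R - 1, k) | k <- iota 0 K]); last first.
- move=> [b k] /= h; have [bE|bE] := eqVneq (n + (m%:~R + a - j%:~R - 1)) (m%:~R + n + b).
    have bE' : b = a - j%:~R - 1.
      by apply: (addrI (m%:~R + n)); rewrite -bE; ring.
    have Kk : (K <= k)%N.
      rewrite leqNgt; apply: contra h => kK; apply/mapP; exists k; first by rewrite mem_iota.
      by rewrite bE'.
    by rewrite hK // (lin0 (component_linear dS _)) scaler0.
  by rewrite (component_other dS (twist_weight b k hv.1 hw)) ?scaler0.
- by rewrite map_inj_uniq ?iota_uniq // => x y [].
rewrite big_map -{1}(subn0 K) -/(index_iota 0 K) big_mkord; apply: eq_bigr => k _ /=.
by rewrite (component_self dS (Yg_WS j k hv hw)) scalerA.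
Qed.

Lemma branch_hom0 p z m a v n w s : hom m a v -> WS n w ->
  (forall j : int, s <> n + (m%:~R + a - j%:~R - 1)) -> br p v z w s = 0.
Proof.
move=> hv hw hs; apply: fsum_eq0 => -[b k] /=.
have [[j ->]|h] := int_or_not a b; last first.
  by rewrite (Yg_hom0 w k hv h) (lin0 (component_linear dS _)) scaler0.
rewrite (component_other dS (Yg_WS j k hv hw)) ?scaler0 //.
by apply/eqP => e; exact: (hs j).
Qed.

Lemma nexp_D c M x : nexp T c (D M x) = D M (nexp T c x).
Proof. by apply: nexp_comm; [exact: D_linear u voa M|move=> y; exact: (D_T voa Vneg u1 muE)]. Qed.

Lemma tm_nexp l c v j w : tm l (nexp T c v) j w = tm (l + c) v j w.
Proof. by apply: fsum_eq => M; rewrite -nexp_D (nexpD lT dT). Qed.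

(** Passing to p + 1 adds 2 pi i to the logarithm, which acts on eigenvalue a by e^(2 pi i a) exp(2
    pi i N); the automorphism cancels it. The integral part - j0 - 1 of the exponent contributes
    1. *)
Lemma twist_equivariance p z v w s :
  br (p + 1) (eexp T (- two_pi_i R) v) z w s = br p v z w s.
Proof.
have lE := eexp_linear lT dT (- two_pi_i R).
apply: (hom_ind (P := fun v => br (p + 1) (eexp T (- two_pi_i R) v) z w s = br p v z w s)) => {v}; last first.
- by move=> x y hx hy; rewrite (linD lE) !(linD (branch_linear_l _ z w s)) hx hy.
- by rewrite (lin0 lE) !(lin0 (branch_linear_l _ z w s)).
move=> m a v hv.
apply: (ds_ind dS (P := fun w => br (p + 1) (eexp T (- two_pi_i R) v) z w s = br p v z w s)) => {w}; last first.
- by move=> x y hx hy; rewrite !(linD (branch_linear_r _ z _ s)) hx hy.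
- by rewrite !(lin0 (branch_linear_r _ z _ s)).
move=> n w hw.
have hn := hom_nexp (- two_pi_i R) hv.
rewrite (eexp_gen lT dT _ hv.2) (linZ (branch_linear_l _ z w s)).
have [[j0 sE]|h] := int_or_not (n + m%:~R + a) s; last first.
  have h' j : s <> n + (m%:~R + a - j%:~R - 1) by move=> e; apply: (h j); rewrite e; ring.
  by rewrite (branch_hom0 _ _ hn hw h') (branch_hom0 _ _ hv hw h') scaler0.
have {}sE : s = n + (m%:~R + a - j0%:~R - 1) by rewrite sE; ring.
rewrite sE (branch_hom _ _ _ hn hw) (branch_hom _ _ _ hv hw) tm_nexp scalerA.
have lE1 : lbr (p + 1) z = lbr p z + two_pi_i R.
  by rewrite (lbr_shift (p + 1)) (lbr_shift p) rmorphD mulrDl mul1r addrA.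
rewrite lE1 addrK -cexpD; congr (_ *: _).
have -> : - two_pi_i R * a + (a - j0%:~R - 1) * (lbr p z + two_pi_i R) =
  (a - j0%:~R - 1) * lbr p z + (- j0 - 1)%:~R * two_pi_i R.
  by rewrite rmorphB rmorphN /=; ring.
by rewrite cexpD cexpMz cexp_two_pi_i exp1rz mulr1.
Qed.

(** * The axioms other than duality *)

Local Notation Va := (fun a => genT (- a)).

Lemma twist_voa : strongly_C_graded_voa Vn Y vac omega Va.
Proof.
split => //.
- exact: direct_sum_opp.
- move=> n; apply/seteqP; split => x.
    have sH (b : C) : subspace (Vn n `&` genT (- b)) := hom_subspace n (- b).
    have sS := sum_of_subspace sH.
    apply: (Vn_ind) => {x} [a x hx| |x y].
    + by apply: (sum_of_in (i := - a)) => //; rewrite opprK.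
    + exact: subspace0.
    + exact: subspaceD.
  apply: (sum_of_ind (P := Vn n)) => [b y [] //| |y z].
  + exact: subspace0 (ds_subspace dV n).
  + exact: subspaceD (ds_subspace dV n).
- by rewrite oppr0; exact: (hom_vac).2.
- by rewrite oppr0; exact: (hom_omega).2.
- move=> a b v n w hv hw; rewrite opprD.
  exact: (gen_bilinear lT (linl n) (linr^~ n) (Tder n)).
Qed.

Lemma twist_automorphism c : voa_automorphism Y vac omega (eexp T c).
Proof.
split.
- exact: eexp_linear.
- exact: eexp_bij.
- exact: eexp_ker (T_vac).
- exact: eexp_ker (T_omega).
- move=> v n w; exact: (eexp_bilinear lT dT (linl n) (linr^~ n) (Tder n)).
Qed.

Lemma TW_direct_sum : direct_sum (gen_eigenspace TW).
Proof.
have := direct_sum_opp (degree_direct_sum dW).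
congr direct_sum; apply/funext => a.
by rewrite (ts_degree hS) opprK.
Qed.

Lemma twist_module : duality Vn Y Wt Yg ->
  strongly_C_graded_twisted_module Vn Y vac omega Va
    (eexp T (- two_pi_i R)) Wt Yg (eexp TW (- two_pi_i R)).
Proof.
move=> hd; have dTW := TW_direct_sum; have lTW := wlinr u 0.
split => //.
- exact: twist_voa.
- exact: twist_automorphism.
- move=> a; rewrite -mulrNN; exact: gen_exp_gen.
- exact: (Yg_linear_l).
- exact: (Yg_linear_r).
- exact: (twist_log).
- exact: (twist_weight).
- by split; [exact: eexp_linear|exact: eexp_bij].
- by move=> n a; rewrite (WtE); exact: (gm_fin_dim wmod).
- move=> n a; have [B hB] := ts_lower hS (n + a - mu / 2) a.
  exists B => l /hB; rewrite (WtE).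
  by congr (Wm _ _ `<=` _); ring.
- by move=> p z v w s _; exact: twist_equivariance.
- exact: (twist_identity).
- exact: (twist_omega).
- by move=> n a w [].
- exact: (twist_degree).
- exact: (twist_derivative).
Qed.

(** * Duality *)

Lemma tm_expand l v j w B K : (forall M, (B <= M)%N -> D M v = 0) ->
  (forall M k, (K <= k)%N -> iter k N (D M v) = 0) ->
  tm l v j w = \sum_(x : 'I_B * 'I_K) (l ^+ x.2 / (x.2)`!%:R) *:
    YW (iter x.2 N (D x.1 v)) (j - (x.1 : nat)%:Z) w.
Proof.
move=> hB hK.
rewrite -(pair_bigA _ (fun (M : 'I_B) (k : 'I_K) => (l ^+ k / (k)`!%:R) *:
    YW (iter k N (D M v)) (j - (M : nat)%:Z) w)) /=.
rewrite (tmE l j w hB); apply: eq_bigr => M _.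
rewrite (nexpE l (hK M)) (lin_sum (wlinl _ w)); apply: eq_bigr => k _.
by rewrite (linZ (wlinl _ w)).
Qed.

(** On eigenvalue a the operator T - a is N, so [beta] gives the coefficients of the polynomial in
    N; convolving them with l^j / j! produces [log_beta]. *)
Lemma nexp_pact a x K l b q : genT a x -> (forall k, (K <= k)%N -> iter k N x = 0) ->
  nexp T l (pact (fun y => T y - a *: y) (fbp b q) x) =
  \sum_(k < K) log_beta k b l q *: iter k N x.
Proof.
move=> gx hK.
have pE : pact (fun y => T y - a *: y) (fbp b q) x = \sum_(i < K) beta i q b *: iter i N x.
  rewrite /pact.
  transitivity (\sum_(i \in [set: nat]) (fbp b q)`_i *: iter i N x).
    rewrite (@fsum_nat _ _ (size (fbp b q))) => [|i hi]; last by rewrite nth_default ?scale0r.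
    by apply: eq_bigr => i _; rewrite (iter_nilp_gen lT dT _ gx).
  by rewrite (@fsum_nat _ _ K) => [|i /hK ->]; last by rewrite scaler0.
rewrite pE (lin_sum (nexp_linear lT dT l)).
pose F j i := (l ^+ j / j`!%:R * beta i q b) *: iter (j + i) N x.
transitivity (\sum_(j < K) \sum_(i < K) F j i).
  rewrite exchange_big /=; apply: eq_bigr => i _; rewrite (linZ (nexp_linear lT dT l)).
  rewrite (@nexpE _ _ _ _ _ K) => [|k kK]; last by rewrite -iterD hK //; lia.
  by rewrite scaler_sumr; apply: eq_bigr => j _; rewrite /F iterD scalerA mulrC.
rewrite -(@triangle_full _ F K) => [|i j hij]; last by rewrite /F hK ?scaler0.
apply: eq_bigr => k _; rewrite /log_beta scaler_suml; apply: eq_bigr => j _.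
by rewrite /F subnKC // -ltnS.
Qed.

(** [Delta_conjugation] rewrites D_M of a mode, the exponential of the derivation N distributes over
    both arguments, and [nexp_pact] expands the first one. The bound on t makes the modes m + q >= t
    vanish by weight, so q stays below [iter_bound t m]. *)
Lemma tm_Y (phi : {scalar W}) m1 a1 v1 m2 a2 v2 w B1 K1 B2 K2 (t : nat) l m j :
  hom m1 a1 v1 -> hom m2 a2 v2 ->
  (forall M, (B1 <= M)%N -> D M v1 = 0) ->
  (forall M k, (K1 <= k)%N -> iter k N (D M v1) = 0) ->
  (forall M, (B2 <= M)%N -> D M v2 = 0) ->
  (forall M k, (K2 <= k)%N -> iter k N (D M v2) = 0) ->
  m1 + m2 <= t%:Z ->
  phi (tm l (Y v1 m v2) j w) = \sum_(x1 : 'I_B1 * 'I_K1) \sum_(x2 : 'I_B2 * 'I_K2)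
    \sum_(q < iter_bound t m) (log_beta x1.2 (a1 - (x1.1 : nat)%:R) l q * (l ^+ x2.2 / (x2.2)`!%:R)) *
      phi (YW (Y (iter x1.2 N (D x1.1 v1)) (m + q%:Z) (iter x2.2 N (D x2.1 v2)))
        (j - (x1.1 : nat)%:Z - q%:Z - (x2.1 : nat)%:Z) w).
Proof.
move=> h1 h2 hB1 hK1 hB2 hK2 mt; set Q := iter_bound t m.
have lE := nexp_linear lT dT l.
pose Ta x := T x - a1 *: x.
have lTa : linear Ta by apply: lin_sub => //; exact: lin_scaler.
pose E p q := nexp T l (pact Ta (fbp (a1 - p%:R) q) (D p v1)).
have EE p q : E p q = \sum_(k < K1) log_beta k (a1 - p%:R) l q *: iter k N (D p v1).
  exact: nexp_pact (hom_D p h1).2 (hK1 p).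
pose F p q r := YW (Y (E p q) (m + q%:Z) (nexp T l (D r v2))) (j - p%:Z - q%:Z - r%:Z) w.
have YW0 i x : x = 0 -> YW x i w = 0 by move=> ->; exact: lin0 (wlinl _ _).
have Fp p q r : (B1 <= p)%N -> F p q r = 0.
  move=> hp; apply: YW0; rewrite /E hB1 // (lin0 (pact_linear lTa _)) (lin0 lE).
  exact: lin0 (linl _ _).
have Fr p q r : (B2 <= r)%N -> F p q r = 0.
  by move=> hr; apply: YW0; rewrite hB2 // (lin0 lE) (lin0 (linr _ _)).
have Fq p q r : (Q <= q)%N -> F p q r = 0.
  move=> hq; apply: YW0.
  have e1 : Vn (m1 - p%:Z) (E p q).
    rewrite EE; apply: subspace_sum => [|k _]; first exact: ds_subspace dV _.
    apply: (subspaceZ _ (ds_subspace dV _)); exact: (hom_iterN k (hom_D p h1)).1.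
  have e2 := (hom_nexp l (hom_D r h2)).1.
  apply: (mode_neg voa Vneg e1 e2).
  move: hq; rewrite /Q /iter_bound; case: ifP => h; lia.
have nD M : nexp T l (D M (Y v1 m v2)) =
    \sum_(k < M.+1) \sum_(p < k.+1) Y (E p (k - p)%N) (m + (k - p)%N%:Z) (nexp T l (D (M - k) v2)).
  rewrite (Delta_conjugation voa Vneg u1 muE a1 v1 v2 M m) (lin_sum lE); apply: eq_bigr => k _.
  rewrite /Gop (lin_sum lE); apply: eq_bigr => p _.
  exact: (nexp_bilinear lT dT (linl _) (linr^~ _) (Tder _)).
have tE : tm l (Y v1 m v2) j w = \sum_(M \in [set: nat]) \sum_(k < M.+1) \sum_(p < k.+1) F p (k - p)%N (M - k)%N.
  apply: fsum_eq => M; rewrite nD (lin_sum (wlinl _ w)); apply: eq_bigr => k _.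
  rewrite (lin_sum (wlinl _ w)); apply: eq_bigr => p _; rewrite /F; congr (YW _ _ w).
  have := ltn_ord k; have := ltn_ord p; lia.
have F0 B' p q r : (B1 + Q + B2 <= B')%N -> (B' <= p + q + r)%N -> F p q r = 0.
  move=> hB' h; have [hp|hp] := leqP B1 p; first exact: Fp.
  have [hq|hq] := leqP Q q; first exact: Fq.
  by apply: Fr; lia.
(* Only triples with p < B1, q < Q and r < B2 contribute, so sums cut off at B may be rearranged
   freely. *)
pose B := (B1 + Q + B2)%N.
rewrite tE (@fsum_nat _ _ B) => [|M hM]; last first.
  rewrite big1 // => k _; rewrite big1 // => p _; apply: (F0 M) => //.
  have := ltn_ord k; have := ltn_ord p; lia.
pose G k r := \sum_(p < k.+1) F p (k - p)%N r.
rewrite (@triangle_full _ G B) => [|k r hkr]; last first.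
  rewrite /G big1 // => p _; apply: (F0 B) => //.
  have := ltn_ord p; lia.
rewrite exchange_big /= linear_sum.
transitivity (\sum_(r < B) \sum_(p < B) \sum_(q < B) phi (F p q r)).
  apply: eq_bigr => r _; rewrite /G (@triangle_full _ (fun p q => F p q r) B) => [|p q hpq]; last first.
    by apply: (F0 B) => //; lia.
  by rewrite linear_sum; apply: eq_bigr => p _; rewrite linear_sum.
rewrite (@sum_shrink _ (fun r => \sum_(p < B) \sum_(q < B) phi (F p q r)) B2) => [|//|r hr]; last first.
- by rewrite big1 // => p _; rewrite big1 // => q _; rewrite Fr // linear0.
- by rewrite /B; lia.
rewrite -(@sum5 _ B1 K1 B2 K2 Q (fun p k1 r k2 q => (log_beta k1 (a1 - p%:R) l q * (l ^+ k2 / k2`!%:R)) *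
      phi (YW (Y (iter k1 N (D p v1)) (m + q%:Z) (iter k2 N (D r v2)))
        (j - p%:Z - q%:Z - r%:Z) w))).
apply: eq_bigr => r _.
rewrite (@sum_shrink _ (fun p => \sum_(q < B) phi (F p q r)) B1) => [|//|p hp]; last first.
- by rewrite big1 // => q _; rewrite Fp // linear0.
- by rewrite /B; lia.
apply: eq_bigr => p _.
rewrite (@sum_shrink _ (fun q => phi (F p q r)) Q) => [|//|q hq]; last first.
- by rewrite Fq // linear0.
- by rewrite /B; lia.
apply: eq_bigr => q _.
rewrite /F EE (lin_sum (linl _ _)) (lin_sum (wlinl _ _)) linear_sum; apply: eq_bigr => k1 _.
rewrite (nexpE l (hK2 r)) (lin_sum (linr _ _)) (lin_sum (wlinl _ _)) linear_sum; apply: eq_bigr => k2 _.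
rewrite (linZ (linr _ _)) (linZ (linl _ _)) scalerA (linZ (wlinl _ _)) linearZ /=.
by rewrite mulrC [_ * log_beta _ _ _ _]mulrC mulrC.
Qed.

(** The functional sees finitely many weights, and those of X lie in one coset of the integers. The
    list [ks] is chosen before X, so a single finite sum serves all branches and all z1, z2. *)
Lemma dual_weights (phi : {scalar W}) (c0 : C) : graded_dual Wt phi -> exists ks : seq int,
  forall X : C -> W, (forall s, WS s (X s)) ->
    (forall s, (forall k : int, s <> c0 - k%:~R) -> X s = 0) ->
  pairing phi X = \sum_(k <- ks) phi (X (c0 - k%:~R)).
Proof.
move=> hphi.
pose S := [set i.1 | i in [set i : C * C | exists2 w, Wt i.1 i.2 w & phi w != 0]].
have finS : finite_set S by exact: finite_image.
have S0 s x : ~ S s -> WS s x -> phi x = 0.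
  move=> hs; apply: (WS_ind (P := fun x => phi x = 0)).
  - move=> b y hy; apply: contrapT => /eqP nz; apply: hs; exists (s, b) => //.
    by exists y.
  - exact: linear0.
  - by move=> y z hy hz; rewrite linearD hy hz /= addr0.
have inj : set_inj ((fun k : int => c0 - k%:~R) @^-1` S) (fun k : int => c0 - k%:~R).
  by move=> a b _ _ /addrI/oppr_inj/eqP; rewrite eqr_int => /eqP.
have /finite_seqP [ks0 hks] := finite_preimage inj finS.
exists (undup ks0) => X X1 X2.
have injh : injective (fun k : int => c0 - k%:~R : C).
  by move=> a b /addrI/oppr_inj/eqP; rewrite eqr_int => /eqP.
rewrite /pairing (@fsum_seq _ _ _ [seq c0 - k%:~R | k <- undup ks0]).
- by rewrite big_map.
- by rewrite map_inj_uniq ?undup_uniq.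
- move=> s hs; have [[k sE]|h] := pselect (exists k : int, s = c0 - k%:~R); last first.
    by rewrite X2 ?linear0 // => k e; apply: h; exists k.
  apply: (S0 s) => // Ss; move/negP: hs; apply; apply/mapP; exists k => //.
  rewrite mem_undup; have : [set` ks0] k by rewrite -hks /= -sE.
  by [].
Qed.

Lemma Y_at_hom m1 a1 v1 m2 a2 v2 z m : hom m1 a1 v1 -> hom m2 a2 v2 ->
  Y_at Vn Y v1 z v2 (m1 + m2 - m - 1) = z ^ (- m - 1) *: Y v1 m v2.
Proof.
move=> h1 h2; have hY k := (hom_Y k h1 h2).1.
rewrite /Y_at (@fsum_single _ _ _ m) => [|k km]; last first.
  rewrite (component_other dV (hY k)) ?scaler0 //.
  by apply: contra km => /eqP e; apply/eqP; lia.
by rewrite (component_self dV (hY m)).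
Qed.

Lemma Y_at_fin v1 v2 s : finite_set [set m : int | component Vn s (Y v1 m v2) != 0].
Proof.
have lc := component_linear dV s.
apply: (ds_ind dV (P := fun v1 => finite_set [set m : int | component Vn s (Y v1 m v2) != 0])) => {v1}.
- move=> m1 v1 h1; apply: (ds_ind dV (P := fun v2 => finite_set [set m : int | component Vn s (Y v1 m v2) != 0])) => {v2}.
  + move=> m2 v2 h2; apply/fin_suppP; exists [:: m1 + m2 - s - 1]; split => // k.
    rewrite inE => hk; rewrite (component_other dV (mode_weight voa k h1 h2)) //.
    by apply: contra hk => /eqP e; apply/eqP; lia.
  + by apply/fin_suppP; exists [::]; split => // k _; rewrite (lin0 (linr _ _)) (lin0 lc).
  + move=> x y hx hy; apply: sub_finite_set (fin_suppD hx hy) => k /=.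
    by rewrite (linD (linr _ _)) (linD lc).
- by apply/fin_suppP; exists [::]; split => // k _; rewrite (lin0 (linl _ _)) (lin0 lc).
- move=> x y hx hy; apply: sub_finite_set (fin_suppD hx hy) => k /=.
  by rewrite (linD (linl _ _)) (linD lc).
Qed.

Lemma Y_at_fin_scale (c : int -> C) v1 v2 s :
  finite_set [set m : int | c m *: component Vn s (Y v1 m v2) != 0].
Proof.
apply: (fin_supp_sub _ (Y_at_fin v1 v2 s)) => m; apply: contraNN => /eqP ->.
by rewrite scaler0.
Qed.

Lemma Y_at_linear_l z v2 s : linear (fun v1 => Y_at Vn Y v1 z v2 s).
Proof.
apply: (lin_fsums (F := fun m v1 => z ^ (- m - 1) *: component Vn s (Y v1 m v2))) => [m|v1].
  by apply: lin_scale; exact: lin_comp (component_linear dV s) (linl m v2).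
exact: Y_at_fin_scale.
Qed.

Lemma Y_at_linear_r z v1 s : linear (fun v2 => Y_at Vn Y v1 z v2 s).
Proof.
apply: (lin_fsums (F := fun m v2 => z ^ (- m - 1) *: component Vn s (Y v1 m v2))) => [m|v2].
  by apply: lin_scale; exact: lin_comp (component_linear dV s) (linr v1 m).
exact: Y_at_fin_scale.
Qed.

Section Duality.
Variable phi : {scalar W}.
Hypothesis hphi : graded_dual Wt phi.

Definition series12 v1 v2 w p z1 z2 (s : C) := pairing phi (br p v1 z1 (br p v2 z2 w s)).
Definition series21 v1 v2 w p z1 z2 (s : C) := pairing phi (br p v2 z2 (br p v1 z1 w s)).
Definition series_iter v1 v2 w p z1 z2 (s : int) :=
  pairing phi (br p (Y_at Vn Y v1 (z1 - z2) v2 s) z2 w).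

Lemma pairing_linear (U : lmodType C) (X : U -> C -> W) : (forall s, linear (fun x => X x s)) ->
  (forall x s, WS s (X x s)) -> linear (fun x => pairing phi (X x) : C^o).
Proof.
move=> lX hX; apply: (lin_fsums (F := fun s x => phi (X x s) : C^o)) => [s|x].
  by move=> c x y; rewrite lX linearP.
exact: graded_dual_fin hphi (hX x).
Qed.

Lemma series12_l v2 w p z1 z2 s : linear (fun v1 => series12 v1 v2 w p z1 z2 s : C^o).
Proof.
apply: pairing_linear => [r|x r]; [exact: (branch_linear_l)|exact: (branch_WS)].
Qed.

Lemma series12_m v1 w p z1 z2 s : linear (fun v2 => series12 v1 v2 w p z1 z2 s : C^o).
Proof.
apply: pairing_linear => [r|x r]; last exact: (branch_WS).
exact: lin_comp (branch_linear_r p z1 v1 r) (branch_linear_l p z2 w s).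
Qed.

Lemma series12_r v1 v2 p z1 z2 s : linear (fun w => series12 v1 v2 w p z1 z2 s : C^o).
Proof.
apply: pairing_linear => [r|x r]; last exact: (branch_WS).
exact: lin_comp (branch_linear_r p z1 v1 r) (branch_linear_r p z2 v2 s).
Qed.

Lemma series_iter_l v2 w p z1 z2 s : linear (fun v1 => series_iter v1 v2 w p z1 z2 s : C^o).
Proof.
apply: pairing_linear => [r|x r]; last exact: (branch_WS).
exact: lin_comp (branch_linear_l p z2 w r) (Y_at_linear_l (z1 - z2) v2 s).
Qed.

Lemma series_iter_m v1 w p z1 z2 s : linear (fun v2 => series_iter v1 v2 w p z1 z2 s : C^o).
Proof.
apply: pairing_linear => [r|x r]; last exact: (branch_WS).
exact: lin_comp (branch_linear_l p z2 w r) (Y_at_linear_r (z1 - z2) v1 s).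
Qed.

Lemma series_iter_r v1 v2 p z1 z2 s : linear (fun w => series_iter v1 v2 w p z1 z2 s : C^o).
Proof.
apply: pairing_linear => [r|x r]; last exact: (branch_WS).
exact: branch_linear_r p z2 _ r.
Qed.

(** Different vectors need different pole orders; asking for every large t makes the property stable
    under sums. *)
Definition dual_eventually (I1 I2 I3 : choiceType) (f1 : int -> C -> C -> I1 -> C)
  (f2 : int -> C -> C -> I2 -> C) (f3 : int -> C -> C -> I3 -> C) :=
  exists t0 : nat, forall t, (t0 <= t)%N -> dual_series t f1 f2 f3.

Lemma dual_eventually_closed (U : lmodType C) (I1 I2 I3 : choiceType)
  (f1 : U -> int -> C -> C -> I1 -> C) (f2 : U -> int -> C -> C -> I2 -> C)
  (f3 : U -> int -> C -> C -> I3 -> C) :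
  (forall p z1 z2 i, linear (fun x => f1 x p z1 z2 i : C^o)) ->
  (forall p z1 z2 i, linear (fun x => f2 x p z1 z2 i : C^o)) ->
  (forall p z1 z2 i, linear (fun x => f3 x p z1 z2 i : C^o)) ->
  dual_eventually (f1 0) (f2 0) (f3 0) /\
  (forall x y, dual_eventually (f1 x) (f2 x) (f3 x) -> dual_eventually (f1 y) (f2 y) (f3 y) ->
     dual_eventually (f1 (x + y)) (f2 (x + y)) (f3 (x + y))).
Proof.
move=> l1 l2 l3; split.
  exists 0%N => t _; have := dual_series0 R t I1 I2 I3.
  by congr dual_series; do 4 apply/funext => ?; apply/esym;
    [exact: lin0 (l1 _ _ _ _)|exact: lin0 (l2 _ _ _ _)|exact: lin0 (l3 _ _ _ _)].
move=> x y [t1 h1] [t2 h2]; exists (maxn t1 t2) => t; rewrite geq_max => /andP[/h1 e1 /h2 e2].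
have := dual_seriesD e1 e2.
by congr dual_series; do 4 apply/funext => ?; apply/esym;
    [exact: linD (l1 _ _ _ _) _ _|exact: linD (l2 _ _ _ _) _ _|exact: linD (l3 _ _ _ _) _ _].
Qed.

Lemma hom_dual m1 a1 v1 m2 a2 v2 n w : hom m1 a1 v1 -> hom m2 a2 v2 -> WS n w ->
  dual_eventually (series12 v1 v2 w) (series21 v1 v2 w) (series_iter v1 v2 w).
Proof.
(* D_M and N do not raise weights, so this bound covers all the pairs of vectors obtained from v1
   and v2 below. *)
move=> h1 h2 hw; exists (`|m1| + `|m2|)%N => t ht.
have [B1 [K1 [hB1 hK1]]] := DN_bound v1.
have [B2 [K2 [hB2 hK2]]] := DN_bound v2.
(* The weight reached from w by the two modes of index 0; modes with sum k lead to weight c0 - k. *)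
pose c0 := n + (m1%:~R + m2%:~R + a1 + a2 - 2).
have [ks hks] := dual_weights c0 hphi.
pose A1 (x : 'I_B1 * 'I_K1) := iter x.2 N (D x.1 v1).
pose A2 (x : 'I_B2 * 'I_K2) := iter x.2 N (D x.1 v2).
(* For twisted modes with sum k, the components D_M of v1 and v2 lower the modes by their M, leaving
   untwisted modes with sum [kp]; if i is the one of [A1], the exponents of z1 and z2 are b1 - i and
   b2 + i. *)
pose b1 (x : 'I_B1 * 'I_K1) : C := a1 - 1 - (x.1 : nat)%:R.
pose b2 (k : int) (x : 'I_B1 * 'I_K1) : C := a2 - 1 - k%:~R + (x.1 : nat)%:R.
pose kp (k : int) (x : 'I_B1 * 'I_K1) (y : 'I_B2 * 'I_K2) : int := k - (x.1 : nat)%:Z - (y.1 : nat)%:Z.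
pose g1 (k : int) (x : 'I_B1 * 'I_K1) (y : 'I_B2 * 'I_K2) (p : int) (z1 z2 : C) (j : int) :=
  log_prefactor (b1 x) (b2 k x) x.2 y.2 (lbr p z1) (lbr p z2) *
  (prod12 YW (A1 x) (A2 y) w phi (kp k x y) (k - (x.1 : nat)%:Z - j) * (z2 / z1) ^ (k - (x.1 : nat)%:Z - j)).
pose g2 (k : int) (x : 'I_B1 * 'I_K1) (y : 'I_B2 * 'I_K2) (p : int) (z1 z2 : C) (i : int) :=
  log_prefactor (b1 x) (b2 k x) x.2 y.2 (lbr p z1) (lbr p z2) *
  (prod21 YW (A1 x) (A2 y) w phi (kp k x y) (i - (x.1 : nat)%:Z) * (z2 / z1) ^ (i - (x.1 : nat)%:Z)).
pose g3 (k : int) (x : 'I_B1 * 'I_K1) (y : 'I_B2 * 'I_K2) (p : int) (z1 z2 : C) (m : int) :=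
  (cexp ((b1 x + 1 + b2 k x) * lbr p z2) * (lbr p z2 ^+ y.2 / (y.2)`!%:R) / (z1 - z2)) *
     \sum_(q < iter_bound t m) (log_beta x.2 (b1 x + 1) (lbr p z2) q * ((z1 - z2) / z2) ^+ q) *
        (iterate Y YW (A1 x) (A2 y) w phi (kp k x y) (m + q%:Z) * ((z1 - z2) / z2) ^ (- (m + q%:Z))).
have hterm k x y : dual_series t (g1 k x y) (g2 k x y) (g3 k x y).
  have hY i : t%:Z <= i -> Y (A1 x) i (A2 y) = 0.
    move=> ti; apply: (mode_neg voa Vneg (hom_iterN x.2 (hom_D x.1 h1)).1
      (hom_iterN y.2 (hom_D y.1 h2)).1); lia.
  apply: (dual_series_reindex (h1 := fun i : int => k - (x.1 : nat)%:Z - i)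
    (h2 := fun i : int => i + (x.1 : nat)%:Z) (h3 := fun i : int => i) _ _ _ _
    (untwisted_dual_series bilW (gm_truncated wmod) jacW w phi (kp k x y) hY (b1 x) (b2 k x) x.2 y.2)).
  - by move=> i j /addrI/oppr_inj.
  - by move=> i j /addIr.
  - by move=> i j.
  - move=> p z1 z2 _ _ _; split; split.
    + by move=> j _; exists (k - (x.1 : nat)%:Z - j); lia.
    + by move=> i; rewrite /g1 (_ : k - (x.1 : nat)%:Z - (k - (x.1 : nat)%:Z - i) = i) //; lia.
    + by move=> j _; exists (j - (x.1 : nat)%:Z); lia.
    + by move=> i; rewrite /g2 addrK.
    + by move=> j _; exists j.
    + by [].
have hsum := dual_series_sum ks (fun k => dual_series_sum (index_enum _)
  (fun x => dual_series_sum (index_enum _) (fun y => hterm k x y))).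
(* The duality axiom indexes its series by the weight of the intermediate vector; the three maps
   send a mode to that weight. *)
apply: (dual_series_reindex (h1 := fun j : int => n + (m2%:~R + a2 - j%:~R - 1))
  (h2 := fun j : int => n + (m1%:~R + a1 - j%:~R - 1))
  (h3 := fun m : int => m1 + m2 - m - 1) _ _ _ _ hsum).
- by move=> i j /addrI /addIr /addrI /oppr_inj/eqP; rewrite eqr_int => /eqP.
- by move=> i j /addrI /addIr /addrI /oppr_inj/eqP; rewrite eqr_int => /eqP.
- by move=> i j /addIr /addrI /oppr_inj.
have tmZ l v j c x : tm l v j (c *: x) = c *: tm l v j x := linZ (tm_linear_r l v j) c x.
have brWS p v z x s : WS s (br p v z x s) := branch_WS p z v x s.
have pair0 X : (forall s, X s = 0) -> pairing phi X = 0.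
  by move=> hX; apply: fsum_eq0 => s; rewrite hX linear0.
have br_other m a v n' x p z c (j0 : int) s : hom m a v -> WS n' x -> n' + (m%:~R + a - 1) = c - j0%:~R ->
    (forall k : int, s <> c - k%:~R) -> br p v z x s = 0.
  move=> hv hx e hs; apply: (branch_hom0 p z hv hx) => j sE; apply: (hs (j0 + j)).
  have -> : c - (j0 + j)%:~R = (c - j0%:~R) - j%:~R by rewrite rmorphD /=; ring.
  by rewrite -e sE; ring.
have br0 p v z s : br p v z 0 s = 0 := lin0 (branch_linear_r p z v s).
move=> p z1 z2 z10 z20 z00; have e1 := cexp_lbr p z10; have e2 := cexp_lbr p z20.
have ph2 l1 l2 i j : phi (tm l1 v1 i (tm l2 v2 j w)) =
   \sum_(x : 'I_B1 * 'I_K1) \sum_(y : 'I_B2 * 'I_K2)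
    (l1 ^+ x.2 / (x.2)`!%:R) * (l2 ^+ y.2 / (y.2)`!%:R) *
      phi (YW (A1 x) (i - (x.1 : nat)%:Z) (YW (A2 y) (j - (y.1 : nat)%:Z) w)).
  rewrite (tm_expand l1 i _ hB1 hK1) linear_sum; apply: eq_bigr => x _.
  rewrite (tm_expand l2 j w hB2 hK2) (lin_sum (wlinr _ _)) linearZ linear_sum /= mulr_sumr.
  by apply: eq_bigr => y _; rewrite (linZ (wlinr _ _)) linearZ /= mulrA.
have ph1 l1 l2 i j : phi (tm l2 v2 j (tm l1 v1 i w)) =
   \sum_(x : 'I_B1 * 'I_K1) \sum_(y : 'I_B2 * 'I_K2)
    (l1 ^+ x.2 / (x.2)`!%:R) * (l2 ^+ y.2 / (y.2)`!%:R) *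
      phi (YW (A2 y) (j - (y.1 : nat)%:Z) (YW (A1 x) (i - (x.1 : nat)%:Z) w)).
  rewrite exchange_big /=.
  rewrite (tm_expand l2 j _ hB2 hK2) linear_sum; apply: eq_bigr => x _.
  rewrite (tm_expand l1 i w hB1 hK1) (lin_sum (wlinr _ _)) linearZ linear_sum /= mulr_sumr.
  by apply: eq_bigr => y _; rewrite (linZ (wlinr _ _)) linearZ /= mulrA [_ / _ * (_ / _)]mulrC.
split; split.
- move=> s nz; apply: contrapT => hs; move/eqP: nz; apply; apply: pair0 => r.
  rewrite (branch_hom0 p z2 h2 hw) ?br0 // => j sE; apply: hs; by exists j.
- move=> j; rewrite /series12 hks => [|r|r hr]; last 2 first.
  + exact: brWS.
  + apply: (br_other _ _ _ _ _ p z1 c0 j r h1 (brWS p v2 z2 w _) _ hr).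
    by rewrite /c0; ring.
  apply: eq_bigr => k _.
  have -> : c0 - k%:~R = (n + (m2%:~R + a2 - j%:~R - 1)) + (m1%:~R + a1 - (k - j)%:~R - 1).
    by rewrite /c0 rmorphB /=; ring.
  rewrite (branch_hom p z1 _ h1 (brWS p v2 z2 w _)) (branch_hom p z2 j h2 hw).
  rewrite tmZ scalerA linearZ /= ph2 mulr_sumr; apply: eq_bigr => x _.
  rewrite mulr_sumr; apply: eq_bigr => y _; rewrite /g1 /log_prefactor /prod12.
  have := exp_shift (b1 x) (b2 k x) (k - (x.1 : nat)%:Z - j) z10 z20 e1 e2.
  have -> : b1 x - (k - (x.1 : nat)%:Z - j)%:~R = a1 - (k - j)%:~R - 1.
    by rewrite /b1 !rmorphB /= -[(x.1 : nat)%:~R]/((x.1 : nat)%:R); ring.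
  have -> : b2 k x + (k - (x.1 : nat)%:Z - j)%:~R = a2 - j%:~R - 1.
    by rewrite /b2 !rmorphB /= -[(x.1 : nat)%:~R]/((x.1 : nat)%:R); ring.
  move=> ->.
  have -> : kp k x y - (k - (x.1 : nat)%:Z - j) = j - (y.1 : nat)%:Z by rewrite /kp; ring.
  have -> : k - j - (x.1 : nat)%:Z = k - (x.1 : nat)%:Z - j by ring.
  by ring.
- move=> s nz; apply: contrapT => hs; move/eqP: nz; apply; apply: pair0 => r.
  rewrite (branch_hom0 p z1 h1 hw) ?br0 // => j sE; apply: hs; by exists j.
- move=> i; rewrite /series21 hks => [|r|r hr]; last 2 first.
  + exact: brWS.
  + apply: (br_other _ _ _ _ _ p z2 c0 i r h2 (brWS p v1 z1 w _) _ hr).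
    by rewrite /c0; ring.
  apply: eq_bigr => k _.
  have -> : c0 - k%:~R = (n + (m1%:~R + a1 - i%:~R - 1)) + (m2%:~R + a2 - (k - i)%:~R - 1).
    by rewrite /c0 rmorphB /=; ring.
  rewrite (branch_hom p z2 _ h2 (brWS p v1 z1 w _)) (branch_hom p z1 i h1 hw).
  rewrite tmZ scalerA linearZ /= ph1 mulr_sumr; apply: eq_bigr => x _.
  rewrite mulr_sumr; apply: eq_bigr => y _; rewrite /g2 /log_prefactor /prod21.
  have := exp_shift (b1 x) (b2 k x) (i - (x.1 : nat)%:Z) z10 z20 e1 e2.
  have -> : b1 x - (i - (x.1 : nat)%:Z)%:~R = a1 - i%:~R - 1.
    by rewrite /b1 !rmorphB /= -[(x.1 : nat)%:~R]/((x.1 : nat)%:R); ring.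
  have -> : b2 k x + (i - (x.1 : nat)%:Z)%:~R = a2 - (k - i)%:~R - 1.
    by rewrite /b2 !rmorphB /= -[(x.1 : nat)%:~R]/((x.1 : nat)%:R); ring.
  have -> : kp k x y - (i - (x.1 : nat)%:Z) = k - i - (y.1 : nat)%:Z by rewrite /kp; ring.
  rewrite [cexp _ * cexp _ in LHS]mulrC => ->.
  by ring.
- by move=> s _; exists (m1 + m2 - s - 1); lia.
- move=> m; rewrite /series_iter (Y_at_hom _ _ h1 h2).
  have hY := hom_Y m h1 h2.
  have brZ s : br p ((z1 - z2) ^ (- m - 1) *: Y v1 m v2) z2 w s =
      (z1 - z2) ^ (- m - 1) *: br p (Y v1 m v2) z2 w s.
    exact: linZ (branch_linear_l p z2 w s) _ _.
  rewrite hks => [|r|r hr]; last 2 first.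
  + exact: brWS.
  + rewrite brZ (branch_hom0 p z2 hY hw) ?scaler0 // => j rE; apply: (hr (j + m)).
    by rewrite rE /c0 !rmorphD !rmorphN /=; ring.
  apply: eq_bigr => k _; rewrite brZ.
  have -> : c0 - k%:~R = n + ((m1 + m2 - m - 1)%:~R + (a1 + a2) - (k - m)%:~R - 1).
    by rewrite /c0 !rmorphB rmorphD /=; ring.
  rewrite (branch_hom p z2 (k - m) hY hw) scalerA linearZ /=.
  rewrite (tm_Y phi w (lbr p z2) m (k - m) h1 h2 hB1 hK1 hB2 hK2 (t := t)); last by lia.
  rewrite mulr_sumr; apply: eq_bigr => x _; rewrite mulr_sumr; apply: eq_bigr => y _.
  rewrite /g3 !mulr_sumr; apply: eq_bigr => q _.
  have -> : b1 x + 1 = a1 - (x.1 : nat)%:R by rewrite /b1; ring.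
  rewrite /iterate.
  have -> : k - m - (x.1 : nat)%:Z - q%:Z - (y.1 : nat)%:Z = kp k x y - (m + q%:Z) by rewrite /kp; ring.
  set Iq := phi _; set lb := log_beta _ _ _ _; set l2 := lbr p z2; set f2 := _ / (y.2)`!%:R.
  have y0 : (z1 - z2) / z2 != 0 by rewrite mulf_neq0 ?invr_neq0.
  have -> : ((z1 - z2) / z2) ^ (- (m + q%:Z)) = ((z1 - z2) / z2) ^ (- m) / ((z1 - z2) / z2) ^+ q.
    by rewrite opprD (expfzDr _ _ y0) -(invr_expz _ q%:Z).
  have -> : a1 + a2 - (k - m)%:~R - 1 = (a1 - (x.1 : nat)%:R + b2 k x) + m%:~R.
    by rewrite /b2 rmorphB /=; ring.
  rewrite (cexp_shift_int _ m e2).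
  rewrite expz_div opprK (expfzDr _ _ z00) -(invr_expz _ 1) expr1z.
  have yq : ((z1 - z2) / z2) ^+ q != 0 by rewrite expf_neq0.
  set E := cexp _; set Zm := (z1 - z2) ^ (- m); set z2m := z2 ^ m; set i0 := (z1 - z2)^-1.
  set yy := ((z1 - z2) / z2) ^+ q in yq *.
  transitivity (Zm * z2m * i0 * E * f2 * lb * Iq); first by ring.
  by rewrite -[LHS]mulr1 -(divff yq); ring.
Qed.
(** Trilinearity reduces to homogeneous vectors. [series21] is [series12] with v1, v2 and z1, z2
    exchanged, so the linearity lemmas of the latter serve for both. *)
Lemma all_dual v1 v2 w : dual_eventually (series12 v1 v2 w) (series21 v1 v2 w) (series_iter v1 v2 w).
Proof.
pose P v1 v2 w := dual_eventually (series12 v1 v2 w) (series21 v1 v2 w) (series_iter v1 v2 w).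
apply: (hom_ind (P := fun v1 => P v1 v2 w)); last 2 first.
- exact: (dual_eventually_closed (fun p z1 z2 i => series12_l v2 w p z1 z2 i)
    (fun p z1 z2 i => series12_m v2 w p z2 z1 i) (fun p z1 z2 i => series_iter_l v2 w p z1 z2 i)).1.
- exact: (dual_eventually_closed (fun p z1 z2 i => series12_l v2 w p z1 z2 i)
    (fun p z1 z2 i => series12_m v2 w p z2 z1 i) (fun p z1 z2 i => series_iter_l v2 w p z1 z2 i)).2.
move=> m1 a1 {}v1 h1; apply: (hom_ind (P := fun v2 => P v1 v2 w)); last 2 first.
- exact: (dual_eventually_closed (fun p z1 z2 i => series12_m v1 w p z1 z2 i)
    (fun p z1 z2 i => series12_l v1 w p z2 z1 i) (fun p z1 z2 i => series_iter_m v1 w p z1 z2 i)).1.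
- exact: (dual_eventually_closed (fun p z1 z2 i => series12_m v1 w p z1 z2 i)
    (fun p z1 z2 i => series12_l v1 w p z2 z1 i) (fun p z1 z2 i => series_iter_m v1 w p z1 z2 i)).2.
move=> m2 a2 {}v2 h2; apply: (ds_ind dS (P := fun w => P v1 v2 w)); last 2 first.
- exact: (dual_eventually_closed (fun p z1 z2 i => series12_r v1 v2 p z1 z2 i)
    (fun p z1 z2 i => series12_r v2 v1 p z2 z1 i) (fun p z1 z2 i => series_iter_r v1 v2 p z1 z2 i)).1.
- exact: (dual_eventually_closed (fun p z1 z2 i => series12_r v1 v2 p z1 z2 i)
    (fun p z1 z2 i => series12_r v2 v1 p z2 z1 i) (fun p z1 z2 i => series_iter_r v1 v2 p z1 z2 i)).2.
by move=> n {}w hw; exact: (hom_dual h1 h2 hw).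
Qed.

End Duality.

Lemma twist_duality : duality Vn Y Wt Yg.
Proof.
move=> v1 v2 w phi hphi; have [t0 ht] := all_dual hphi v1 v2 w.
(* The pole order of the axiom has to be positive, hence the successor. *)
have [G [eG hG]] := ht t0.+1 (leqnSn t0).
have [K [a [m [n hK]]]] := elog_f_branch t0.+1 eG.
exists K, a, m, n, t0.+1; split => // p z1 z2; have [h1 h2 h3] := hG p z1 z2.
have nE (b c : C) : (`|b| < `|c|) = (Normc.normc b < Normc.normc c) by rewrite !normCE ltcR.
split; rewrite nE normr_gt0.
- by move=> lt0 z0; apply: sasum_abs; rewrite hK; exact: h1.
- by move=> lt0 z0; apply: sasum_abs; rewrite hK; exact: h2.
- by move=> lt0 z0 q hq; apply: sasum_abs; rewrite hK; exact: h3.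
Qed.

End Twist.


(** * Return from - u to u *)

Theorem theorem5p5 (R : realType)
  (V : lmodType R[i]) (Vn : int -> set V) (Y : V -> int -> V -> V)
  (vac omega u : V) (mu : R[i])
  (W : lmodType R[i]) (Wm : R[i] -> R[i] -> set W) (YW : V -> int -> W -> W)
  (V_voa : is_voa Vn Y vac omega)
  (V0 : Vn 0 = [set v | exists c : R[i], v = c *: vac])
  (Vneg : forall n : int, n < 0 -> Vn n `<=` [set 0])
  (u_wt1 : Vn 1 u)
  (L1u : Lop Y omega 1 u = 0)
  (muE : Y u 1 u = mu *: vac)
  (W_module : strongly_C_graded_module Y vac omega
                (gen_eigenspace (Y u 0)) Wm YW)
  (W_degree : forall alpha,
     degree_space Wm alpha = gen_eigenspace (YW u 0) alpha)
  (W_lower : real_lower_bounded Wm) :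
  let YWu := Delta_modified Y (- u) YW in
  let LWu0 := fun w => YWu omega w (- 2) 0%N in
  let Wt := fun n alpha : R[i] =>
    gen_eigenspace LWu0 n `&` gen_eigenspace (YW u 0) alpha in
  (forall n alpha, Wt n alpha = Wm (n + alpha - mu / 2) alpha) /\
  strongly_C_graded_twisted_module Vn Y vac omega
    (gen_eigenspace (Y u 0))
    (exp_op (fun v => two_pi_i R *: Y u 0 v))
    Wt YWu
    (exp_op (fun w => two_pi_i R *: YW u 0 w)).
Proof.
move=> YWu LWu0 Wtw.
have lY n w : linear (fun v => Y v n w) := modes_linl (voa_bilinear V_voa) n w.
have rY v n : linear (Y v n) := modes_linr (voa_bilinear V_voa) v n.
have lYW n w : linear (fun v => YW v n w) := modes_linl (gm_bilinear W_module) n w.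
have rYW v n : linear (YW v n) := modes_linr (gm_bilinear W_module) v n.
have Yopp n x : Y (- u) n x = - Y u n x := linN (lY n x) u.
have YWopp n x : YW (- u) n x = - YW u n x := linN (lYW n x) u.
have genV : gen_eigenspace (Y u 0) = (fun a => gen_eigenspace (Y (- u) 0) (- a)).
  by apply/funext => a; apply/seteqP; split => x /(gen_opp a x (rY u 0) (Yopp 0)).
have genW : gen_eigenspace (YW u 0) = (fun a => gen_eigenspace (YW (- u) 0) (- a)).
  by apply/funext => a; apply/seteqP; split => x /(gen_opp a x (rYW u 0) (YWopp 0)).
(* The setup is taken at - u. Both degree spaces are renamed by the sign, while mu is unchanged
   because u enters it twice. *)
have hS : twist_setup Vn Y vac omega (- u) mu Wm YW.
  split => //.
  - by rewrite -scaleN1r; exact: (subspaceZ _ (ds_subspace (voa_graded V_voa) 1)).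
  - by rewrite (linN (rY omega 2)) [Y omega 2 u]L1u oppr0.
  - by rewrite Yopp (linN (rY u 1)) opprK.
  - by rewrite -genV.
  - by move=> a; rewrite W_degree genW.
have dV := T_direct_sum V_voa (ts_u1 hS); have dW := TW_direct_sum hS.
have WtE' : Wtw = Wt Y omega (- u) YW by apply/funext => n; apply/funext => a; rewrite /Wtw genW.
(* The two signs cancel: 2 pi i Y_0(u) = - 2 pi i Y_0(- u). *)
have gE : exp_op (fun v => two_pi_i R *: Y u 0 v) = eexp (Y (- u) 0) (- two_pi_i R).
  apply/funext => x; rewrite -(exp_op_eexp (rY (- u) 0) dV).
    by congr exp_op; apply/funext => y; rewrite Yopp scalerN scaleNr opprK.
  exact: scalar_separation (voa_graded V_voa) (voa_fin_dim V_voa).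
have gWE : exp_op (fun w => two_pi_i R *: YW u 0 w) = eexp (YW (- u) 0) (- two_pi_i R).
  apply/funext => x; rewrite -(exp_op_eexp (rYW (- u) 0) dW).
    by congr exp_op; apply/funext => y; rewrite YWopp scalerN scaleNr opprK.
  exact: scalar_separation (gm_graded W_module) (fun i => gm_fin_dim W_module i.1 i.2).
split; first by move=> n a; rewrite WtE' (WtE hS).
rewrite gE gWE genV WtE'.
exact: (twist_module hS (twist_duality hS)).
Qed.
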